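(* Let $n\ge 2$, let $\psi\in\mathcal{S}(\mathbb{R})$ be a non-trivial window (i.e. $\psi\not\equiv 0$) and let $\eta\in\mathcal{S}(\mathbb{R})$ be a reconstruction window for $\psi$. Then for all $f,h\in L^1(\mathbb{R}^n)\cap L^2(\mathbb{R}^n)$, $$\int_{\mathbb{R}^n}f(\mathbf{x})\overline{h(\mathbf{x})}\,d\mathbf{x}=\frac{1}{C_{\psi,\eta}}\int_{\mathbb{S}^{n-1}}\int_{\mathbb{R}^{\times}}\int_{\mathbb{R}}DS_\psi f(\mathbf{u},b,a)\,\overline{DS_\eta h(\mathbf{u},b,a)}\,|a|^{n-2}\,db\,da\,d\mathbf{u}.$$
   Context: $\mathbb{R}^\times=\mathbb{R}\setminus\{0\}$; $\mathbb{S}^{n-1}$ is the unit sphere of $\mathbb{R}^n$ and $d\mathbf{u}$ its surface measure. $\mathcal{S}(\mathbb{R})$ is the Schwartz space (complex-valued functions). The Fourier transform is $\widehat{g}(\boldsymbol{\xi})=\int g(\mathbf{x})e^{-i\mathbf{x}\cdot\boldsymbol{\xi}}\,d\mathbf{x}$. For $\psi\in\mathcal{S}(\mathbb{R})$ and $f\in L^1(\mathbb{R}^n)$, the directional Stockwell transform of $f$ is $$DS_\psi f(\mathbf{u},b,a)=\frac{|a|}{(2\pi)^{n/2}}\int_{\mathbb{R}^n}f(\mathbf{x})\,\overline{\psi\big(a(\mathbf{x}\cdot\mathbf{u}-b)\big)}\,e^{-ia(\mathbf{x}\cdot\mathbf{u})}\,d\mathbf{x},\qquad \mathbf{u}\in\mathbb{S}^{n-1},\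 b\in\mathbb{R},\ a\in\mathbb{R}^\times.$$ A function $\eta\in\mathcal{S}(\mathbb{R})$ is a reconstruction window for a non-trivial $\psi\in\mathcal{S}(\mathbb{R})$ if the (Lebesgue) integral $$C_{\psi,\eta}=\frac{1}{\pi}\int_{\mathbb{R}}\overline{\widehat{\psi}(\xi-1)}\,\widehat{\eta}(\xi-1)\,\frac{d\xi}{|\xi|^n}$$ is nonzero and finite. The triple integral is an iterated integral in the order written ($b$ innermost, then $a$, then $\mathbf{u}$). *)

(* Defs.v *)
From HB Require Import structures.
From mathcomp Require Import all_boot all_order all_algebra.
From mathcomp Require Import complex.
From mathcomp Require Import all_classical all_reals all_analysis.
From mathcomp Require Import measurable_realfun.

Set Implicit Arguments.
Unset Strict Implicit.
Unset Printing Implicit Defensive.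

Import Order.TTheory GRing.Theory Num.Theory.
Import numFieldNormedType.Exports.

Local Open Scope classical_set_scope.
Local Open Scope ring_scope.
Local Open Scope complex_scope.

Lemma sigma_finite_prod d1 d2 (T1 : measurableType d1) (T2 : measurableType d2)
    (R : realType) (m1 : {sigma_finite_measure set T1 -> \bar R})
    (m2 : {sigma_finite_measure set T2 -> \bar R}) :
  sigma_finite setT (m1 \x m2)%E.
Proof.
have /sigma_finiteP[F [TF ndF Foo]] := sigma_finiteT m1.
have /sigma_finiteP[G [TG ndG Goo]] := sigma_finiteT m2.
exists (fun n => F n `*` G n).
  rewrite -setXTT TF TG predeqE => -[x y]; split.
    move=> [/= [n _ Fnx] [k _ Gky]]; exists (maxn n k) => //; split.
    - by move: x Fnx; exact/subsetPset/ndF/leq_maxl.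
    - by move: y Gky; exact/subsetPset/ndG/leq_maxr.
  by move=> [n _ []/= ? ?]; split; exists n.
move=> k; have [? ?] := Foo k; have [? ?] := Goo k.
split; first exact: measurableX.
by rewrite product_measure1E// lte_mul_pinfty// ge0_fin_numE.
Qed.

(* R^n is [n.-tuple R] with its library sigma-algebra, generated by the
   coordinates, i.e. the Borel sets.  Its Lebesgue measure is the n-fold product
   of [lebesgue_measure], transported along (t, x) |-> t :: x. *)
Section lebesgue_cons.
Context {R : realType} {n : nat}.
Variable mu : {sigma_finite_measure set (n.-tuple R) -> \bar R}.

Definition tuple_cons (p : R * n.-tuple R) : n.+1.-tuple R :=
  [tuple of p.1 :: p.2].

Lemma measurable_tuple_cons : measurable_fun setT tuple_cons.
Proof. exact: measurable_cons. Qed.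

Definition lebesgue_cons : set (n.+1.-tuple R) -> \bar R :=
  pushforward (lebesgue_measure \x mu)%E tuple_cons.

Let lebesgue_cons0 : lebesgue_cons set0 = 0%E.
Proof. by rewrite /lebesgue_cons /pushforward preimage_set0 measure0. Qed.

Let lebesgue_cons_ge0 A : (0 <= lebesgue_cons A)%E.
Proof. by rewrite /lebesgue_cons /pushforward measure_ge0. Qed.

Let lebesgue_cons_sigma_additive : semi_sigma_additive lebesgue_cons.
Proof.
move=> F mF tF mUF; rewrite /lebesgue_cons /pushforward preimage_bigcup.
apply: measure_semi_sigma_additive.
- move=> k; rewrite -[X in measurable X]setTI.
  by apply: measurable_tuple_cons => //; exact: mF.
- apply/trivIsetP => /= i j _ _ ij; rewrite -preimage_setI.
  by move/trivIsetP : tF => /(_ _ _ _ _ ij) ->//; rewrite preimage_set0.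
- rewrite -preimage_bigcup -[X in measurable X]setTI.
  exact: measurable_tuple_cons.
Qed.

HB.instance Definition _ := isMeasure.Build _ _ _
  lebesgue_cons lebesgue_cons0 lebesgue_cons_ge0 lebesgue_cons_sigma_additive.

Let lebesgue_cons_sigma_finite : sigma_finite setT lebesgue_cons.
Proof.
have [F UF mF] : sigma_finite setT (lebesgue_measure \x mu)%E.
  exact: sigma_finite_prod.
pose uncons (x : n.+1.-tuple R) : R * n.-tuple R :=
  (thead x, [tuple of behead x]).
have tcK : cancel tuple_cons uncons.
  move=> [t x]; rewrite /uncons /tuple_cons /= theadE; congr pair.
  exact/val_inj.
have muncons : measurable_fun setT uncons.
  apply/measurable_fun_pair; first exact: measurable_tnth.
  exact: measurable_behead.
exists (fun k => uncons @^-1` F k).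
  by rewrite -preimage_bigcup -UF preimage_setT.
move=> k; have [mFk Fk] := mF k; split.
  by rewrite -[X in measurable X]setTI; exact: muncons.
rewrite /lebesgue_cons /pushforward -comp_preimage.
rewrite (_ : uncons \o tuple_cons = id) ?preimage_id//.
by apply/funext => p /=; rewrite tcK.
Qed.

HB.instance Definition _ := @Measure_isSigmaFinite.Build _ _ _
  lebesgue_cons lebesgue_cons_sigma_finite.

End lebesgue_cons.

Fixpoint lebesgue_tuple (R : realType) (n : nat) :
    {sigma_finite_measure set (n.-tuple R) -> \bar R} :=
  match n with
  | 0 => dirac [tuple]
  | m.+1 => lebesgue_cons (lebesgue_tuple R m)
  end.

Section euclidean.
Context {R : realType} {n : nat}.
Implicit Types x u : n.-tuple R.

Definition dotp x u : R := \sum_(i < n) tnth x i * tnth u i.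

Definition norm2 x : R := Num.sqrt (dotp x x).

Definition sphere : set (n.-tuple R) := [set u | norm2 u = 1].

Definition punctured_ball : set (n.-tuple R) := [set x | 0 < norm2 x <= 1].

Definition normalize x : n.-tuple R := [tuple tnth x i / norm2 x | i < n].

Lemma measurable_norm2 : measurable_fun setT norm2.
Proof.
apply: measurableT_comp.
  by apply: continuous_measurable_fun; exact: sqrt_continuous.
by apply: measurable_sum => i; apply: measurable_funM; exact: measurable_tnth.
Qed.

Lemma measurable_punctured_ball : measurable punctured_ball.
Proof.
rewrite (_ : punctured_ball = setT `&` norm2 @^-1` `]0, 1]).
  exact: measurable_norm2.
by apply/seteqP; split=> x /=; rewrite in_itv/=; [split|case].
Qed.

Lemma measurable_normalize : measurable_fun setT normalize.
Proof.
apply/measurable_fun_tnthP => i.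
rewrite (_ : _ \o _ = fun x => tnth x i * norm2 x `^ (-1)); last first.
  by apply/funext => x /=; rewrite tnth_mktuple powR_inv1// sqrtr_ge0.
apply: measurable_funM; first exact: measurable_tnth.
by apply: (measurableT_comp (measurable_powR _)); exact: measurable_norm2.
Qed.

(* The surface measure of the sphere, as the measure occurring in polar
   coordinates: sigma A = n * Leb {r *: u | u \in A, 0 < r <= 1}.  It lives on
   R^n and is carried by [sphere]. *)
Definition surface_measure : set (n.-tuple R) -> \bar R := fun A =>
  (n%:R%:E * lebesgue_tuple R n (punctured_ball `&` normalize @^-1` A))%E.

Let surface_measure0 : surface_measure set0 = 0%E.
Proof.
by rewrite /surface_measure preimage_set0 setI0 measure0 mule0.
Qed.

Let surface_measure_ge0 A : (0 <= surface_measure A)%E.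
Proof. by rewrite /surface_measure mule_ge0// lee_fin. Qed.

Let surface_measure_sigma_additive : semi_sigma_additive surface_measure.
Proof.
have mpre A : measurable A -> measurable (punctured_ball `&` normalize @^-1` A).
  move=> mA; apply: measurableI; first exact: measurable_punctured_ball.
  by rewrite -[X in measurable X]setTI; exact: measurable_normalize.
move=> F mF tF mUF; rewrite [X in _ --> X]/surface_measure.
rewrite [X in X @ _ --> _](_ : _ = fun k => n%:R%:E *
    \sum_(0 <= i < k)
      lebesgue_tuple R n (punctured_ball `&` normalize @^-1` F i))%E; last first.
  by apply/funext => k; rewrite ge0_sume_distrr.
apply: cvgeZl => //; rewrite preimage_bigcup setI_bigcupr.
apply: measure_semi_sigma_additive.
- by move=> k; exact: mpre.
- apply/trivIsetP => /= i j _ _ ij; rewrite setIACA setIid -preimage_setI.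
  by move/trivIsetP : tF => /(_ _ _ _ _ ij) ->//; rewrite preimage_set0 setI0.
- by rewrite -setI_bigcupr -preimage_bigcup; exact: mpre.
Qed.

HB.instance Definition _ := isMeasure.Build _ _ _ surface_measure
  surface_measure0 surface_measure_ge0 surface_measure_sigma_additive.

End euclidean.

Arguments sphere {R n}.
Arguments surface_measure {R n}.

Section complex_valued.
Context {d} {T : measurableType d} {R : realType}.
Variable mu : {measure set T -> \bar R}.
Implicit Types (D : set T) (f : T -> R[i]).

Definition cintegrable D f :=
  mu.-integrable D (EFin \o (@complex.Re R \o f)) /\
  mu.-integrable D (EFin \o (@complex.Im R \o f)).

Definition cintegral D f : R[i] :=
  (\int[mu]_(x in D) complex.Re (f x)) +i* (\int[mu]_(x in D) complex.Im (f x)).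

Definition cLfun (p : \bar R) f :=
  [/\ measurable_fun setT (@complex.Re R \o f),
      measurable_fun setT (@complex.Im R \o f) &
      finite_norm mu p (@Normc.normc R \o f)].

End complex_valued.

Section windows.
Context {R : realType}.
Local Notation leb := (@lebesgue_measure R).

Definition expi (t : R) : R[i] := cos t +i* sin t.

(* The derivatives of a complex-valued function of a real variable are taken
   componentwise. *)
Definition cderive1n (k : nat) (g : R -> R[i]) (x : R) : R[i] :=
  derive1n k (@complex.Re R \o g) x +i* derive1n k (@complex.Im R \o g) x.

Definition csmooth (g : R -> R[i]) :=
  forall (k : nat) (x : R),
    derivable (derive1n k (@complex.Re R \o g)) x 1 /\
    derivable (derive1n k (@complex.Im R \o g)) x 1.

Definition schwartz (g : R -> R[i]) :=
  csmooth g /\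
  forall j k : nat, exists C : R,
    forall x : R, `|x| ^+ j * Normc.normc (cderive1n k g x) <= C.

Definition fourier (g : R -> R[i]) (xi : R) : R[i] :=
  cintegral leb setT (fun x => g x * expi (- (x * xi))).

Definition admissibility_integrand (n : nat) (psi eta : R -> R[i]) (xi : R) :
    R[i] :=
  conjc (fourier psi (xi - 1)) * fourier eta (xi - 1) * ((`|xi| ^+ n)^-1)%:C.

Definition admissibility_constant (n : nat) (psi eta : R -> R[i]) : R[i] :=
  (pi^-1)%:C * cintegral leb setT (admissibility_integrand n psi eta).

(* [Rintegral], hence [cintegral], is total, with a meaningless value when the
   integral diverges: finiteness of the integral has to be stated apart. *)
Definition reconstruction_window (n : nat) (psi eta : R -> R[i]) :=
  [/\ schwartz eta,
      cintegrable leb setT (admissibility_integrand n psi eta) &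
      admissibility_constant n psi eta != 0].

Definition stockwell (n : nat) (psi : R -> R[i]) (f : n.-tuple R -> R[i])
    (u : n.-tuple R) (b a : R) : R[i] :=
  (`|a| / (2 * pi) `^ (n%:R / 2))%:C *
  cintegral (lebesgue_tuple R n) setT (fun x =>
    f x * conjc (psi (a * (dotp x u - b))) * expi (- (a * dotp x u))).

End windows.

(* Main.v *)
(* Let W(xi) = conj psi^(xi - 1) eta^(xi - 1) and Phi = f^ conj h^.  By Fubini the
   Fourier transform in b of DS_psi f(u, b, a) is
   (2 pi)^(-n/2) conj psi^(w / a) f^((w + a) u), so Parseval on the line and
   w = a (xi - 1) turn the integral in b, weighted by |a|^(n-2), into a constant
   times the integral over xi of W(xi) Phi(a xi u) |a|^(n-1).  Exchanging the a- and
   xi-integrals, the substitution s = a xi separates the variables: what comes out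
   is the integral of W(xi) / |xi|^n times that of Phi(s u) |s|^(n-1) over the line.
   Polar coordinates and Parseval on R^n then give the inner product of f and h.

   Plancherel's identity for a real function f in L1 and L2 is obtained by weighting
   |f^|^2 with exp(- e |xi|), whose transform is the Cauchy kernel: AM-GM gives one
   inequality as e tends to 0, dominated convergence gives equality for truncated
   continuous functions, and these are dense.  Slicing extends it to R^n. *)

From HB Require Import structures.
Require Import Defs.
From mathcomp Require Import all_boot all_order all_algebra.
From mathcomp Require Import complex ring lra.
From mathcomp Require Import all_classical all_reals all_analysis.
From mathcomp Require Import measurable_realfun.

Set Implicit Arguments.
Unset Strict Implicit.
Unset Printing Implicit Defensive.

Import Order.TTheory GRing.Theory Num.Theory.
Import numFieldNormedType.Exports.

Local Open Scope classical_set_scope.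
Local Open Scope ring_scope.
Local Open Scope complex_scope.

(** Absolute convergence is obtained differently at each stage. In [b], the transform is integrable
    by Tonelli and bounded because the window is, hence square integrable, so Parseval on the line
    applies for every [u] and every [a != 0]. In [(a, xi)], the double integral of the moduli
    factors into that of the admissibility integrand, finite by hypothesis, and that of
    [|Phi (s u)| |s|^(n-1)], which polar coordinates for [|Phi|] make finite for almost every [u];
    this is why the integrability in [a] is stated almost everywhere. The [1 / pi] of the
    admissibility constant is what remains of four factors: [(2 pi)^-1] from Parseval in [b],
    [(2 pi)^-n] from the normalization of the two transforms, [(2 pi)^n] from Parseval on [R^n], and
    [2] because the lines [R u] cover every half-line twice. The Cauchy kernel is positive and has
    mass [2 pi] whatever [e] is: positivity lets AM-GM pass under the integral, and the fixed mass
    makes the resulting bound uniform in [e]. *)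

Section lebesgue_affine.
Context {R : realType}.
Local Notation leb := (@lebesgue_measure R).

Let measurable_aff (a b : R) :
  measurable_fun setT (fun x => a * x + b : measurableTypeR R).
Proof. by apply: measurable_funD => //; exact: mulrl_measurable. Qed.

Let affm (a b : R) : {measure set (measurableTypeR R) -> \bar R} :=
  measure_function_pushforward__canonical__measure_function_Measure leb
    (measurable_aff a b).

(** The image of [leb] under the affine map, multiplied by [|a|], gives every interval []l, r]] its
    length, so it is [leb] by uniqueness. For [a < 0] the preimage is half-open on the other side,
    which does not change its length. *)
Lemma lebesgue_measure_affine (a b : R) (A : set R) : a != 0 -> measurable A ->
  leb ((fun x => a * x + b) @^-1` A) = (`|a|^-1%:E * leb A)%E.
Proof.
move=> a0 mA.
pose mu := mscale (NngNum (normr_ge0 a)) (affm a b).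
have -> : leb A = mu A.
  apply: lebesgue_measure_unique => // _ [[l r]] _ <- /=.
  rewrite /mu /mscale/= /pushforward.
  have [ap|an|/eqP] := ltrgt0P a; last by rewrite (negbTE a0).
  - rewrite (_ : _ @^-1` _ = `](l - b) / a, (r - b) / a]%classic); last first.
      apply/seteqP; split => x /=; rewrite !in_itv/= ltr_pdivrMr// ler_pdivlMr//;
        by rewrite ltrBlDr lerBrDr mulrC.
    rewrite !lebesgue_measure_itv/= !lte_fin ltr_pdivrMr// divfK// ltrD2r.
    case: ifP => _; last by rewrite mule0.
    by rewrite -!EFinB -EFinM; congr EFin; field.
  - rewrite (_ : _ @^-1` _ = `[(r - b) / a, (l - b) / a[%classic); last first.
      apply/seteqP; split => x /=; rewrite !in_itv/= ltr_ndivlMr// ler_ndivrMr//;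
        by rewrite ltrBlDr lerBrDr mulrC andbC.
    rewrite !lebesgue_measure_itv/= !lte_fin ltr_ndivrMr// divfK// ltrD2r.
    case: ifP => _; last by rewrite mule0.
    by rewrite -!EFinB -EFinM; congr EFin; field.
by rewrite /mu /mscale/= /pushforward muleA -EFinM mulVf ?mul1e// normr_eq0.
Qed.

Lemma ge0_integral_affine (a b : R) (f : R -> \bar R) : a != 0 ->
  measurable_fun setT f -> (forall x, 0 <= f x)%E ->
  (\int[leb]_x f (a * x + b)%R = `|a|^-1%:E * \int[leb]_x f x)%E.
Proof.
move=> a0 mf f0.
have := @ge0_integral_pushforward _ _ (measurableTypeR R) (measurableTypeR R) R _
  (measurable_aff a b) leb setT f
  measurableT mf (fun x _ => f0 x).
rewrite preimage_setT => <-.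
have k0 : 0 <= `|a|^-1 by rewrite invr_ge0.
rewrite (_ : `|a|^-1 = (NngNum k0)%:num)// -ge0_integral_mscale//.
apply: eq_measure_integral => /=; first exact: measurable_aff.
move=> pa A mA _; rewrite /mscale/= /pushforward/=.
exact: lebesgue_measure_affine.
Qed.

End lebesgue_affine.

(** * Fubini's theorem for real-valued iterated integrals *)

Lemma ae_eq_integrable {d} {T : measurableType d} {R : realType}
    (mu : {measure set T -> \bar R}) (D : set T) (f g : T -> \bar R) :
  measurable D -> measurable_fun D g -> ae_eq mu D f g ->
  mu.-integrable D f -> mu.-integrable D g.
Proof.
move=> mD mg fg /integrableP[mf foo]; apply/integrableP; split => //.
rewrite -(ae_eq_integral (fun x => `|g x|%E) (fun x => `|f x|%E))//.
- exact: measurableT_comp.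
- exact: measurableT_comp.
- exact: ae_eq_abse fg.
Qed.

Section real_fubini.
Context {d1 d2} {T1 : measurableType d1} {T2 : measurableType d2} {R : realType}.
Variable m1 : {sigma_finite_measure set T1 -> \bar R}.
Variable m2 : {sigma_finite_measure set T2 -> \bar R}.
Implicit Type g : T1 * T2 -> R.

(** The integral is by definition the difference of the integrals of the positive and negative
    parts, infinite values included, and Tonelli makes each of them measurable in the parameter. *)
Lemma measurable_eintegral1 (h : T1 * T2 -> \bar R) : measurable_fun setT h ->
  measurable_fun setT (fun x => \int[m2]_y h (x, y))%E.
Proof.
move=> mh.
rewrite (_ : (fun x => _) = (fun x => \int[m2]_y h^\+ (x, y)) \-
    (fun x => \int[m2]_y h^\- (x, y)))%E; last first.
  apply/funext => x; rewrite [LHS]integralE.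
  under eq_integral do rewrite funepos_comp/=.
  by under [X in (_ - X = _)%E]eq_integral do rewrite funeneg_comp/=.
apply: emeasurable_funB.
- by apply: measurable_fun_fubini_tonelli_F => //; exact: measurable_funepos.
- by apply: measurable_fun_fubini_tonelli_F => //; exact: measurable_funeneg.
Qed.

Lemma measurable_Rintegral1 g : measurable_fun setT g ->
  measurable_fun setT (fun x => \int[m2]_y g (x, y)).
Proof.
move=> mg; apply: (measurableT_comp (fine_measurable measurableT)) => //.
by apply: (@measurable_eintegral1 (EFin \o g)); exact/measurable_EFinP.
Qed.

Lemma measurable_eintegral2 (h : T1 * T2 -> \bar R) : measurable_fun setT h ->
  measurable_fun setT (fun y => \int[m1]_x h (x, y))%E.
Proof.
move=> mh.
rewrite (_ : (fun y => _) = (fun y => \int[m1]_x h^\+ (x, y)) \-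
    (fun y => \int[m1]_x h^\- (x, y)))%E; last first.
  apply/funext => y; rewrite [LHS]integralE.
  under eq_integral do rewrite funepos_comp/=.
  by under [X in (_ - X = _)%E]eq_integral do rewrite funeneg_comp/=.
apply: emeasurable_funB.
- by apply: measurable_fun_fubini_tonelli_G => //; exact: measurable_funepos.
- by apply: measurable_fun_fubini_tonelli_G => //; exact: measurable_funeneg.
Qed.

Lemma measurable_Rintegral2 g : measurable_fun setT g ->
  measurable_fun setT (fun y => \int[m1]_x g (x, y)).
Proof.
move=> mg; apply: (measurableT_comp (fine_measurable measurableT)) => //.
by apply: (@measurable_eintegral2 (EFin \o g)); exact/measurable_EFinP.
Qed.

(** The inner real integral is [fine] of the extended one, so the two differ only where a section
    fails to be integrable; this is a null set, and Fubini's theorem for extended values carries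
    over. *)
Lemma integral12_Rintegral g : (m1 \x m2)%E.-integrable setT (EFin \o g) ->
  m1.-integrable setT (EFin \o (fun x => \int[m2]_y g (x, y))) /\
  \int[m1]_x \int[m2]_y g (x, y) = \int[(m1 \x m2)%E]_z g z.
Proof.
move=> ig; have mg : measurable_fun setT g.
  by apply/measurable_EFinP; exact: measurable_int ig.
have iF := integrable_fubini_F ig.
have mF := measurable_Rintegral1 mg.
have E : ae_eq m1 setT (EFin \o (fun x => \int[m2]_y g (x, y)))
    (fubini_F m2 (EFin \o g)).
  apply: filterS (ae_integrable1 ig) => x ix _ /=.
  by rewrite /Rintegral fineK// integrable_fin_num.
have mE : measurable_fun setT (EFin \o (fun x => \int[m2]_y g (x, y))).
  exact/measurable_EFinP.
split; first exact: ae_eq_integrable (ae_eq_sym E) iF.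
by congr fine; rewrite -(integral12_prod_meas1 ig);
  apply: ae_eq_integral E => //; exact: measurable_int iF.
Qed.

Lemma integral21_Rintegral g : (m1 \x m2)%E.-integrable setT (EFin \o g) ->
  m2.-integrable setT (EFin \o (fun y => \int[m1]_x g (x, y))) /\
  \int[m2]_y \int[m1]_x g (x, y) = \int[(m1 \x m2)%E]_z g z.
Proof.
move=> ig; have mg : measurable_fun setT g.
  by apply/measurable_EFinP; exact: measurable_int ig.
have iF : m2.-integrable setT (fubini_G m1 (EFin \o g)).
  have mEg : measurable_fun setT (EFin \o g) by exact/measurable_EFinP.
  apply/integrableP; split; first exact: measurable_fubini_G ig.
  apply: le_lt_trans ((integrable21ltyP _ _ mEg).1 ig).
  apply: ge0_le_integral => //.
  - by apply: measurableT_comp => //; exact: measurable_fubini_G ig.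
  - apply: (measurable_fun_fubini_tonelli_G (abse \o (EFin \o g))).
    + exact: measurableT_comp.
    + by move=> z; exact: abse_ge0.
  - move=> y _; apply: le_abse_integral => //.
    exact: (measurableT_comp mEg (pair2_measurable _)).
have mF := measurable_Rintegral2 mg.
have E : ae_eq m2 setT (EFin \o (fun y => \int[m1]_x g (x, y)))
    (fubini_G m1 (EFin \o g)).
  apply: filterS (ae_integrable2 ig) => x ix _ /=.
  by rewrite /Rintegral fineK// integrable_fin_num.
have mE : measurable_fun setT (EFin \o (fun y => \int[m1]_x g (x, y))).
  exact/measurable_EFinP.
split; first exact: ae_eq_integrable (ae_eq_sym E) iF.
by congr fine; rewrite -(integral21_prod_meas1 ig);
  apply: ae_eq_integral E => //; exact: measurable_int iF.
Qed.

End real_fubini.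

(** * Complex-valued integrals *)

Section complex_basic.
Context {R : realType}.
Implicit Types (x y z : R[i]) (r : R).
Local Notation normc := (@Normc.normc R).

(** The squared modulus, kept as a polynomial in the two parts so that identities between squared
    norms are decided by [ring] and [field], without square roots. *)
Definition nsqc z : R := complex.Re z ^+ 2 + complex.Im z ^+ 2.

Lemma nsqc_ge0 z : 0 <= nsqc z.
Proof. by rewrite addr_ge0 ?sqr_ge0. Qed.

Lemma normcE z : normc z = Num.sqrt (nsqc z).
Proof. by case: z. Qed.

Lemma normc_ge0 z : 0 <= normc z.
Proof. by rewrite normcE sqrtr_ge0. Qed.

Lemma sqr_normc z : normc z ^+ 2 = nsqc z.
Proof. by rewrite normcE sqr_sqrtr// nsqc_ge0. Qed.

Lemma nsqcM x y : nsqc (x * y) = nsqc x * nsqc y.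
Proof. by rewrite -!sqr_normc Normc.normcM exprMn. Qed.

Lemma Re_le_normc z : `|complex.Re z| <= normc z.
Proof. by rewrite normcE -sqrtr_sqr ler_sqrt ?nsqc_ge0// lerDl sqr_ge0. Qed.

Lemma Im_le_normc z : `|complex.Im z| <= normc z.
Proof. by rewrite normcE -sqrtr_sqr ler_sqrt ?nsqc_ge0// lerDr sqr_ge0. Qed.

Lemma normc_le_ReIm z : normc z <= `|complex.Re z| + `|complex.Im z|.
Proof.
rewrite normcE -(ler_pXn2r (n:=2))//; rewrite ?nnegrE ?sqrtr_ge0 ?addr_ge0//.
rewrite sqr_sqrtr ?nsqc_ge0// sqrrD !real_normK ?num_real// /nsqc.
have : 0 <= `|complex.Re z| * `|complex.Im z| by exact: mulr_ge0.
by rewrite mulr2n; lra.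
Qed.

Lemma normc_conjc z : normc (conjc z) = normc z.
Proof. by case: z => a b; rewrite !normcE /nsqc/= sqrrN. Qed.

Lemma normc_real r : normc r%:C = `|r|.
Proof. by rewrite normcE /nsqc/= expr0n/= addr0 sqrtr_sqr. Qed.

Lemma ReD x y : complex.Re (x + y) = complex.Re x + complex.Re y.
Proof. by case: x; case: y. Qed.
Lemma ImD x y : complex.Im (x + y) = complex.Im x + complex.Im y.
Proof. by case: x; case: y. Qed.
Lemma ReN x : complex.Re (- x) = - complex.Re x.
Proof. by case: x. Qed.
Lemma ImN x : complex.Im (- x) = - complex.Im x.
Proof. by case: x. Qed.
Lemma ReM x y : complex.Re (x * y) =
  complex.Re x * complex.Re y - complex.Im x * complex.Im y.
Proof. by case: x; case: y. Qed.
Lemma ImM x y : complex.Im (x * y) =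
  complex.Re x * complex.Im y + complex.Im x * complex.Re y.
Proof. by case: x; case: y. Qed.
Lemma ReJ x : complex.Re (conjc x) = complex.Re x.
Proof. by case: x. Qed.
Lemma ImJ x : complex.Im (conjc x) = - complex.Im x.
Proof. by case: x. Qed.

Lemma complexP x y : complex.Re x = complex.Re y -> complex.Im x = complex.Im y ->
  x = y.
Proof. by case: x; case: y => a b c e /= -> ->. Qed.

Lemma normc_expi r : normc (expi r) = 1.
Proof. by rewrite normcE /nsqc/= cos2Dsin2 sqrtr1. Qed.

Lemma expiD r s : expi (r + s) = expi r * expi s.
Proof. by apply: complexP; rewrite ?ReM ?ImM/= ?cosD ?sinD//; ring. Qed.

Lemma conjc_expi r : conjc (expi r) = expi (- r).
Proof. by apply: complexP; rewrite ?ReJ ?ImJ/= ?cosN ?sinN. Qed.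

End complex_basic.

Definition cE := (@ReD, @ImD, @ReN, @ImN, @ReM, @ImM, @ReJ, @ImJ).

Lemma integrable_EFinZl {d} {T : measurableType d} {R : realType}
    (mu : {measure set T -> \bar R}) (f : T -> R) (c : R) :
  mu.-integrable setT (EFin \o f) ->
  mu.-integrable setT (EFin \o (fun x => c * f x)).
Proof. exact: integrableZl. Qed.

Section complex_measurable.
Context {R : realType}.
Local Notation normc := (@Normc.normc R).

Definition cmeas {d} {T : measurableType d} (f : T -> R[i]) :=
  measurable_fun setT (@complex.Re R \o f) /\
  measurable_fun setT (@complex.Im R \o f).

Section closure.
Context {d} {T : measurableType d}.
Implicit Types f g : T -> R[i].

Lemma cmeasD f g : cmeas f -> cmeas g -> cmeas (fun x => f x + g x).
Proof.
case=> f1 f2 [g1 g2]; split.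
- rewrite (_ : _ \o _ = (@complex.Re R \o f) \+ (@complex.Re R \o g)).
    exact: measurable_funD.
  by apply/funext => x /=; rewrite ReD.
- rewrite (_ : _ \o _ = (@complex.Im R \o f) \+ (@complex.Im R \o g)).
    exact: measurable_funD.
  by apply/funext => x /=; rewrite ImD.
Qed.

Lemma cmeasM f g : cmeas f -> cmeas g -> cmeas (fun x => f x * g x).
Proof.
case=> f1 f2 [g1 g2]; split.
- rewrite (_ : _ \o _ = (@complex.Re R \o f) \* (@complex.Re R \o g) \-
    (@complex.Im R \o f) \* (@complex.Im R \o g)).
    by apply: measurable_funB; exact: measurable_funM.
  by apply/funext => x /=; rewrite ReM.
- rewrite (_ : _ \o _ = (@complex.Re R \o f) \* (@complex.Im R \o g) \+
    (@complex.Im R \o f) \* (@complex.Re R \o g)).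
    by apply: measurable_funD; exact: measurable_funM.
  by apply/funext => x /=; rewrite ImM.
Qed.

Lemma cmeasJ f : cmeas f -> cmeas (fun x => conjc (f x)).
Proof.
case=> f1 f2; split.
- rewrite (_ : _ \o _ = @complex.Re R \o f)//.
  by apply/funext => x /=; rewrite ReJ.
- rewrite (_ : _ \o _ = \- (@complex.Im R \o f)); first exact: measurable_funN.
  by apply/funext => x /=; rewrite ImJ.
Qed.

Lemma cmeas_cst c : cmeas (fun _ : T => c).
Proof. by split; exact: measurable_cst. Qed.

Lemma cmeas_real (r : T -> R) : measurable_fun setT r -> cmeas (fun x => (r x)%:C).
Proof. by move=> mr; split => //; exact: measurable_cst. Qed.

Lemma cmeas_expi (r : T -> R) : measurable_fun setT r -> cmeas (fun x => expi (r x)).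
Proof.
move=> mr; split; rewrite /comp /=.
- apply: measurableT_comp mr; apply: continuous_measurable_fun.
  exact: continuous_cos.
- apply: measurableT_comp mr; apply: continuous_measurable_fun.
  exact: continuous_sin.
Qed.

Lemma measurable_nsqc f : cmeas f -> measurable_fun setT (fun x => nsqc (f x)).
Proof.
by case=> f1 f2; apply: measurable_funD; exact: measurable_funX.
Qed.

Lemma measurable_normc f : cmeas f -> measurable_fun setT (fun x => normc (f x)).
Proof.
move=> mf; under eq_fun do rewrite normcE.
apply: (measurableT_comp (f := @Num.sqrt R)); last exact: measurable_nsqc.
by apply: continuous_measurable_fun; exact: sqrt_continuous.
Qed.

Lemma cmeas_comp {d'} {T' : measurableType d'} f (phi : T' -> T) :
  cmeas f -> measurable_fun setT phi -> cmeas (fun x => f (phi x)).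
Proof.
case=> f1 f2 mphi; split.
- exact: (measurableT_comp f1 mphi).
- exact: (measurableT_comp f2 mphi).
Qed.

End closure.

Section cintegral_domain.
Context {d} {T : measurableType d}.
Variables (mu : {measure set T -> \bar R}) (D : set T).
Hypothesis mD : measurable D.

Lemma cintegrableZl_in (c : R[i]) f : cintegrable mu D f ->
  cintegrable mu D (fun x => c * f x).
Proof.
case=> f1 f2; split; rewrite /comp.
- under eq_fun do rewrite ReM EFinB !EFinM.
  by apply: integrableB => //; exact: integrableZl.
- under eq_fun do rewrite ImM EFinD !EFinM.
  by apply: integrableD => //; exact: integrableZl.
Qed.

Lemma cintegralZl_in (c : R[i]) f : cintegrable mu D f ->
  cintegral mu D (fun x => c * f x) = c * cintegral mu D f.
Proof.
have iZ (k : R) (g : T -> R) : mu.-integrable D (EFin \o g) ->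
    mu.-integrable D (EFin \o (fun x => k * g x)) by exact: integrableZl.
case=> f1 f2; apply: complexP; rewrite ?ReM ?ImM /cintegral/=.
- rewrite -!RintegralZl// -RintegralB//; try exact: iZ.
  by apply: eq_Rintegral => x _; rewrite ReM.
- rewrite -!RintegralZl// -RintegralD//; try exact: iZ.
  by apply: eq_Rintegral => x _; rewrite ImM.
Qed.

Lemma ae_eq_cintegrable_in f g : cmeas g ->
  {ae mu, forall x, D x -> f x = g x} -> cintegrable mu D f -> cintegrable mu D g.
Proof.
case=> g1 g2 fg [f1 f2]; split.
- apply: (ae_eq_integrable mD _ _ f1).
    by apply: measurable_funTS; apply/measurable_EFinP.
  by apply: filterS fg => x /= h Dx; rewrite h.
- apply: (ae_eq_integrable mD _ _ f2).
    by apply: measurable_funTS; apply/measurable_EFinP.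
  by apply: filterS fg => x /= h Dx; rewrite h.
Qed.

Lemma ae_eq_cintegral_in f g : cmeas g -> cintegrable mu D f ->
  {ae mu, forall x, D x -> f x = g x} -> cintegral mu D f = cintegral mu D g :> R[i].
Proof.
case=> g1 g2 [/measurable_int f1 /measurable_int f2] fg.
apply: complexP; congr fine; apply: ae_eq_integral => //;
  try (by apply: measurable_funTS; apply/measurable_EFinP);
  by apply: filterS fg => x /= h Dx; rewrite h.
Qed.

Lemma eq_cintegral f g : (forall x, D x -> f x = g x) ->
  cintegral mu D f = cintegral mu D g :> R[i].
Proof.
by move=> fg; apply: complexP; apply: eq_Rintegral => x /set_mem Dx; rewrite fg.
Qed.

Lemma eq_cintegrable f g : (forall x, D x -> f x = g x) ->
  cintegrable mu D f -> cintegrable mu D (g : T -> R[i]).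
Proof.
by move=> fg [f1 f2]; split;
  [apply: (eq_integrable mD _ _ _ f1)|apply: (eq_integrable mD _ _ _ f2)];
  move=> x /set_mem Dx /=; rewrite fg.
Qed.

End cintegral_domain.

Section integral.
Context {d} {T : measurableType d}.
Variable mu : {measure set T -> \bar R}.
Implicit Types f g : T -> R[i].

(** Both directions come from [|Re z|, |Im z| <= |z| <= |Re z| + |Im z|]. The modulus form is the
    one on which Tonelli operates. *)
Lemma cintegrableP f : cintegrable mu setT f <->
  cmeas f /\ (\int[mu]_x (normc (f x))%:E < +oo)%E.
Proof.
split=> [[/integrableP[f1 i1] /integrableP[f2 i2]]|[mf fi]].
  have m1 : measurable_fun setT (@complex.Re R \o f) by exact/measurable_EFinP.
  have m2 : measurable_fun setT (@complex.Im R \o f) by exact/measurable_EFinP.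
  split => //; apply: le_lt_trans (lte_add_pinfty i1 i2).
  have ma1 : measurable_fun setT (abse \o (EFin \o (@complex.Re R \o f))).
    exact: measurableT_comp.
  have ma2 : measurable_fun setT (abse \o (EFin \o (@complex.Im R \o f))).
    exact: measurableT_comp.
  rewrite -ge0_integralD//; apply: ge0_le_integral => //.
  - by move=> x _; rewrite lee_fin normc_ge0.
  - by apply/measurable_EFinP; exact: measurable_normc.
  - exact: emeasurable_funD.
  - by move=> x _; rewrite lee_fin normc_le_ReIm.
have mn : measurable_fun setT (fun x => (normc (f x))%:E).
  by apply/measurable_EFinP; exact: measurable_normc.
case: (mf) => f1 f2.
split; apply/integrableP; split; try exact/measurable_EFinP;
  apply: le_lt_trans fi; apply: ge0_le_integral => //;
  try (by apply: measurableT_comp => //; exact/measurable_EFinP);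
  move=> x _; rewrite lee_fin ?Re_le_normc ?Im_le_normc//.
Qed.

Lemma cintegrable_norm f : cintegrable mu setT f ->
  (\int[mu]_x (normc (f x))%:E < +oo)%E.
Proof. by case/cintegrableP. Qed.

Lemma cintegrable_meas f : cintegrable mu setT f -> cmeas f.
Proof. by case/cintegrableP. Qed.

Lemma cintegrable_le f g : cmeas f -> cintegrable mu setT g ->
  (forall x, normc (f x) <= normc (g x)) -> cintegrable mu setT f.
Proof.
move=> mf ig fg; apply/cintegrableP; split => //.
apply: le_lt_trans (cintegrable_norm ig); apply: ge0_le_integral => //.
- by move=> x _; rewrite lee_fin normc_ge0.
- by apply/measurable_EFinP; exact: measurable_normc.
- by apply/measurable_EFinP/measurable_normc/cintegrable_meas.
- by move=> x _; rewrite lee_fin.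
Qed.

Lemma cintegrableD f g : cintegrable mu setT f -> cintegrable mu setT g ->
  cintegrable mu setT (fun x => f x + g x).
Proof.
case=> f1 f2 [g1 g2]; split; rewrite /comp;
  under eq_fun do rewrite ?ReD ?ImD EFinD; exact: integrableD.
Qed.

Lemma cintegrableZl c f : cintegrable mu setT f ->
  cintegrable mu setT (fun x => c * f x).
Proof. exact: cintegrableZl_in. Qed.

Lemma cintegrableJ f : cintegrable mu setT f ->
  cintegrable mu setT (fun x => conjc (f x)).
Proof.
move=> fi; have [mf ni] := (cintegrableP f).1 fi.
apply/cintegrableP; split; first exact: cmeasJ.
by under eq_integral do rewrite normc_conjc.
Qed.

Lemma cintegralD f g : cintegrable mu setT f -> cintegrable mu setT g ->
  cintegral mu setT (fun x => f x + g x) =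
  cintegral mu setT f + cintegral mu setT g.
Proof.
case=> f1 f2 [g1 g2]; apply: complexP => /=.
- by rewrite -RintegralD//; apply: eq_Rintegral => x _; rewrite ReD.
- by rewrite -RintegralD//; apply: eq_Rintegral => x _; rewrite ImD.
Qed.

Lemma cintegralZl c f : cintegrable mu setT f ->
  cintegral mu setT (fun x => c * f x) = c * cintegral mu setT f.
Proof. exact: cintegralZl_in. Qed.

Lemma cintegralJ f : cintegrable mu setT f ->
  cintegral mu setT (fun x => conjc (f x)) = conjc (cintegral mu setT f).
Proof.
case=> f1 f2; apply: complexP; rewrite ?ReJ ?ImJ /cintegral/=.
- by apply: eq_Rintegral => x _; rewrite ReJ.
- rewrite -mulN1r -RintegralZl//.
  by apply: eq_Rintegral => x _; rewrite ImJ mulN1r.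
Qed.

(* The constant 2 is not optimal, but only finiteness matters here. *)
Lemma normc_cintegral_le f : cintegrable mu setT f ->
  ((normc (cintegral mu setT f))%:E <= 2%:E * \int[mu]_x (normc (f x))%:E)%E.
Proof.
move=> ifn; have [f1 f2] := ifn; have [[m1 m2] _] := (cintegrableP f).1 ifn.
have mn : measurable_fun setT (fun x => (normc (f x))%:E).
  by apply/measurable_EFinP; apply: measurable_normc.
rewrite (le_trans (y := (`|complex.Re (cintegral mu setT f)| +
  `|complex.Im (cintegral mu setT f)|)%:E))//; first by rewrite lee_fin normc_le_ReIm.
rewrite mule_natl mule2n EFinD/=; apply: leeD.
- rewrite EFin_normr_Rintegral//.
  apply: le_trans.
    by apply: le_abse_integral => //; exact/measurable_EFinP.
  apply: ge0_le_integral => //.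
  + by apply: measurableT_comp => //; exact/measurable_EFinP.
  + by move=> x _; rewrite lee_fin Re_le_normc.
- rewrite EFin_normr_Rintegral//.
  apply: le_trans.
    by apply: le_abse_integral => //; exact/measurable_EFinP.
  apply: ge0_le_integral => //.
  + by apply: measurableT_comp => //; exact/measurable_EFinP.
  + by move=> x _; rewrite lee_fin Im_le_normc.
Qed.

Lemma ae_eq_cintegral f g : cmeas f -> cmeas g ->
  {ae mu, forall x, f x = g x} -> cintegral mu setT f = cintegral mu setT g.
Proof.
case=> f1 f2 [g1 g2] fg; apply: complexP; congr fine; apply: ae_eq_integral => //;
  try exact/measurable_EFinP; by apply: filterS fg => x -> _.
Qed.

End integral.

Section fubini.
Context {d1 d2} {T1 : measurableType d1} {T2 : measurableType d2}.
Variable m1 : {sigma_finite_measure set T1 -> \bar R}.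
Variable m2 : {sigma_finite_measure set T2 -> \bar R}.
Implicit Type f : T1 * T2 -> R[i].

Lemma cmeas_cintegral1 f : cmeas f ->
  cmeas (fun x => cintegral m2 setT (fun y => f (x, y))).
Proof.
case=> f1 f2; split.
- exact: (measurable_Rintegral1 m2 f1).
- exact: (measurable_Rintegral1 m2 f2).
Qed.

Lemma cmeas_cintegral2 f : cmeas f ->
  cmeas (fun y => cintegral m1 setT (fun x => f (x, y))).
Proof.
case=> f1 f2; split.
- exact: (measurable_Rintegral2 m1 f1).
- exact: (measurable_Rintegral2 m1 f2).
Qed.

Lemma cfubini1 f : cintegrable (m1 \x m2)%E setT f ->
  cintegrable m1 setT (fun x => cintegral m2 setT (fun y => f (x, y))) /\
  cintegral m1 setT (fun x => cintegral m2 setT (fun y => f (x, y))) =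
  cintegral (m1 \x m2)%E setT f.
Proof.
case=> f1 f2.
have [i1 e1] := integral12_Rintegral f1; have [i2 e2] := integral12_Rintegral f2.
by split; [split|exact: complexP].
Qed.

Lemma cfubini2 f : cintegrable (m1 \x m2)%E setT f ->
  cintegrable m2 setT (fun y => cintegral m1 setT (fun x => f (x, y))) /\
  cintegral m2 setT (fun y => cintegral m1 setT (fun x => f (x, y))) =
  cintegral (m1 \x m2)%E setT f.
Proof.
case=> f1 f2.
have [i1 e1] := integral21_Rintegral f1; have [i2 e2] := integral21_Rintegral f2.
by split; [split|exact: complexP].
Qed.

Lemma cintegrable_prod1 f : cmeas f ->
  (\int[m1]_x \int[m2]_y (normc (f (x, y)))%:E < +oo)%E ->
  cintegrable (m1 \x m2)%E setT f.
Proof.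
move=> mf fi; apply/cintegrableP; split => //.
rewrite (fubini_tonelli1 (fun z => (normc (f z))%:E))//.
- by apply/measurable_EFinP; exact: measurable_normc.
- by move=> z; rewrite lee_fin normc_ge0.
Qed.

Lemma cintegrable_prod2 f : cmeas f ->
  (\int[m2]_y \int[m1]_x (normc (f (x, y)))%:E < +oo)%E ->
  cintegrable (m1 \x m2)%E setT f.
Proof.
move=> mf fi; apply/cintegrableP; split => //.
rewrite (fubini_tonelli2 (fun z => (normc (f z))%:E))//.
- by apply/measurable_EFinP; exact: measurable_normc.
- by move=> z; rewrite lee_fin normc_ge0.
Qed.

Lemma ae_cintegrable2 f : cintegrable (m1 \x m2)%E setT f ->
  {ae m2, forall y, cintegrable m1 setT (fun x => f (x, y))}.
Proof.
case=> f1 f2; apply: filterS2 (ae_integrable2 f1) (ae_integrable2 f2).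
by move=> x; split.
Qed.

End fubini.
End complex_measurable.

(** * Plancherel's identity on the line *)

Section cauchy_kernel.
Context {R : realType}.
Local Notation leb := (@lebesgue_measure R).
Implicit Types e t x : R.

(** This is the Fourier transform of [exp (- e |x|)], that is [2 pi] times the Poisson kernel of the
    half-plane at height [e]. *)
Definition cauchy_kernel e t : R := 2 * e / (e ^+ 2 + t ^+ 2).

Let den_gt0 e t : 0 < e -> 0 < e ^+ 2 + t ^+ 2.
Proof. by move=> e0; rewrite ltr_pwDl ?exprn_gt0// sqr_ge0. Qed.

Lemma cauchy_kernel_ge0 e t : 0 < e -> 0 <= cauchy_kernel e t.
Proof. by move=> e0; rewrite divr_ge0 ?mulr_ge0 ?(ltW e0) ?(ltW (den_gt0 _ _)). Qed.

(** After a dilation by [e] the kernel no longer depends on [e], which provides the fixed majorant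
    for the limit [e -> 0]. *)
Lemma cauchy_kernel_scale e t : 0 < e -> e * cauchy_kernel e (e * t) = cauchy_kernel 1 t.
Proof.
move=> e0; have := den_gt0 t ltr01; have := den_gt0 (e * t) e0.
rewrite /cauchy_kernel => p1 p2.
field; rewrite !lt0r_neq0//.
by rewrite (_ : _ + _ = 1 ^+ 2 + t ^+ 2)//; ring.
Qed.

Let primitive e t x : R := - expR (- (e * x)) / e
  + expR (- (e * x)) * (t * sin (t * x) - e * cos (t * x)) / (e ^+ 2 + t ^+ 2).

Let is_derive_primitive e t x : 0 < e ->
  is_derive x 1 (primitive e t) (expR (- (e * x)) * (1 + cos (t * x))).
Proof.
move=> e0; apply: is_derive_eq; rewrite /GRing.scale/=.
by field; rewrite !lt0r_neq0// den_gt0.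
Qed.

Let cvg_primitive e t : 0 < e -> primitive e t x @[x --> +oo] --> (0 : R).
Proof.
move=> e0; pose K := e^-1 + (`|t| + e) / (e ^+ 2 + t ^+ 2).
have cE : K * expR (- (e * x)) @[x --> +oo] --> (0 : R).
  rewrite -[X in _ --> X](mulr0 K); apply: cvgMr.
  apply: (@cvg_comp _ _ _ ( *%R e) (fun x => expR (- x)) _
    (pinfty_nbhs R)); last exact: cvgr_expR.
  exact: gt0_cvgMry.
have bnd x : `|primitive e t x| <= K * expR (- (e * x)).
  rewrite (_ : primitive e t x = (- e^-1 + (t * sin (t * x) - e * cos (t * x)) /
    (e ^+ 2 + t ^+ 2)) * expR (- (e * x))); last by rewrite /primitive; ring.
  rewrite normrM [X in _ * X]ger0_norm ?expR_ge0// ler_wpM2r ?expR_ge0//.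
  rewrite (le_trans (ler_normD _ _))// normrN (gtr0_norm (x := e^-1)) ?invr_gt0// lerD2l.
  rewrite normrM [X in _ * X]gtr0_norm ?invr_gt0 ?den_gt0// ler_wpM2r//.
    by rewrite invr_ge0 ltW// den_gt0.
  rewrite (le_trans (ler_normB _ _))// !normrM (gtr0_norm e0) lerD//.
  - by rewrite ler_piMr// ler_norml sin_geN1 sin_le1.
  - by rewrite ler_piMr ?(ltW e0)// ler_norml cos_geN1 cos_le1.
apply: (@squeeze_cvgr _ _ _ _ (fun x => - (K * expR (- (e * x))))
   (fun x => K * expR (- (e * x)))) => //.
- by apply: nearW => x; have := bnd x; rewrite ler_norml.
- by rewrite -oppr0; exact: cvgN.
Qed.

(** Adding 1 to the cosine makes the integrand nonnegative, as the fundamental theorem of calculus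
    on a half-line asks here; the extra term is subtracted again in [integral_cos_cauchy_weight]. *)
Let integral_half e t : 0 < e ->
  (\int[leb]_(x in `[0%R, +oo[) (expR (- (e * x)) * (1 + cos (t * x)))%:E =
  (e^-1 + e / (e ^+ 2 + t ^+ 2))%:E)%E.
Proof.
move=> e0.
rewrite (@ge0_continuous_FTC2y _ _ (primitive e t) _ 0).
- rewrite /primitive !mulr0 oppr0 expR0 sin0 cos0 -EFinB; congr EFin; ring.
- by move=> x _; rewrite mulr_ge0 ?expR_ge0// -lerBlDl sub0r cos_geN1.
- apply: continuous_subspaceT => x; apply: cvgM.
    by apply: continuous_comp; [|exact: continuous_expR]; apply: cvgN;
      exact: mulrl_continuous.
  apply: cvgD; first exact: cvg_cst.
  by apply: continuous_comp; [exact: mulrl_continuous|exact: continuous_cos].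
- exact: cvg_primitive.
- by move=> x _; have [] := is_derive_primitive t x e0.
- apply: cvg_at_right_filter; apply: differentiable_continuous.
  by apply/derivable1_diffP; have [] := is_derive_primitive t 0 e0.
- move=> x _; rewrite derive1E.
  by have /@derive_val := is_derive_primitive t x e0.
Qed.

Let integral_even e t : 0 < e ->
  (\int[leb]_x (expR (- (e * `|x|)) * (1 + cos (t * x)))%:E =
  (2 * (e^-1 + e / (e ^+ 2 + t ^+ 2)))%:E)%E.
Proof.
move=> e0; rewrite ge0_symfun_integralT.
- rewrite EFinM -integral_half// -set_itvcy; congr (_ * _)%E.
  apply: eq_integral => x; rewrite inE/= in_itv/= andbT => x0.
  by rewrite ger0_norm.
- by move=> x; rewrite mulr_ge0 ?expR_ge0// -lerBlDl sub0r cos_geN1.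
- move=> x; apply: cvgM.
    apply: continuous_comp; [|exact: continuous_expR]; apply: cvgN.
    by apply: cvgMr; exact: norm_continuous.
  apply: cvgD; first exact: cvg_cst.
  by apply: continuous_comp; [exact: mulrl_continuous|exact: continuous_cos].
- by move=> x /=; rewrite normrN mulrN cosN.
Qed.

Definition cauchy_weight e (x : R) : R := expR (- (e * `|x|)).

Lemma measurable_cauchy_weight e : measurable_fun setT (cauchy_weight e).
Proof.
apply: continuous_measurable_fun => x.
apply: continuous_comp; [|exact: continuous_expR]; apply: cvgN.
by apply: cvgMr; exact: norm_continuous.
Qed.

Lemma cauchy_weight_ge0 e x : 0 <= cauchy_weight e x.
Proof. exact: expR_ge0. Qed.

Lemma integrable_cauchy_weight e : 0 < e ->
  leb.-integrable setT (EFin \o cauchy_weight e).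
Proof.
move=> e0; have mw := measurable_cauchy_weight e.
apply/integrableP; split; first exact/measurable_EFinP.
have := integral_even 0 e0; under eq_integral do rewrite mul0r cos0.
move=> /(congr1 (fun z => z < +oo)%E); rewrite ltry => h.
apply: le_lt_trans h; apply: ge0_le_integral => //.
- by apply: measurableT_comp => //; exact/measurable_EFinP.
- by apply/measurable_EFinP; apply: measurable_funM.
- move=> x _; rewrite /= lee_fin ger0_norm ?expR_ge0// ler_peMr ?expR_ge0//.
  by rewrite lerDl.
Qed.

Lemma integrable_cos_cauchy_weight e t : 0 < e ->
  leb.-integrable setT (EFin \o (fun x => cos (t * x) * cauchy_weight e x)).
Proof.
move=> e0; apply: le_integrable (integrable_cauchy_weight e0) => //.
- apply/measurable_EFinP; apply: measurable_funM; last exact: measurable_cauchy_weight.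
  by apply: continuous_measurable_fun => x;
   apply: continuous_comp; [exact: mulrl_continuous|exact: continuous_cos].
- by move=> x _; rewrite /= lee_fin normrM ler_piMl// ler_norml cos_geN1 cos_le1.
Qed.

Lemma integral_cos_cauchy_weight e t : 0 < e ->
  \int[leb]_x (cos (t * x) * cauchy_weight e x) = cauchy_kernel e t.
Proof.
move=> e0.
have iw := integrable_cauchy_weight e0; have ic := integrable_cos_cauchy_weight t e0.
have E s : \int[leb]_x (cauchy_weight e x + cos (s * x) * cauchy_weight e x) =
    2 * (e^-1 + e / (e ^+ 2 + s ^+ 2)).
  rewrite /Rintegral -[RHS]/(fine _%:E) -integral_even//; congr fine.
  by apply: eq_integral => x _; congr EFin; rewrite /cauchy_weight; ring.
have C0 : \int[leb]_x (cos (0 * x) * cauchy_weight e x) =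
    \int[leb]_x cauchy_weight e x.
  by apply: eq_Rintegral => x _; rewrite mul0r cos0 mul1r.
have := E t; have := E 0; rewrite !RintegralD//; last exact: integrable_cos_cauchy_weight.
rewrite C0.
rewrite expr0n/= addr0 expr2 invfM mulrA mulfV ?lt0r_neq0// mul1r.
rewrite /cauchy_kernel; set u := \int[leb]_x cauchy_weight e x.
set v := \int[leb]_x (_ * _).
move=> h1 h2.
(* At frequency 0 the cosine is 1, so [E 0] evaluates [u + u]; half of it is the contribution of the
   added 1 to [E t], which evaluates [u + v]. *)
have -> : v = (u + v) - (u + u) / 2 by field.
by rewrite h1 h2 -expr2; field; rewrite !lt0r_neq0// den_gt0.
Qed.

Let integral_oneDsqr : (\int[leb]_x ((oneDsqr x)^-1)%:E = pi%:E)%E.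
Proof.
rewrite ge0_symfun_integralT.
- rewrite -set_itvcy integral0y_oneDsqr -EFinM; congr EFin; by field.
- by move=> x; rewrite invr_ge0 (le_trans ler01)// oneDsqr_ge1.
- exact: continuous_oneDsqrV.
- by move=> x /=; rewrite /oneDsqr sqrrN.
Qed.

Lemma measurable_cauchy_kernel e : 0 < e -> measurable_fun setT (cauchy_kernel e).
Proof.
move=> e0; apply: continuous_measurable_fun => x; apply: cvgM; first exact: cvg_cst.
apply: cvgV; first by rewrite lt0r_neq0// den_gt0.
by apply: cvgD; [exact: cvg_cst|exact: exprn_continuous].
Qed.

(** The kernel is [2 / e] times [1 / (1 + (x / e)^2)], so a dilation reduces the integral to that of
    the derivative of the arctangent. *)
Lemma ge0_integral_cauchy_kernel e : 0 < e ->
  (\int[leb]_x (cauchy_kernel e x)%:E = (2 * pi)%:E)%E.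
Proof.
move=> e0.
have mo : measurable_fun setT (fun x : R => ((oneDsqr x)^-1)%:E).
  apply/measurable_EFinP; apply: continuous_measurable_fun => x.
  exact: continuous_oneDsqrV.
have o0 x : (0 <= ((oneDsqr x)^-1)%:E)%E.
  by rewrite lee_fin invr_ge0 (le_trans ler01) ?oneDsqr_ge1.
have i0 : e^-1 != 0 by rewrite invr_eq0 lt0r_neq0.
have := ge0_integral_affine 0 i0 mo o0.
rewrite integral_oneDsqr => h.
have -> : (\int[leb]_x (cauchy_kernel e x)%:E =
    \int[leb]_x ((2 / e)%:E * ((oneDsqr (e^-1 * x + 0))^-1)%:E))%E.
  apply: eq_integral => x _; rewrite -EFinM; congr EFin.
  have dx : e ^+ 2 + x ^+ 2 != 0 by rewrite lt0r_neq0// den_gt0.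
  have en : e != 0 by rewrite lt0r_neq0.
  have -> : oneDsqr (e^-1 * x + 0) = (e ^+ 2 + x ^+ 2) / e ^+ 2.
    by rewrite /oneDsqr; field.
  by rewrite /cauchy_kernel; field; rewrite dx en.
have mc : measurable_fun setT (fun x : R => ((oneDsqr (e^-1 * x + 0))^-1)%:E).
  apply: (measurableT_comp (f := fun y : R => ((oneDsqr y)^-1)%:E)
    (g := fun x : R => e^-1 * x + 0)) => //.
  by apply: measurable_funD => //; exact: mulrl_measurable.
rewrite ge0_integralZl_EFin//; last by rewrite divr_ge0// ltW.
rewrite h -!EFinM; congr EFin; rewrite gtr0_norm ?invr_gt0//.
by field; rewrite lt0r_neq0.
Qed.

Lemma integrable_cauchy_kernel e : 0 < e ->
  leb.-integrable setT (EFin \o cauchy_kernel e).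
Proof.
move=> e0; apply/integrableP; split.
  by apply/measurable_EFinP; exact: measurable_cauchy_kernel.
under eq_integral do rewrite /= ger0_norm ?cauchy_kernel_ge0//.
by rewrite ge0_integral_cauchy_kernel// ltry.
Qed.

End cauchy_kernel.

(* The library's own sigma-finite structure on [m1 \x m2] is shadowed by the one
   for subprobabilities, so it has to be packed explicitly. *)
Definition prod_measure {d1 d2} {T1 : measurableType d1} {T2 : measurableType d2}
    {R : realType} (m1 : {sigma_finite_measure set T1 -> \bar R})
    (m2 : {sigma_finite_measure set T2 -> \bar R}) :
    {sigma_finite_measure set (T1 * T2)%type -> \bar R} :=
  HB.pack_for {sigma_finite_measure set (T1 * T2)%type -> \bar R} (m1 \x m2)%E
    (Measure_isSigmaFinite.Build _ _ _ (m1 \x m2)%E (sigma_finite_prod m1 m2)).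

Section product_integrals.
Context {d1 d2} {T1 : measurableType d1} {T2 : measurableType d2} {R : realType}.
Variable m1 : {sigma_finite_measure set T1 -> \bar R}.
Variable m2 : {sigma_finite_measure set T2 -> \bar R}.

Lemma ge0_integral_prodM (p : T1 -> R) (q : T2 -> R) :
  measurable_fun setT p -> measurable_fun setT q ->
  (forall x, 0 <= p x) -> (forall y, 0 <= q y) ->
  (\int[m1]_x \int[m2]_y (p x * q y)%:E =
   \int[m1]_x (p x)%:E * \int[m2]_y (q y)%:E)%E.
Proof.
move=> mp mq p0 q0.
have mEp : measurable_fun setT (EFin \o p) by exact/measurable_EFinP.
have mEq : measurable_fun setT (EFin \o q) by exact/measurable_EFinP.
under eq_integral => x _.
  under eq_integral do rewrite EFinM.
  rewrite (ge0_integralZl_EFin m2 measurableT (f1 := EFin \o q))//; last first.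
    by move=> y _; rewrite lee_fin.
over.
rewrite /= ge0_integralZr//.
- by move=> x _; rewrite lee_fin.
- by apply: integral_ge0 => y _; rewrite lee_fin.
Qed.

Lemma measurable_prodM (p : T1 -> R) (q : T2 -> R) :
  measurable_fun setT p -> measurable_fun setT q ->
  measurable_fun setT (fun z : T1 * T2 => p z.1 * q z.2).
Proof.
move=> mp mq; apply: measurable_funM.
- exact: (measurableT_comp mp measurable_fst).
- exact: (measurableT_comp mq measurable_snd).
Qed.

Lemma integrable_prodM (p : T1 -> R) (q : T2 -> R) :
  m1.-integrable setT (EFin \o p) -> m2.-integrable setT (EFin \o q) ->
  (m1 \x m2)%E.-integrable setT (EFin \o (fun z => p z.1 * q z.2)).
Proof.
move=> /integrableP[mp ip] /integrableP[mq iq].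
have {}mp : measurable_fun setT p by exact/measurable_EFinP.
have {}mq : measurable_fun setT q by exact/measurable_EFinP.
apply/integrable12ltyP; first by apply/measurable_EFinP; exact: measurable_prodM.
rewrite [ltLHS](_ : _ = \int[m1]_x \int[m2]_y (`|p x| * `|q y|)%:E)%E.
  rewrite ge0_integral_prodM//; try exact: measurableT_comp.
  by apply: lte_mul_pinfty => //; [exact: integral_ge0|
    rewrite ge0_fin_numE//; exact: integral_ge0].
apply: eq_integral => x _; apply: eq_integral => y _.
by rewrite /= normrM.
Qed.

Lemma Rintegral_prodM (p : T1 -> R) (q : T2 -> R) :
  m1.-integrable setT (EFin \o p) -> m2.-integrable setT (EFin \o q) ->
  \int[(m1 \x m2)%E]_z (p z.1 * q z.2) = (\int[m1]_x p x) * (\int[m2]_y q y).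
Proof.
move=> ip iq; have [_ <-] := integral12_Rintegral (integrable_prodM ip iq).
rewrite -RintegralZr//; apply: eq_Rintegral => x _ /=.
by rewrite RintegralZl.
Qed.

End product_integrals.

Lemma integrable_le {d} {T : measurableType d} {R : realType}
    (mu : {measure set T -> \bar R}) (f g : T -> R) :
  measurable_fun setT f -> mu.-integrable setT (EFin \o g) ->
  (forall x, `|f x| <= `|g x|) -> mu.-integrable setT (EFin \o f).
Proof.
move=> mf ig fg; apply: le_integrable ig => //; first exact/measurable_EFinP.
by move=> x _; rewrite lee_fin.
Qed.

(** * The power spectrum of a real function and its weighted integrals *)

Section real_fourier.
Context {R : realType}.
Local Notation leb := (@lebesgue_measure R).
Implicit Types (f g : R -> R) (xi : R).

Definition cos_transform f xi : R := \int[leb]_x (f x * cos (x * xi)).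
Definition sin_transform f xi : R := \int[leb]_x (f x * sin (x * xi)).
(** The squared modulus of the Fourier transform of a real [f], whose real and imaginary parts are
    [cos_transform f] and [- sin_transform f]. *)
Definition power_spectrum f xi : R :=
  cos_transform f xi ^+ 2 + sin_transform f xi ^+ 2.

Lemma measurable_cos : measurable_fun setT (@cos R).
Proof. by apply: continuous_measurable_fun; exact: continuous_cos. Qed.
Lemma measurable_sin : measurable_fun setT (@sin R).
Proof. by apply: continuous_measurable_fun; exact: continuous_sin. Qed.

Lemma measurable_cos_transform f : measurable_fun setT f ->
  measurable_fun setT (cos_transform f).
Proof.
move=> mf; apply: (measurable_Rintegral2 leb
  (g := fun z : R * R => f z.1 * cos (z.1 * z.2))).
apply: measurable_funM; first exact: (measurableT_comp mf measurable_fst).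
by apply: (measurableT_comp measurable_cos); exact: measurable_funM.
Qed.

Lemma measurable_sin_transform f : measurable_fun setT f ->
  measurable_fun setT (sin_transform f).
Proof.
move=> mf; apply: (measurable_Rintegral2 leb
  (g := fun z : R * R => f z.1 * sin (z.1 * z.2))).
apply: measurable_funM; first exact: (measurableT_comp mf measurable_fst).
by apply: (measurableT_comp measurable_sin); exact: measurable_funM.
Qed.

Lemma measurable_power_spectrum f : measurable_fun setT f ->
  measurable_fun setT (power_spectrum f).
Proof.
move=> mf; apply: measurable_funD; apply: measurable_funX.
- exact: measurable_cos_transform.
- exact: measurable_sin_transform.
Qed.

Lemma power_spectrum_ge0 f xi : 0 <= power_spectrum f xi.
Proof. by rewrite addr_ge0 ?sqr_ge0. Qed.

Lemma integrable_Mcos f xi : leb.-integrable setT (EFin \o f) ->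
  leb.-integrable setT (EFin \o (fun x => f x * cos (x * xi))).
Proof.
move=> fi; have mf : measurable_fun setT f by apply/measurable_EFinP; apply: measurable_int fi.
apply: integrable_le fi _ => [|x].
  apply: measurable_funM => //; apply: (measurableT_comp measurable_cos).
  exact: measurable_funM.
by rewrite normrM ler_piMr// ler_norml cos_geN1 cos_le1.
Qed.

Lemma integrable_Msin f xi : leb.-integrable setT (EFin \o f) ->
  leb.-integrable setT (EFin \o (fun x => f x * sin (x * xi))).
Proof.
move=> fi; have mf : measurable_fun setT f by apply/measurable_EFinP; apply: measurable_int fi.
apply: integrable_le fi _ => [|x].
  apply: measurable_funM => //; apply: (measurableT_comp measurable_sin).
  exact: measurable_funM.
by rewrite normrM ler_piMr// ler_norml sin_geN1 sin_le1.
Qed.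

(** Each square is a double integral, and [cos p cos q + sin p sin q = cos (p - q)] gathers the two.
    The frequency is then left in a single cosine, ready to be integrated against a weight. *)
Lemma power_spectrumE f xi : leb.-integrable setT (EFin \o f) ->
  power_spectrum f xi =
  \int[(leb \x leb)%E]_z (f z.1 * f z.2 * cos ((z.1 - z.2) * xi)).
Proof.
move=> fi; have ic := integrable_Mcos xi fi; have isn := integrable_Msin xi fi.
rewrite /power_spectrum !expr2 -!Rintegral_prodM// -RintegralD//; last 2 first.
- exact: (integrable_prodM ic ic).
- exact: (integrable_prodM isn isn).
by apply: eq_Rintegral => z _; rewrite mulrBl cosB; ring.
Qed.

(** The triple integrand is dominated by [|f x| |f y| |w xi|], which is integrable as a product, so
    Fubini allows the integral in [xi] to be taken first. *)
Lemma weighted_power_spectrum f w : leb.-integrable setT (EFin \o f) ->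
  leb.-integrable setT (EFin \o w) ->
  leb.-integrable setT (EFin \o (fun xi => power_spectrum f xi * w xi)) /\
  \int[leb]_xi (power_spectrum f xi * w xi) =
  \int[(leb \x leb)%E]_z
    (f z.1 * f z.2 * \int[leb]_xi (cos ((z.1 - z.2) * xi) * w xi)).
Proof.
move=> fi wi.
have mf : measurable_fun setT f by apply/measurable_EFinP; apply: measurable_int fi.
have mw : measurable_fun setT w by apply/measurable_EFinP; apply: measurable_int wi.
have ffi := integrable_prodM fi fi.
pose leb2 := prod_measure leb leb.
pose H (y : (R * R) * R) := f y.1.1 * f y.1.2 * (cos ((y.1.1 - y.1.2) * y.2) * w y.2).
have iH : (leb2 \x leb)%E.-integrable setT (EFin \o H).
  apply: (integrable_le _ (integrable_prodM (m1 := prod_measure leb leb) ffi wi))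
    => [|y].
    apply: measurable_funM.
      exact: (measurableT_comp (measurable_prodM mf mf) measurable_fst).
    apply: measurable_funM; last exact: (measurableT_comp mw measurable_snd).
    apply: (measurableT_comp measurable_cos); apply: measurable_funM => //.
    by apply: measurable_funB;
      [exact: (measurableT_comp measurable_fst measurable_fst)|
       exact: (measurableT_comp measurable_snd measurable_fst)].
  rewrite /H !normrM ler_wpM2l ?mulr_ge0//.
  by rewrite ler_piMl// ler_norml cos_geN1 cos_le1.
have [i1 e1] := integral12_Rintegral iH.
have [i2 e2] := integral21_Rintegral iH.
have Exi xi : \int[leb2]_z H (z, xi) = power_spectrum f xi * w xi.
  rewrite power_spectrumE// -RintegralZr//.
    by apply: eq_Rintegral => z _; rewrite /H/=; ring.
  apply: (integrable_le _ ffi) => [|z].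
    apply: measurable_funM; first exact: measurable_prodM.
    apply: (measurableT_comp measurable_cos); apply: measurable_funM => //.
    exact: measurable_funB.
  by rewrite normrM ler_piMr// ler_norml cos_geN1 cos_le1.
have Ez z : \int[leb]_xi H (z, xi) =
    f z.1 * f z.2 * \int[leb]_xi (cos ((z.1 - z.2) * xi) * w xi).
  rewrite -RintegralZl//; apply: (integrable_le _ wi) => [|xi].
    apply: measurable_funM => //; apply: (measurableT_comp measurable_cos).
    exact: measurable_funM.
  by rewrite normrM ler_piMl// ler_norml cos_geN1 cos_le1.
split.
  by rewrite (_ : (fun xi => _) = fun xi => \int[leb2]_z H (z, xi))//;
    apply/funext => xi; rewrite Exi.
transitivity (\int[leb]_xi \int[leb2]_z H (z, xi)).
  by apply: eq_Rintegral => xi _; rewrite Exi.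
rewrite e2 -e1.
by apply: eq_Rintegral => z _; rewrite Ez.
Qed.

End real_fourier.

Section affine_integrable.
Context {R : realType}.
Local Notation leb := (@lebesgue_measure R).

Lemma measurable_affine (a b : R) : measurable_fun setT (fun x : R => a * x + b).
Proof. by apply: measurable_funD => //; exact: mulrl_measurable. Qed.

Lemma integral_affine (a b : R) (f : R -> \bar R) : a != 0 ->
  leb.-integrable setT f ->
  (\int[leb]_x f (a * x + b)%R = `|a|^-1%:E * \int[leb]_x f x)%E.
Proof.
move=> a0 fi; have mf := measurable_int _ fi.
have fp := ge0_integral_affine b a0 (measurable_funepos mf) (@funepos_ge0 _ _ f).
have fn := ge0_integral_affine b a0 (measurable_funeneg mf) (@funeneg_ge0 _ _ f).
transitivity (`|a|^-1%:E * \int[leb]_x f^\+ x - `|a|^-1%:E * \int[leb]_x f^\- x)%E.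
  rewrite -fp -fn [LHS]integralE; congr (_ - _)%E; apply: eq_integral => x _.
  - by rewrite (funepos_comp f (fun x => a * x + b)).
  - by rewrite (funeneg_comp f (fun x => a * x + b)).
rewrite -muleBr; [|by []|by rewrite fin_num_adde_defr// integrable_pos_fin_num].
by congr (_ * _)%E; rewrite [RHS]integralE.
Qed.

Lemma integrable_affine (a b : R) (f : R -> \bar R) : a != 0 ->
  leb.-integrable setT f -> leb.-integrable setT (fun x => f (a * x + b)).
Proof.
move=> a0 /integrableP[mf fi]; apply/integrableP; split.
  exact: (measurableT_comp mf (measurable_affine a b)).
rewrite (@ge0_integral_affine _ a b (fun x => `|f x|%E))//.
- by rewrite lte_mul_pinfty// ?lee_fin// invr_ge0.
- exact: measurableT_comp.
Qed.

Lemma Rintegral_affine (a b : R) (f : R -> R) : a != 0 ->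
  leb.-integrable setT (EFin \o f) ->
  \int[leb]_x f (a * x + b) = `|a|^-1 * \int[leb]_x f x.
Proof.
move=> a0 fi; rewrite {1}/Rintegral (@integral_affine a b (EFin \o f))//.
by rewrite fineM// integrable_fin_num.
Qed.

End affine_integrable.

Lemma norm_prod_le {R : realFieldType} (a b : R) :
  `|a * b| <= 2^-1 * (a ^+ 2 + b ^+ 2).
Proof.
have h1 := sqr_ge0 (a - b); have h2 := sqr_ge0 (a + b).
by rewrite ler_norml; apply/andP; split; nra.
Qed.

Section weighted_plancherel.
Context {R : realType}.
Local Notation leb := (@lebesgue_measure R).
Implicit Types (f g : R -> R) (e xi : R).

Let L2 f := (\int[leb]_x (f x ^+ 2)%:E)%E.

Lemma cauchy_kernel_le e t : 0 < e -> cauchy_kernel e t <= 2 / e.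
Proof.
move=> e0; rewrite /cauchy_kernel ler_pdivrMr; last by rewrite ltr_pwDl ?exprn_gt0 ?sqr_ge0.
rewrite -mulrA mulrDr ler_pM2l// expr2 mulKf ?lt0r_neq0// lerDl.
by rewrite mulr_ge0 ?sqr_ge0// invr_ge0 ltW.
Qed.

Let kern f e (z : R * R) := f z.1 * f z.2 * cauchy_kernel e (z.1 - z.2).

Let measurable_kc e : 0 < e ->
  measurable_fun setT (fun z : R * R => cauchy_kernel e (z.1 - z.2)).
Proof.
move=> e0; apply: (measurableT_comp (measurable_cauchy_kernel e0)).
exact: measurable_funB.
Qed.

Let integrable_kern f e : 0 < e -> leb.-integrable setT (EFin \o f) ->
  (leb \x leb)%E.-integrable setT (EFin \o kern f e).
Proof.
move=> e0 fi.
have mf : measurable_fun setT f by apply/measurable_EFinP; apply: measurable_int fi.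
have h := integrable_EFinZl (2 / e) (integrable_prodM fi fi).
apply: (integrable_le _ h) => [|z].
  by apply: measurable_funM; [exact: measurable_prodM|exact: measurable_kc].
rewrite /kern normrM [leRHS]normrM [leRHS]mulrC ler_wpM2l//.
rewrite [leRHS]ger0_norm ?divr_ge0 ?(ltW e0)// ger0_norm.
  exact: cauchy_kernel_le.
exact: cauchy_kernel_ge0.
Qed.

Let integral_kc e (y : R) : 0 < e ->
  (\int[leb]_x (cauchy_kernel e (x - y))%:E = (2 * pi)%:E)%E.
Proof.
move=> e0; rewrite -(ge0_integral_cauchy_kernel e0).
have h : measurable_fun setT (EFin \o cauchy_kernel e).
  by apply/measurable_EFinP; exact: measurable_cauchy_kernel.
have := ge0_integral_affine (- y) (oner_neq0 _) h.
rewrite normr1 invr1 mul1e => <-.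
  by apply: eq_integral => x _; rewrite /= mul1r.
by move=> x; rewrite lee_fin cauchy_kernel_ge0.
Qed.

Let cauchy_kernelN e t : cauchy_kernel e (- t) = cauchy_kernel e t.
Proof. by rewrite /cauchy_kernel sqrrN. Qed.

Lemma weighted_power_spectrum_kern f e : 0 < e -> leb.-integrable setT (EFin \o f) ->
  \int[leb]_xi (power_spectrum f xi * cauchy_weight e xi) =
  \int[(leb \x leb)%E]_z kern f e z.
Proof.
move=> e0 fi.
rewrite (weighted_power_spectrum fi (integrable_cauchy_weight e0)).2.
by apply: eq_Rintegral => z _; rewrite integral_cos_cauchy_weight.
Qed.

(** Under the positive kernel, [|f x f y|] is bounded by [(f x ^ 2 + f y ^ 2) / 2]. The bound
    obtained does not depend on [e]. *)
Lemma weighted_power_spectrum_le f e : 0 < e -> leb.-integrable setT (EFin \o f) ->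
  (\int[leb]_xi (power_spectrum f xi * cauchy_weight e xi)%:E <= (2 * pi)%:E * L2 f)%E.
Proof.
move=> e0 fi.
have mf : measurable_fun setT f by apply/measurable_EFinP; apply: measurable_int fi.
have [i1 _] := weighted_power_spectrum fi (integrable_cauchy_weight e0).
rewrite -[leLHS]fineK; last exact: integrable_fin_num.
rewrite [leLHS](_ : _ = (\int[(leb \x leb)%E]_z kern f e z)%:E); last first.
  by rewrite -weighted_power_spectrum_kern.
have ik := integrable_kern e0 fi.
have mk : measurable_fun setT (kern f e).
  by apply/measurable_EFinP; apply: measurable_int ik.
rewrite /Rintegral fineK; last exact: integrable_fin_num.
(* [A] and [B] are the two terms of the AM-GM bound. In each, the variable that is not squared is
   integrated first and meets only the kernel, of mass [2 pi]; the factor [1 / 2] then leaves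
   [pi * L2 f]. *)
pose A (z : R * R) := f z.1 ^+ 2 * cauchy_kernel e (z.1 - z.2).
pose B (z : R * R) := f z.2 ^+ 2 * cauchy_kernel e (z.1 - z.2).
have mA : measurable_fun setT (fun z => (2^-1 * A z)%:E).
  apply/measurable_EFinP; do 2 apply: measurable_funM => //; last exact: measurable_kc.
  by apply: measurable_funX; exact: (measurableT_comp mf measurable_fst).
have mB : measurable_fun setT (fun z => (2^-1 * B z)%:E).
  apply/measurable_EFinP; do 2 apply: measurable_funM => //; last exact: measurable_kc.
  by apply: measurable_funX; exact: (measurableT_comp mf measurable_snd).
have A0 z : (0 <= (2^-1 * A z)%:E)%E.
  by rewrite lee_fin mulr_ge0 ?invr_ge0// mulr_ge0 ?sqr_ge0 ?cauchy_kernel_ge0.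
have B0 z : (0 <= (2^-1 * B z)%:E)%E.
  by rewrite lee_fin mulr_ge0 ?invr_ge0// mulr_ge0 ?sqr_ge0 ?cauchy_kernel_ge0.
apply: (@le_trans _ _ (\int[(leb \x leb)%E]_z ((2^-1 * A z)%:E + (2^-1 * B z)%:E))%E).
  apply: (le_trans (lee_abs _)).
  apply: (le_trans (le_abse_integral _ _ _)) => //.
    exact: measurable_int ik.
  apply: ge0_le_integral => //.
  - by apply: measurableT_comp => //; exact/measurable_EFinP.
  - exact: emeasurable_funD.
  move=> z _; rewrite /= lee_fin /kern /A /B normrM (ger0_norm (cauchy_kernel_ge0 _ e0)).
  rewrite -mulrDr -mulrDl mulrA ler_wpM2r ?cauchy_kernel_ge0//.
  exact: norm_prod_le.
have m2 : measurable_fun setT (fun x : R => (f x ^+ 2)%:E).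
  by apply/measurable_EFinP; exact: measurable_funX.
have p0 : 0 <= 2 * pi :> R by rewrite mulr_ge0 ?pi_ge0.
have IA : (\int[(leb \x leb)%E]_z (2^-1 * A z)%:E = pi%:E * L2 f)%E.
  rewrite (fubini_tonelli1 (m1 := leb) (m2 := leb) (fun z => (2^-1 * A z)%:E))//.
  rewrite /fubini_F /L2 -ge0_integralZl_EFin ?pi_ge0//; last first.
    by move=> x _; rewrite lee_fin sqr_ge0.
  apply: eq_integral => x _ /=.
  rewrite (_ : \int[leb]_y _ = (2^-1 * f x ^+ 2)%:E *
      \int[leb]_y (cauchy_kernel e (y - x))%:E)%E; last first.
    rewrite -ge0_integralZl_EFin//.
    - by apply: eq_integral => y _; rewrite -EFinM -[y - x]opprB cauchy_kernelN mulrA.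
    - by move=> y _; rewrite lee_fin cauchy_kernel_ge0.
    - apply/measurable_EFinP; apply: (measurableT_comp (measurable_cauchy_kernel e0)).
      exact: measurable_funB.
    - by rewrite mulr_ge0 ?sqr_ge0 ?invr_ge0.
  by rewrite integral_kc// -!EFinM; congr EFin; field.
have IB : (\int[(leb \x leb)%E]_z (2^-1 * B z)%:E = pi%:E * L2 f)%E.
  rewrite (fubini_tonelli2 (m1 := leb) (m2 := leb) (fun z => (2^-1 * B z)%:E))//.
  rewrite /fubini_G /L2 -ge0_integralZl_EFin ?pi_ge0//; last first.
    by move=> x _; rewrite lee_fin sqr_ge0.
  apply: eq_integral => x _ /=.
  rewrite (_ : \int[leb]_y _ = (2^-1 * f x ^+ 2)%:E *
      \int[leb]_y (cauchy_kernel e (y - x))%:E)%E; last first.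
    rewrite -ge0_integralZl_EFin//.
    - by apply: eq_integral => y _; rewrite -EFinM mulrA.
    - by move=> y _; rewrite lee_fin cauchy_kernel_ge0.
    - apply/measurable_EFinP; apply: (measurableT_comp (measurable_cauchy_kernel e0)).
      exact: measurable_funB.
    - by rewrite mulr_ge0 ?sqr_ge0 ?invr_ge0.
  by rewrite integral_kc// -!EFinM; congr EFin; field.
rewrite ge0_integralD// IA IB -ge0_muleDl ?lee_fin ?pi_ge0//.
by rewrite -EFinD mulrDl mul1r.
Qed.

(** The substitution [x := e x + y] in the first variable moves [e] from the kernel into a translate
    of [f]. The bound [K] on [f] makes the new integrand at most
    [K * cauchy_kernel 1 z.1 * |f z.2|]. *)
Lemma kern_shift f e K : 0 < e -> leb.-integrable setT (EFin \o f) ->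
  (forall x, `|f x| <= K) ->
  \int[(leb \x leb)%E]_z kern f e z =
  \int[(leb \x leb)%E]_z (cauchy_kernel 1 z.1 * (f (e * z.1 + z.2) * f z.2)).
Proof.
move=> e0 fi fK.
have mf : measurable_fun setT f by apply/measurable_EFinP; apply: measurable_int fi.
have ik := integrable_kern e0 fi.
have [_ <-] := integral21_Rintegral ik.
have i2 : (leb \x leb)%E.-integrable setT (EFin \o
    (fun z : R * R => cauchy_kernel 1 z.1 * (f (e * z.1 + z.2) * f z.2))).
  have h := integrable_EFinZl K (integrable_prodM (integrable_cauchy_kernel ltr01) fi).
  apply: (integrable_le _ h) => [|z].
    apply: measurable_funM.
      exact: (measurableT_comp (measurable_cauchy_kernel ltr01) measurable_fst).
    apply: measurable_funM; last exact: (measurableT_comp mf measurable_snd).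
    apply: (measurableT_comp mf); apply: measurable_funD => //.
    exact: measurable_funM.
  rewrite !normrM mulrCA ler_wpM2r ?mulr_ge0//.
  exact: (le_trans (fK _) (ler_norm _)).
have [_ <-] := integral21_Rintegral i2.
apply: eq_Rintegral => y _ /=.
have iy : leb.-integrable setT (EFin \o (fun x => f x * cauchy_kernel e (x - y))).
  apply: (integrable_le _ (integrable_EFinZl (2 / e) fi)) => [|x].
    apply: measurable_funM => //.
    apply: (measurableT_comp (measurable_cauchy_kernel e0)); exact: measurable_funB.
  rewrite normrM [leRHS]normrM [leRHS]mulrC ler_wpM2l//.
  rewrite [leRHS]ger0_norm ?divr_ge0 ?(ltW e0)//.
  by rewrite ger0_norm ?cauchy_kernel_le ?cauchy_kernel_ge0.
transitivity (f y * \int[leb]_x (f x * cauchy_kernel e (x - y))).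
  by rewrite -RintegralZl//; apply: eq_Rintegral => x _; rewrite /kern/=; ring.
have en : e != 0 by rewrite lt0r_neq0.
have := Rintegral_affine y en iy; rewrite gtr0_norm// => /(congr1 ( *%R e)).
rewrite mulrA divff// mul1r => <-.
rewrite mulrA -RintegralZl//; last exact: (integrable_affine y en iy).
apply: eq_Rintegral => x _ /=.
by rewrite addrK -(cauchy_kernel_scale x e0); ring.
Qed.

End weighted_plancherel.

Section plancherel_limit.
Context {R : realType}.
Local Notation leb := (@lebesgue_measure R).
Implicit Types (f g : R -> R) (e xi : R).

Let L2 f := (\int[leb]_x (f x ^+ 2)%:E)%E.

Let w n := cauchy_weight (n.+1%:R^-1 : R).

Let nw (xi : R) : n.+1%:R^-1 * `|xi| @[n --> \oo] --> (0 : R).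
Proof. by rewrite -[X in _ --> X](mul0r `|xi|); apply: cvgMl; exact: cvg_harmonic. Qed.

(** The weights [exp (- e |xi|)] increase to 1 as [e = 1 / (n + 1)] decreases to 0, so this is
    monotone convergence, valid even if the limit is infinite. *)
Lemma cvg_weighted_power_spectrum f : measurable_fun setT f ->
  (\int[leb]_xi (power_spectrum f xi * cauchy_weight n.+1%:R^-1 xi)%:E @[n --> \oo] -->
   \int[leb]_xi (power_spectrum f xi)%:E)%E.
Proof.
move=> mf; have mP := measurable_power_spectrum mf.
have h n : measurable_fun setT (fun xi => (power_spectrum f xi * w n xi)%:E).
  by apply/measurable_EFinP; apply: measurable_funM => //; exact: measurable_cauchy_weight.
have := @cvg_monotone_convergence _ _ _ leb setT measurableT
  (fun n xi => (power_spectrum f xi * w n xi)%:E) h.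
rewrite (_ : (fun x => limn _) = fun xi => (power_spectrum f xi)%:E).
  apply.
  - by move=> n xi _; rewrite lee_fin mulr_ge0 ?power_spectrum_ge0 ?cauchy_weight_ge0.
  - move=> xi _ m n mn; rewrite lee_fin ler_wpM2l ?power_spectrum_ge0//.
    rewrite /w /cauchy_weight ler_expR lerN2 ler_wpM2r//.
    by rewrite lef_pV2 ?posrE// ler_nat ltnS.
apply/funext => xi; apply/cvg_lim => //; apply: cvg_EFin; first exact: nearW.
rewrite -[X in _ --> X]mulr1 -[X in _ * X]expR0 -[X in expR X]oppr0.
apply: cvgMr; apply: continuous_cvg; first exact: continuous_expR.
exact: cvgN (nw xi).
Qed.

Lemma power_spectrum_le f : leb.-integrable setT (EFin \o f) ->
  (\int[leb]_xi (power_spectrum f xi)%:E <= (2 * pi)%:E * L2 f)%E.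
Proof.
move=> fi; have mf : measurable_fun setT f by apply/measurable_EFinP; apply: measurable_int fi.
have := cvg_weighted_power_spectrum mf => /cvgP c.
rewrite -(cvg_lim _ (cvg_weighted_power_spectrum mf))//.
apply: lime_le => //; apply: nearW => n.
by apply: weighted_power_spectrum_le; rewrite // invr_gt0.
Qed.

(* Because of the factor [g y], a jump of [g] at a zero of [g] is harmless: the
   truncation of a continuous function to an open interval qualifies. *)
Definition shift_continuous g := forall t y,
  g (n.+1%:R^-1 * t + y) * g y @[n --> \oo] --> g y * g y.

(** The same weighted integrals are given two limits: monotone convergence on the frequency side
    yields the power spectrum, dominated convergence on the kernel side replaces the translate of
    [g] by [g] itself and leaves the mass of the kernel times [L2 g]. *)
Lemma plancherel_shift_continuous g (K : R) : leb.-integrable setT (EFin \o g) ->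
  (forall x, `|g x| <= K) -> shift_continuous g ->
  (\int[leb]_xi (power_spectrum g xi)%:E = (2 * pi)%:E * L2 g)%E.
Proof.
move=> gi gK sg.
have mg : measurable_fun setT g by apply/measurable_EFinP; apply: measurable_int gi.
have ik := integrable_cauchy_kernel (@ltr01 R).
pose F n (z : R * R) := cauchy_kernel 1 z.1 * (g (n.+1%:R^-1 * z.1 + z.2) * g z.2).
pose G (z : R * R) := cauchy_kernel 1 z.1 * (g z.2 * g z.2).
have mk : measurable_fun setT (fun z : R * R => cauchy_kernel 1 z.1).
  exact: (measurableT_comp (measurable_cauchy_kernel ltr01) measurable_fst).
have mg2 : measurable_fun setT (fun z : R * R => g z.2).
  exact: (measurableT_comp mg measurable_snd).
have mF n : measurable_fun setT (EFin \o F n).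
  apply/measurable_EFinP; apply: measurable_funM => //; apply: measurable_funM => //.
  by apply: (measurableT_comp mg); apply: measurable_funD => //; exact: measurable_funM.
have mG : measurable_fun setT (EFin \o G).
  by apply/measurable_EFinP; do 2 apply: measurable_funM => //.
have iD := integrable_EFinZl K (integrable_prodM ik (integrable_norm gi)).
have FK n z : `|F n z| <= K * (cauchy_kernel 1 z.1 * `|g z.2|).
  have k0 : 0 <= cauchy_kernel 1 z.1 by exact: cauchy_kernel_ge0.
  rewrite /F normrM (ger0_norm k0) normrM mulrCA.
  rewrite ler_wpM2r//; first by rewrite mulr_ge0// cauchy_kernel_ge0.
have cFG : {ae prod_measure leb leb, forall z, setT z ->
    (EFin \o F n) z @[n --> \oo] --> (EFin \o G) z}.
  apply: aeW => z _; apply: cvg_EFin; first exact: nearW.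
  by apply: cvgMr; exact: sg.
have bF : {ae prod_measure leb leb, forall z n, setT z ->
    (`|(EFin \o F n) z| <= (K * (cauchy_kernel 1 z.1 * `|g z.2|))%:E)%E}.
  by apply: aeW => z n _; exact: FK.
have [_ _ cv] := @dominated_convergence _ _ _ (prod_measure leb leb) setT measurableT
  (fun n => EFin \o F n) (EFin \o G) _ mF mG cFG iD bF.
have e0 n : 0 < n.+1%:R^-1 :> R by rewrite invr_gt0.
have FE n : (\int[(leb \x leb)%E]_z (F n z)%:E =
    \int[leb]_xi (power_spectrum g xi * w n xi)%:E)%E.
  have [i1 _] := weighted_power_spectrum gi (integrable_cauchy_weight (e0 n)).
  have iF : (leb \x leb)%E.-integrable setT (EFin \o F n).
    apply: (integrable_le (mu := prod_measure leb leb) _ iD) => [|z].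
      by apply/measurable_EFinP; exact: mF.
    by rewrite (le_trans (FK n z))// ler_norm.
  rewrite -[LHS]fineK ?integrable_fin_num// -[RHS]fineK ?integrable_fin_num//.
  congr EFin; have := weighted_power_spectrum_kern (e0 n) gi.
  by rewrite (kern_shift (e0 n) gi gK) => h; exact: esym h.
have GE : (\int[(leb \x leb)%E]_z (G z)%:E = (2 * pi)%:E * L2 g)%E.
  rewrite (fubini_tonelli1 (m1 := leb) (m2 := leb) (fun z => (G z)%:E))//; last first.
    by move=> z; rewrite lee_fin mulr_ge0 ?cauchy_kernel_ge0// -expr2 sqr_ge0.
  have mgg : measurable_fun setT (fun y => g y ^+ 2) by exact: measurable_funX.
  have := ge0_integral_prodM leb leb (measurable_cauchy_kernel (@ltr01 R)) mgg
    (fun x => cauchy_kernel_ge0 x ltr01) (fun y => sqr_ge0 (g y)).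
  rewrite ge0_integral_cauchy_kernel// => h; exact: h.
have FEs : (fun n => \int[(leb \x leb)%E]_z (F n z)%:E)%E =
    (fun n => \int[leb]_xi (power_spectrum g xi * w n xi)%:E)%E by exact/funext.
have := cvg_weighted_power_spectrum mg; rewrite -/(w _) -FEs -GE => cP.
exact: (cvg_unique _ cP cv).
Qed.

End plancherel_limit.

(** * Square-mean approximation by truncated continuous functions *)

Section plancherel_density.
Context {R : realType}.
Local Notation leb := (@lebesgue_measure R).
Implicit Types (f g : R -> R) (e xi : R).

Let L2 f := (\int[leb]_x (f x ^+ 2)%:E)%E.

Lemma cvge0_lt (u : nat -> \bar R) (e : R) : 0 < e -> u @ \oo --> 0%E ->
  exists n, (u n < e%:E)%E.
Proof.
move=> e0 /fine_cvgP[ufin /cvgrPdist_lt/(_ e e0) ulim].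
have [N _ H] := filterI ufin ulim; exists N.
have [/= fN dN] := H N (leqnn N).
by rewrite -(fineK fN) lte_fin (le_lt_trans (ler_norm _))// -normrN -sub0r.
Qed.

Let clamp (K u : R) : R := Num.max (- K) (Num.min u K).

Let clamp_bound (K u : R) : 0 <= K -> `|clamp K u| <= K.
Proof.
move=> K0; rewrite /clamp ler_norml le_max lexx/= ge_max; apply/andP; split; first lra.
by rewrite ge_min lexx orbT.
Qed.

(** The projection onto [[-K, K]] does not increase distances and fixes [v]. Continuous approximants
    can thus be made bounded without moving away from a bounded target. *)
Let clamp_dist (K u v : R) : `|v| <= K -> `|v - clamp K u| <= `|v - u|.
Proof.
rewrite ler_norml => /andP[v1 v2]; rewrite /clamp.
have [uK|Ku] := leP u K.
- have [uNK|NKu] := leP (- K) u; first by [].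
  by rewrite (ger0_norm (x := v - u)) ?ler_norml; [apply/andP; split; lra|lra].
- have [uNK|NKu] := leP (- K) K; last by exfalso; lra.
  by rewrite (ler0_norm (x := v - u)) ?ler_norml; [apply/andP; split; lra|lra].
Qed.

Let continuous_clamp (K : R) (G : R -> R) : continuous G ->
  continuous (fun x => clamp K (G x)).
Proof.
move=> cG x; apply: (@continuous_max R R (cst (- K)) (fun x => Num.min (G x) K)).
  exact: cvg_cst.
by apply: (@continuous_min R R G (cst K)); [exact: cG|exact: cvg_cst].
Qed.

Let window (M : R) (G : R -> R) x : R := if `|x| < M then G x else 0.

(** If [|y| < M], the translates of [y] eventually stay in the open interval and continuity of [G]
    applies; if [|y| >= M], the factor taken at [y] is 0. The strict inequality in [window] is what
    makes the two cases exhaustive. *)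
Let shift_continuous_window (M : R) (G : R -> R) : continuous G ->
  shift_continuous (window M G).
Proof.
move=> cG t y; rewrite /window; have [yM|yM] := ltP `|y| M; last first.
  by rewrite mulr0; under eq_cvg do rewrite mulr0; exact: cvg_cst.
apply: cvgMl.
have cy : (n.+1%:R^-1 * t + y : R) @[n --> \oo] --> y.
  rewrite -[X in _ --> X]add0r; apply: cvgD; last exact: cvg_cst.
  by rewrite -[X in _ --> X](mul0r t); apply: cvgMl; exact: cvg_harmonic.
have /cvgrPdist_lt/(_ (M - `|y|)) near_y := cy.
have cGy : G (n.+1%:R^-1 * t + y) @[n --> \oo] --> G y.
  by apply: continuous_cvg; [exact: cG|exact: cy].
apply: cvg_trans; last exact: cGy.
apply: near_eq_cvg.
have : 0 < M - `|y| by rewrite subr_gt0.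
move=> /near_y; apply: filterS => n h; rewrite ifT//.
have := ler_normD (n.+1%:R^-1 * t + y - y) y; rewrite subrK => /le_lt_trans; apply.
by rewrite -ltrBrDr distrC.
Qed.

Let measurable_window (M : R) (G : R -> R) : measurable_fun setT G ->
  measurable_fun setT (window M G).
Proof.
move=> mG; apply: measurable_fun_ifT => //.
apply: (@measurable_fun_ltr _ _ _ _ (fun x : R => `|x|) (cst M)) => //.
Qed.

Let window_integrable (M K : R) (G : R -> R) : 0 <= K -> measurable_fun setT G ->
  (forall x, `|G x| <= K) -> leb.-integrable setT (EFin \o window M G).
Proof.
move=> K0 mG GK; have iI := integrable_EFinZl K (integrable_indic_itv (- M) M false true).
apply: (integrable_le _ iI) => [|x]; first exact: measurable_window.
rewrite /window; case: ifPn => [xM|_]; last by rewrite normr0.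
rewrite indicE mem_set ?mulr1; first by rewrite (le_trans (GK x))// ler_norm.
by rewrite /= in_itv/= -ltr_norml.
Qed.

(** [f] is first cut off in height and in width, with a small error in square mean by dominated
    convergence. Continuous functions approximate the result in mean on a bounded interval; since
    both functions can be kept below [M] in modulus, closeness in mean upgrades to closeness in
    square mean. *)
Lemma shift_continuous_dense f e : measurable_fun setT f -> (L2 f < +oo)%E -> 0 < e ->
  exists g : R -> R, exists K : R,
    [/\ leb.-integrable setT (EFin \o g), forall x, `|g x| <= K, shift_continuous g &
      (\int[leb]_x ((f x - g x) ^+ 2)%:E <= e%:E)%E].
Proof.
move=> mf f2 e0.
pose tr n x : R := if (`|f x| <= n%:R) then f x else 0.
have mtr n : measurable_fun setT (tr n).
  apply: measurable_fun_ifT => //.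
  apply: (@measurable_fun_ler _ _ _ _ (fun x : R => `|f x|) (cst _)) => //.
  exact: measurableT_comp.
pose fn n := window n%:R (tr n).
have mfn n : measurable_fun setT (fn n) by exact: measurable_window.
have fnE n x : fn n x = f x \/ fn n x = 0.
  by rewrite /fn /window /tr; case: ifP => _; [case: ifP => _|]; [left|right|right].
have mf2 : measurable_fun setT (fun x => (f x ^+ 2)%:E).
  by apply/measurable_EFinP; exact: measurable_funX.
have mF n : measurable_fun setT (fun x => ((f x - fn n x) ^+ 2)%:E).
  by apply/measurable_EFinP; apply: measurable_funX; exact: measurable_funB.
have if2 : leb.-integrable setT (fun x => (f x ^+ 2)%:E).
  apply/integrableP; split => //.
  by under eq_integral do rewrite gee0_abs ?lee_fin ?sqr_ge0//.
have cF : {ae leb, forall x, setT x ->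
    ((f x - fn n x) ^+ 2)%:E @[n --> \oo] --> (0 : R)%:E}.
  apply: aeW => x _; apply: cvg_EFin; first exact: nearW.
  apply: cvg_near_cst.
  near=> n; have nx : `|x| < n%:R by near: n; exact: nbhs_infty_gtr.
  have nf : `|f x| <= n%:R by near: n; exact: nbhs_infty_ger.
  by rewrite /= /fn /window nx /tr nf subrr expr0n.
have bF : {ae leb, forall x n, setT x ->
    (`|((f x - fn n x) ^+ 2)%:E| <= (f x ^+ 2)%:E)%E}.
  apply: aeW => x n _; rewrite /= lee_fin normrX real_normK ?num_real//.
  by case: (fnE n x) => ->; rewrite ?subr0// subrr expr0n sqr_ge0.
have [_ _] := @dominated_convergence _ _ _ leb setT measurableT
  (fun n x => ((f x - fn n x) ^+ 2)%:E) (cst 0%E) (fun x => (f x ^+ 2)%:E) mF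
  (measurable_cst _) cF if2 bF.
rewrite integral0 => c0.
(* The inequality [(a + b)^2 <= 2 a^2 + 2 b^2] doubles each of the two errors, so each is allowed a
   quarter of [e]. *)
have e4 : 0 < e / 4 by rewrite divr_gt0.
have [N hN] := cvge0_lt e4 c0.
set M : R := N%:R in hN *.
have M0 : 0 <= M by rewrite /M.
have trM x : `|tr N x| <= M by rewrite /tr; case: ifP => // _; rewrite normr0.
have mtr' : measurable_fun setT (tr N) := mtr N.
pose E : set R := `]- M, M[%classic.
have inE' x : E x = (`|x| < M) :> Prop by rewrite /E/= in_itv/= -ltr_norml.
have ifN : leb.-integrable setT (EFin \o fn N) by exact: window_integrable trM.
have mE : measurable E by exact: measurable_itv.
have Efin : (leb E < +oo)%E by rewrite lebesgue_measure_itv/=; case: ifP; rewrite ltry.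
have ifE : leb.-integrable E (EFin \o fn N) by exact: integrableS ifN.
have [G_ [cG iG cvG]] := approximation_continuous_integrable mE Efin ifE.
(* Multiplied by the [2 * M] of [fgE] this is at most [e / 4]; [M + 1] instead of [M] covers the
   case [M = 0]. *)
have e1 : 0 < e / (8 * (M + 1)) by rewrite divr_gt0// mulr_gt0// ltr_wpDl.
have [k hk] := cvge0_lt e1 cvG.
pose g := window M (fun x => clamp M (G_ k x)).
have cc : continuous (fun x => clamp M (G_ k x)) by exact: continuous_clamp.
have mc : measurable_fun setT (fun x => clamp M (G_ k x)) by exact: continuous_measurable_fun.
have bc x : `|clamp M (G_ k x)| <= M by exact: clamp_bound.
have mg : measurable_fun setT g by exact: measurable_window.
exists g, M; split.
- exact: window_integrable bc.
- by move=> x; rewrite /g /window; case: ifP => // _; rewrite normr0.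
- exact: shift_continuous_window.
(* One factor of the square is bounded by [2 * M], the other by the distance to [G_ k], which
   clamping does not increase. *)
have fgE x : (fn N x - g x) ^+ 2 <= 2 * M * (`|fn N x - G_ k x| * \1_E x).
  rewrite /g {1}/fn /window; case: ifPn => [xM|_].
    have xE : E x by rewrite inE'.
    have -> : fn N x = tr N x by rewrite /fn /window xM.
    rewrite indicE mem_set// mulr1 -[leLHS]real_normK ?num_real// expr2.
    apply: ler_pM => //; last exact: clamp_dist.
    by rewrite (le_trans (ler_normB _ _))// mulrDl mul1r lerD.
  by rewrite subrr expr0n/= mulr_ge0 ?mulr_ge0.
have mG : measurable_fun setT (G_ k) by exact: continuous_measurable_fun.
have mD : measurable_fun setT (fun x => (`|fn N x - G_ k x| * \1_E x)%:E).
  apply/measurable_EFinP; apply: measurable_funM; last exact: measurable_indic.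
  by apply: measurableT_comp => //; exact: measurable_funB.
have h2 : (\int[leb]_x ((fn N x - g x) ^+ 2)%:E <= (e / 4)%:E)%E.
  apply: (@le_trans _ _ (\int[leb]_x ((2 * M)%:E * (`|fn N x - G_ k x| * \1_E x)%:E))%E).
    apply: ge0_le_integral => //.
    - by move=> x _; rewrite lee_fin sqr_ge0.
    - by apply/measurable_EFinP; apply: measurable_funX; exact: (measurable_funB (mfn N) mg).
    - exact: measurable_funeM.
    - by move=> x _; rewrite -EFinM lee_fin.
  rewrite ge0_integralZl_EFin//; last by rewrite mulr_ge0.
  rewrite (_ : \int[leb]_x _ = \int[leb]_(x in E) `|(fn N x - G_ k x)%:E|)%E; last first.
    rewrite [RHS]integral_mkcond; apply: eq_integral => x _.
    by rewrite restrict_EFin/= patchE indicE; case: ifP; rewrite ?mulr1 ?mulr0.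
  apply: (@le_trans _ _ ((2 * M)%:E * (e / (8 * (M + 1)))%:E)%E).
    by apply: lee_wpmul2l; rewrite ?lee_fin ?mulr_ge0//; exact: ltW.
  rewrite -EFinM lee_fin.
  have arith (m : R) : 0 <= m -> 2 * m * (e / (8 * (m + 1))) = (e / 4) * (m / (m + 1)).
    by move=> m0; field; rewrite lt0r_neq0// ltr_wpDl.
  rewrite arith//.
  by rewrite ler_piMr ?(ltW e4)// ler_pdivrMr ?ltr_wpDl// mul1r lerDl.
have mFN := mF N.
have m2 : measurable_fun setT (fun x => ((fn N x - g x) ^+ 2)%:E).
  by apply/measurable_EFinP; apply: measurable_funX; exact: (measurable_funB (mfn N) mg).
apply: (@le_trans _ _ (\int[leb]_x (2%:E * ((f x - fn N x) ^+ 2)%:E +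
    2%:E * ((fn N x - g x) ^+ 2)%:E))%E).
  apply: ge0_le_integral => //.
  - by move=> x _; rewrite lee_fin sqr_ge0.
  - by apply/measurable_EFinP; apply: measurable_funX; exact: measurable_funB.
  - by apply: emeasurable_funD; exact: measurable_funeM.
  - move=> x _; rewrite -!EFinM -EFinD lee_fin.
    have := sqr_ge0 ((f x - fn N x) - (fn N x - g x)).
    set u := f x; set v := fn N x; set z := g x; nra.
rewrite ge0_integralD//; try exact: measurable_funeM; last 2 first.
- by move=> x _; rewrite -EFinM lee_fin mulr_ge0 ?sqr_ge0.
- by move=> x _; rewrite -EFinM lee_fin mulr_ge0 ?sqr_ge0.
rewrite !ge0_integralZl_EFin//; try (by move=> x _; rewrite lee_fin sqr_ge0).
rewrite (_ : e%:E = 2%:E * (e / 4)%:E + 2%:E * (e / 4)%:E)%E; last first.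
  by rewrite -!EFinM -EFinD; congr EFin; field.
by apply: leeD; apply: lee_wpmul2l; rewrite ?lee_fin//; exact: ltW.
Unshelve. all: by end_near.
Qed.

End plancherel_density.

Section plancherel_real.
Context {R : realType}.
Local Notation leb := (@lebesgue_measure R).
Implicit Types (f g : R -> R) (e xi : R).

Let L2 f := (\int[leb]_x (f x ^+ 2)%:E)%E.

(** The difference of the two sides is [(s a - b)^2 / s]. For small [s] the coefficient of the main
    term is close to 1, so this replaces the triangle inequality for norms while only squares are
    handled. *)
Lemma sqrD_le (s a b : R) : 0 < s ->
  (a + b) ^+ 2 <= (1 + s) * a ^+ 2 + (1 + s^-1) * b ^+ 2.
Proof.
move=> s0; rewrite -subr_ge0.
rewrite (_ : _ - _ = s^-1 * (s * a - b) ^+ 2); last by field; rewrite lt0r_neq0.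
by rewrite mulr_ge0 ?sqr_ge0// invr_ge0 ltW.
Qed.

(** First [e] tends to 0 at fixed [s], then [s] tends to 0; the order matters because [c s] may blow
    up as [s] tends to 0. *)
Lemma le_limit_quadratic (a b : R) (c : R -> R) : 0 <= b ->
  (forall s e, 0 < s -> 0 < e -> a <= (1 + s) ^+ 2 * b + c s * e) -> a <= b.
Proof.
move=> b0 H.
have H1 s : 0 < s -> a <= (1 + s) ^+ 2 * b.
  move=> s0; apply/ler_addgt0Pr => d d0.
  have k0 : 0 < `|c s| + 1 by rewrite ltr_wpDl.
  apply: (le_trans (H s (d / (`|c s| + 1)) s0 _)); first by rewrite divr_gt0.
  rewrite lerD2l mulrCA ler_piMr ?(ltW d0)// ler_pdivrMr// mul1r.
  by rewrite (le_trans (ler_norm _))// lerDl.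
apply/ler_addgt0Pr => d d0.
have k0 : 0 < 3 * b + d by rewrite ltr_wpDl// mulr_ge0.
(* For [s <= 1] one has [(1 + s)^2 b <= b + 3 s b], and this choice of [s] makes [3 s b] at most [d]
   without dividing by a possibly zero [b]. *)
have s0 : 0 < d / (3 * b + d) by rewrite divr_gt0.
have s1 : d / (3 * b + d) <= 1 by rewrite ler_pdivrMr// mul1r lerDr mulr_ge0.
apply: (le_trans (H1 _ s0)).
set s := d / _ in s0 s1 *.
have sb : s * (3 * b) <= d.
  by rewrite /s mulrAC ler_pdivrMr// ler_wpM2l ?(ltW d0)// lerDl ltW.
rewrite (_ : (1 + s) ^+ 2 * b = b + (2 * s + s * s) * b); last by ring.
rewrite lerD2l; apply: le_trans sb.
have -> : s * (3 * b) = (2 * s + s) * b by ring.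
by rewrite ler_wpM2r// lerD2l ler_piMr// ltW.
Qed.

Lemma cos_transformD f g xi : leb.-integrable setT (EFin \o f) ->
  leb.-integrable setT (EFin \o g) ->
  cos_transform (fun x => f x + g x) xi = cos_transform f xi + cos_transform g xi.
Proof.
move=> fi gi; rewrite /cos_transform -RintegralD//; try exact: integrable_Mcos.
by apply: eq_Rintegral => x _; rewrite mulrDl.
Qed.

Lemma sin_transformD f g xi : leb.-integrable setT (EFin \o f) ->
  leb.-integrable setT (EFin \o g) ->
  sin_transform (fun x => f x + g x) xi = sin_transform f xi + sin_transform g xi.
Proof.
move=> fi gi; rewrite /sin_transform -RintegralD//; try exact: integrable_Msin.
by apply: eq_Rintegral => x _; rewrite mulrDl.
Qed.

Lemma power_spectrumD_le (s : R) f g xi : 0 < s -> leb.-integrable setT (EFin \o f) ->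
  leb.-integrable setT (EFin \o g) ->
  power_spectrum (fun x => f x + g x) xi <=
  (1 + s) * power_spectrum f xi + (1 + s^-1) * power_spectrum g xi.
Proof.
move=> s0 fi gi; rewrite /power_spectrum cos_transformD// sin_transformD//.
apply: (le_trans (lerD (sqrD_le _ _ s0) (sqrD_le _ _ s0))).
by rewrite le_eqVlt; apply/orP; left; apply/eqP; ring.
Qed.

Lemma ge0_integral_comb (s t : R) (p q r : R -> R) : 0 <= s -> 0 <= t ->
  measurable_fun setT p -> measurable_fun setT q -> measurable_fun setT r ->
  (forall x, 0 <= p x) -> (forall x, 0 <= q x) -> (forall x, 0 <= r x) ->
  (forall x, r x <= s * p x + t * q x) ->
  (\int[leb]_x (r x)%:E <=
   s%:E * \int[leb]_x (p x)%:E + t%:E * \int[leb]_x (q x)%:E)%E.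
Proof.
move=> s0 t0 mp mq mr p0 q0 r0 H.
have mEp : measurable_fun setT (EFin \o p) by exact/measurable_EFinP.
have mEq : measurable_fun setT (EFin \o q) by exact/measurable_EFinP.
have mEr : measurable_fun setT (EFin \o r) by exact/measurable_EFinP.
rewrite -!ge0_integralZl_EFin//; try (by move=> x _; rewrite lee_fin).
rewrite -ge0_integralD//; try exact: measurable_funeM; last 2 first.
- by move=> x _; rewrite -EFinM lee_fin mulr_ge0.
- by move=> x _; rewrite -EFinM lee_fin mulr_ge0.
apply: ge0_le_integral => //.
- by move=> x _; rewrite lee_fin.
- by apply: emeasurable_funD; exact: measurable_funeM.
- by move=> x _; rewrite -!EFinM -EFinD lee_fin.
Qed.

(** Only the lower bound on the spectrum is left. With [g] close to [f] and satisfying the identity,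
    [f] is compared to [g] in space and [g] to [f] in frequency; [power_spectrum_le] controls the
    spectrum of the difference [g - f]. *)
Theorem plancherel_real f : leb.-integrable setT (EFin \o f) -> (L2 f < +oo)%E ->
  (\int[leb]_xi (power_spectrum f xi)%:E = (2 * pi)%:E * L2 f)%E.
Proof.
move=> fi f2; have mf : measurable_fun setT f by apply/measurable_EFinP; apply: measurable_int fi.
have mP := measurable_power_spectrum mf.
have P0 (g : R -> R) x : 0 <= power_spectrum g x := power_spectrum_ge0 g x.
apply/eqP; rewrite eq_le power_spectrum_le//=.
set A := (\int[leb]_xi _)%E; set B := (_ * _)%E.
have tp0 : 0 <= 2 * pi :> R by rewrite mulr_ge0 ?pi_ge0.
have B0 : (0 <= B)%E.
  by rewrite mule_ge0// integral_ge0// => x _; rewrite lee_fin sqr_ge0.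
have Boo : (B < +oo)%E by rewrite /B lte_mul_pinfty.
have A0 : (0 <= A)%E.
  by apply: integral_ge0 => x _; rewrite lee_fin power_spectrum_ge0.
have Aoo : (A < +oo)%E by apply: le_lt_trans Boo; exact: power_spectrum_le.
have Af : A \is a fin_num by rewrite ge0_fin_numE.
have Bf : B \is a fin_num by rewrite ge0_fin_numE.
rewrite -(fineK Af) -(fineK Bf) lee_fin.
(* The coefficient of [e] after both comparisons: the first term is the error on the frequency side,
   multiplied by [1 + s] in the second comparison, the other is the error on the space side. *)
pose c (s : R) : R := (1 + s) * ((1 + s^-1) * (2 * pi)) + (1 + s^-1) * (2 * pi).
apply: (le_limit_quadratic (c := c) (fine_ge0 A0)).
move=> s e s0 e0.
have [g [K [gi gK sg gf]]] := shift_continuous_dense mf f2 e0.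
have mg : measurable_fun setT g by apply/measurable_EFinP; apply: measurable_int gi.
have ai : leb.-integrable setT (EFin \o (fun x => g x - f x)).
  by rewrite /comp; under eq_fun do rewrite EFinB; exact: integrableB.
have gf' : ((2 * pi)%:E * \int[leb]_x ((g x - f x) ^+ 2)%:E <= (2 * pi * e)%:E)%E.
  rewrite [(2 * pi * e)%:E]EFinM; apply: lee_wpmul2l; first by rewrite lee_fin.
  apply: le_trans gf; rewrite le_eqVlt; apply/orP; left; apply/eqP.
  by apply: eq_integral => x _; rewrite -sqrrN opprB.
have gf'' : ((2 * pi)%:E * \int[leb]_x ((f x - g x) ^+ 2)%:E <= (2 * pi * e)%:E)%E.
  by rewrite [(2 * pi * e)%:E]EFinM; apply: lee_wpmul2l; rewrite ?lee_fin.
have s1 : 0 <= 1 + s by rewrite addr_ge0// ltW.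
have s2 : 0 <= 1 + s^-1 by rewrite addr_ge0// invr_ge0 ltW.
have mgf : measurable_fun setT (fun x => g x - f x) by exact: measurable_funB.
have mfg : measurable_fun setT (fun x => f x - g x) by exact: measurable_funB.
have H1 : ((2 * pi)%:E * L2 g <= ((1 + s) * fine A + (1 + s^-1) * (2 * pi * e))%:E)%E.
  rewrite -(plancherel_shift_continuous gi gK sg).
  apply: (@le_trans _ _ ((1 + s)%:E * A +
      (1 + s^-1)%:E * \int[leb]_xi (power_spectrum (fun x => g x - f x) xi)%:E)%E).
    apply: ge0_integral_comb => //; try exact: measurable_power_spectrum.
    move=> xi; have := power_spectrumD_le xi s0 fi ai.
    rewrite (_ : (fun x => f x + (g x - f x)) = g)//.
    by apply/funext => x; rewrite addrC subrK.
  rewrite [leRHS](_ : _ = (1 + s)%:E * A + (1 + s^-1)%:E * (2 * pi * e)%:E)%E; last first.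
    by rewrite -{2}(fineK Af) -!EFinM -EFinD.
  apply: leeD => //; apply: lee_wpmul2l; rewrite ?lee_fin//.
  exact: (le_trans (power_spectrum_le ai)).
have H2 : (B <= (1 + s)%:E * ((2 * pi)%:E * L2 g) + (1 + s^-1)%:E * (2 * pi * e)%:E)%E.
  apply: (@le_trans _ _ ((1 + s)%:E * ((2 * pi)%:E * L2 g) +
     (1 + s^-1)%:E * ((2 * pi)%:E * \int[leb]_x ((f x - g x) ^+ 2)%:E))%E); last first.
    by apply: leeD => //; apply: lee_wpmul2l; rewrite ?lee_fin.
  rewrite ![((1 + _)%:E * (_ * _))%E]muleCA -ge0_muleDr; last 2 first.
  - by rewrite mule_ge0// integral_ge0// => x _; rewrite lee_fin sqr_ge0.
  - by rewrite mule_ge0// integral_ge0// => x _; rewrite lee_fin sqr_ge0.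
  apply: lee_wpmul2l; rewrite ?lee_fin//.
  apply: ge0_integral_comb => //; try (by move=> x; exact: sqr_ge0);
    try exact: measurable_funX.
  by move=> x; rewrite -{1}(subrK (g x) (f x)) addrC; exact: sqrD_le.
rewrite -lee_fin fineK//; apply: (le_trans H2).
apply: (@le_trans _ _ ((1 + s)%:E * ((1 + s) * fine A + (1 + s^-1) * (2 * pi * e))%:E
    + (1 + s^-1)%:E * (2 * pi * e)%:E)%E).
  by apply: leeD => //; apply: lee_wpmul2l; rewrite ?lee_fin.
by rewrite -!EFinM -EFinD lee_fin le_eqVlt; apply/orP; left; apply/eqP; rewrite /c; ring.
Qed.

End plancherel_real.

(** * From real to complex functions: polarization and Parseval's identity on the line *)

Section square_integrable.
Context {R : realType} {d} {T : measurableType d}.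
Variable mu : {measure set T -> \bar R}.
Implicit Types f g h : T -> R[i].

Definition cL12 f := [/\ cmeas f, (\int[mu]_x (Normc.normc (f x))%:E < +oo)%E &
  (\int[mu]_x (nsqc (f x))%:E < +oo)%E].

Lemma cL12_integrable f : cL12 f -> cintegrable mu setT f.
Proof. by case=> mf f1 _; apply/cintegrableP. Qed.

Lemma measurable_nsqcE f : cmeas f -> measurable_fun setT (fun x => (nsqc (f x))%:E).
Proof. by move=> mf; apply/measurable_EFinP; exact: measurable_nsqc. Qed.

Lemma nsqcD_le (x y : R[i]) : nsqc (x + y) <= 2 * nsqc x + 2 * nsqc y.
Proof.
rewrite /nsqc ReD ImD; case: x => a b; case: y => c e /=.
by have h1 := sqr_ge0 (a - c); have h2 := sqr_ge0 (b - e); nra.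
Qed.

Lemma cL12D f g : cL12 f -> cL12 g -> cL12 (fun x => f x + g x).
Proof.
move=> Lf Lg; have [mf f1 f2] := Lf; have [mg g1 g2] := Lg.
have ifg := cintegrableD (cL12_integrable Lf) (cL12_integrable Lg).
split; [exact: cmeasD|exact: cintegrable_norm ifg|].
have m1 := measurable_nsqcE mf; have m2 := measurable_nsqcE mg.
apply: (@le_lt_trans _ _ (\int[mu]_x (2%:E * (nsqc (f x))%:E + 2%:E * (nsqc (g x))%:E))%E).
  apply: ge0_le_integral => //.
  - by move=> x _; rewrite lee_fin nsqc_ge0.
  - by apply: measurable_nsqcE; exact: cmeasD.
  - by apply: emeasurable_funD; exact: measurable_funeM.
  - by move=> x _; rewrite -!EFinM -EFinD lee_fin nsqcD_le.
rewrite ge0_integralD//; try exact: measurable_funeM; last 2 first.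
- by move=> x _; rewrite -EFinM lee_fin mulr_ge0 ?nsqc_ge0.
- by move=> x _; rewrite -EFinM lee_fin mulr_ge0 ?nsqc_ge0.
rewrite !ge0_integralZl_EFin//; try (by move=> x _; rewrite lee_fin nsqc_ge0).
by apply: lte_add_pinfty; rewrite lte_mul_pinfty.
Qed.

Lemma cL12Z c f : cL12 f -> cL12 (fun x => c * f x).
Proof.
move=> Lf; have [mf f1 f2] := Lf.
have ifc := cintegrableZl c (cL12_integrable Lf).
split; [by apply: cmeasM => //; exact: cmeas_cst|exact: cintegrable_norm ifc|].
under eq_integral do rewrite nsqcM EFinM.
rewrite ge0_integralZl_EFin//; first by rewrite lte_mul_pinfty// lee_fin nsqc_ge0.
- by move=> x _; rewrite lee_fin nsqc_ge0.
- exact: measurable_nsqcE.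
- exact: nsqc_ge0.
Qed.

Lemma polarization_Re (x y : R[i]) :
  complex.Re (x * conjc y) = 2^-1 * (nsqc (x + y) - nsqc x - nsqc y).
Proof. by case: x => a b; case: y => c e; rewrite /nsqc/=; field. Qed.

Lemma polarization_Im (x y : R[i]) :
  complex.Im (x * conjc y) = 2^-1 * (nsqc (x + 'i * y) - nsqc x - nsqc y).
Proof. by case: x => a b; case: y => c e; rewrite /nsqc/=; field. Qed.

Lemma integrable_nsqc f : cmeas f -> (\int[mu]_x (nsqc (f x))%:E < +oo)%E ->
  mu.-integrable setT (EFin \o (fun x => nsqc (f x))).
Proof.
move=> mf f2; apply/integrableP; split; first exact: measurable_nsqcE.
by under eq_integral do rewrite /= ger0_norm ?nsqc_ge0//.
Qed.

Lemma integral_polarization (p q r : T -> R) : mu.-integrable setT (EFin \o p) ->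
  mu.-integrable setT (EFin \o q) -> mu.-integrable setT (EFin \o r) ->
  mu.-integrable setT (EFin \o (fun x => 2^-1 * (p x - q x - r x))) /\
  \int[mu]_x (2^-1 * (p x - q x - r x)) =
  2^-1 * (\int[mu]_x p x - \int[mu]_x q x - \int[mu]_x r x).
Proof.
move=> ip iq ir.
have i1 : mu.-integrable setT (EFin \o (fun x => p x - q x)).
  by rewrite /comp; under eq_fun do rewrite EFinB; exact: integrableB.
have i2 : mu.-integrable setT (EFin \o (fun x => p x - q x - r x)).
  by rewrite /comp; under eq_fun do rewrite EFinB; exact: integrableB.
split; first exact: integrable_EFinZl.
by rewrite RintegralZl// RintegralB// RintegralB.
Qed.

End square_integrable.

Section polarization.
Context {R : realType} {d1 d2} {T : measurableType d1} {S : measurableType d2}.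
Variables (mu : {measure set T -> \bar R}) (nu : {measure set S -> \bar R}).

Lemma cintegrable_polarization (f h : T -> R[i]) : cL12 mu f -> cL12 mu h ->
  cintegrable mu setT (fun x => f x * conjc (h x)).
Proof.
move=> Lf Lh; have [mf _ f2] := Lf; have [mh _ h2] := Lh.
have [ms _ s2] := cL12D Lf Lh; have [mi _ i2] := cL12D Lf (cL12Z 'i Lh).
split.
- have := (integral_polarization (integrable_nsqc ms s2) (integrable_nsqc mf f2)
    (integrable_nsqc mh h2)).1.
  congr (_.-integrable _ _); apply/funext => x /=; by rewrite -polarization_Re.
- have := (integral_polarization (integrable_nsqc mi i2) (integrable_nsqc mf f2)
    (integrable_nsqc mh h2)).1.
  congr (_.-integrable _ _); apply/funext => x /=; by rewrite -polarization_Im.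
Qed.

(** [F] and [H] play the role of transforms of [f] and [h]. The real part of an inner product is
    read off from the squared norms of the summands and of their sum, the imaginary part from those
    with ['i * h] in the sum, so four norm identities give one for inner products. *)
Lemma parseval_polarization (f h : T -> R[i]) (F H : S -> R[i]) (K : R) :
  0 <= K -> cmeas F -> cmeas H -> cL12 mu f -> cL12 mu h ->
  (\int[nu]_x (nsqc (F x))%:E = K%:E * \int[mu]_x (nsqc (f x))%:E)%E ->
  (\int[nu]_x (nsqc (H x))%:E = K%:E * \int[mu]_x (nsqc (h x))%:E)%E ->
  (\int[nu]_x (nsqc (F x + H x))%:E = K%:E * \int[mu]_x (nsqc (f x + h x))%:E)%E ->
  (\int[nu]_x (nsqc (F x + 'i * H x))%:E =
    K%:E * \int[mu]_x (nsqc (f x + 'i * h x))%:E)%E ->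
  cintegrable nu setT (fun x => F x * conjc (H x)) /\
  cintegral nu setT (fun x => F x * conjc (H x)) =
  K%:C * cintegral mu setT (fun x => f x * conjc (h x)).
Proof.
move=> K0 mF mH Lf Lh eF eH eS eI.
have [mf _ f2] := Lf; have [mh _ h2] := Lh.
have [ms _ s2] := cL12D Lf Lh; have [mi _ i2] := cL12D Lf (cL12Z 'i Lh).
have mS : cmeas (fun x => F x + H x) by exact: cmeasD.
have mI : cmeas (fun x => F x + 'i * H x).
  by apply: cmeasD => //; apply: cmeasM => //; exact: cmeas_cst.
have fin (G : S -> R[i]) (g : T -> R[i]) : cmeas G -> cmeas g ->
    (\int[mu]_x (nsqc (g x))%:E < +oo)%E ->
    (\int[nu]_x (nsqc (G x))%:E = K%:E * \int[mu]_x (nsqc (g x))%:E)%E ->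
    nu.-integrable setT (EFin \o (fun x => nsqc (G x))) /\
    \int[nu]_x nsqc (G x) = K * \int[mu]_x nsqc (g x).
  move=> mG mg g2 eG; split.
    by apply: integrable_nsqc => //; rewrite eG lte_mul_pinfty.
  by rewrite /Rintegral eG fineM//; exact: (integrable_fin_num _ (integrable_nsqc mg g2)).
have [iF EF] := fin _ _ mF mf f2 eF; have [iH EH] := fin _ _ mH mh h2 eH.
have [iS ES] := fin _ _ mS ms s2 eS; have [iI EI] := fin _ _ mI mi i2 eI.
have [r1 e1] := integral_polarization iS iF iH.
have [r2 e2] := integral_polarization iI iF iH.
have [_ e3] := integral_polarization (integrable_nsqc ms s2) (integrable_nsqc mf f2)
  (integrable_nsqc mh h2).
have [_ e4] := integral_polarization (integrable_nsqc mi i2) (integrable_nsqc mf f2)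
  (integrable_nsqc mh h2).
split.
  split.
  - by move: r1; congr (_.-integrable _ _); apply/funext => x /=; rewrite -polarization_Re.
  - by move: r2; congr (_.-integrable _ _); apply/funext => x /=; rewrite -polarization_Im.
apply: complexP; rewrite ?ReM ?ImM /cintegral/= mul0r ?subr0 ?addr0.
- under eq_Rintegral do rewrite polarization_Re.
  under [in RHS]eq_Rintegral do rewrite polarization_Re.
  by rewrite e1 e3 ES EF EH; ring.
- under eq_Rintegral do rewrite polarization_Im.
  under [in RHS]eq_Rintegral do rewrite polarization_Im.
  by rewrite e2 e4 EI EF EH; ring.
Qed.

End polarization.

Lemma ge0_half {R : realFieldType} (x : \bar R) : (0 <= x)%E ->
  x = ((2^-1)%:E * x + (2^-1)%:E * x)%E.
Proof.
case: x => [r| |]//= _; last by rewrite gt0_muley// lte_fin invr_gt0.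
by rewrite -!EFinM -EFinD; congr EFin; field.
Qed.

Section fourier_complex.
Context {R : realType}.
Local Notation leb := (@lebesgue_measure R).
Implicit Types f g h : R -> R[i].

Lemma cintegrable_Mexpi {d} {T : measurableType d} (mu : {measure set T -> \bar R})
    (f : T -> R[i]) (r : T -> R) : cintegrable mu setT f -> measurable_fun setT r ->
  cintegrable mu setT (fun x => f x * expi (r x)).
Proof.
move=> fi mr; apply: (cintegrable_le _ fi) => [|x].
  by apply: cmeasM; [exact: cintegrable_meas fi|exact: cmeas_expi].
by rewrite Normc.normcM normc_expi mulr1.
Qed.

Lemma cintegrable_fourier f xi : cintegrable leb setT f ->
  cintegrable leb setT (fun x => f x * expi (- (x * xi))).
Proof.
move=> fi; apply: cintegrable_Mexpi => //; apply: measurable_funN.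
exact: measurable_funM.
Qed.

Lemma fourierD f g xi : cintegrable leb setT f -> cintegrable leb setT g ->
  fourier (fun x => f x + g x) xi = fourier f xi + fourier g xi.
Proof.
move=> fi gi; rewrite /fourier -cintegralD; try exact: cintegrable_fourier.
by congr cintegral; apply/funext => x; rewrite mulrDl.
Qed.

Lemma fourierZ c f xi : cintegrable leb setT f ->
  fourier (fun x => c * f x) xi = c * fourier f xi.
Proof.
move=> fi; rewrite /fourier -cintegralZl; last exact: cintegrable_fourier.
by congr cintegral; apply/funext => x; rewrite mulrA.
Qed.

Lemma cmeas_fourier f : cmeas f -> cmeas (fourier f).
Proof.
move=> mf; apply: (@cmeas_cintegral2 _ _ _ _ _ leb
  (fun z : R * R => f z.1 * expi (- (z.1 * z.2)))).
apply: cmeasM; first exact: (cmeas_comp mf measurable_fst).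
by apply: cmeas_expi; apply: measurable_funN; exact: measurable_funM.
Qed.

Lemma fourierE f xi : cintegrable leb setT f ->
  let f1 := @complex.Re R \o f in let f2 := @complex.Im R \o f in
  fourier f xi = (cos_transform f1 xi + sin_transform f2 xi)
    +i* (cos_transform f2 xi - sin_transform f1 xi).
Proof.
move=> [i1 i2] f1 f2; rewrite /fourier /cintegral /cos_transform /sin_transform.
congr (_ +i* _).
- rewrite -RintegralD//; [|exact: integrable_Mcos|exact: integrable_Msin].
  by apply: eq_Rintegral => x _; rewrite ReM/= cosN sinN; ring.
- rewrite -RintegralB//; [|exact: integrable_Mcos|exact: integrable_Msin].
  by apply: eq_Rintegral => x _; rewrite ImM/= cosN sinN; ring.
Qed.

Lemma cos_transformN (p : R -> R) xi : cos_transform p (- xi) = cos_transform p xi.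
Proof. by apply: eq_Rintegral => x _; rewrite mulrN cosN. Qed.

Lemma sin_transformN (p : R -> R) xi : leb.-integrable setT (EFin \o p) ->
  sin_transform p (- xi) = - sin_transform p xi.
Proof.
move=> ip; rewrite /sin_transform -[RHS]mulN1r -RintegralZl//; last exact: integrable_Msin.
by apply: eq_Rintegral => x _; rewrite mulrN sinN; ring.
Qed.

(** Reflection preserves Lebesgue measure. This is used to discard the odd part of [|f^|^2] without
    having to know beforehand that it is integrable. *)
Lemma ge0_integral_even_part (p : R -> R) : measurable_fun setT p ->
  (forall x, 0 <= p x) ->
  (\int[leb]_x (p x)%:E = \int[leb]_x (2^-1 * (p x + p (- x)))%:E)%E.
Proof.
move=> mp p0; have mEp : measurable_fun setT (EFin \o p) by exact/measurable_EFinP.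
have mN : measurable_fun setT (fun x : R => (p (- x))%:E).
  by apply: (measurableT_comp mEp (measurable_funN _)); exact: measurable_id.
have Ep0 x : (0 <= (p x)%:E)%E by rewrite lee_fin.
have IN : (\int[leb]_x (p (- x))%:E = \int[leb]_x (p x)%:E)%E.
  have N1 : (-1 : R) != 0 by rewrite oppr_eq0 oner_eq0.
  have := ge0_integral_affine 0 N1 mEp Ep0.
  rewrite normrN1 invr1 mul1e => <-.
  by apply: eq_integral => x _; rewrite /= mulN1r addr0.
have h0 : 0 <= 2^-1 :> R by rewrite invr_ge0.
rewrite [LHS]ge0_half; last exact: integral_ge0.
have E1 := ge0_integralZl_EFin leb measurableT (fun x _ => Ep0 x) mEp h0.
have E2 := ge0_integralZl_EFin leb measurableT (fun x _ => Ep0 (- x)) mN h0.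
rewrite -{2}IN -E1 -E2 -ge0_integralD//; try exact: measurable_funeM; last 2 first.
- by move=> x _; rewrite -EFinM lee_fin mulr_ge0.
- by move=> x _; rewrite -EFinM lee_fin mulr_ge0.
by apply: eq_integral => x _; rewrite -!EFinM -EFinD mulrDr.
Qed.

(** For [f = f1 + i f2], the squared modulus of the transform is the sum of the two power spectra
    plus a cross term of [f1] and [f2]. The cross term is odd in [xi], because cosine transforms are
    even and sine transforms odd, and vanishes when [xi] and [- xi] are averaged. *)
Lemma plancherel1 f : cL12 leb f ->
  (\int[leb]_xi (nsqc (fourier f xi))%:E = (2 * pi)%:E * \int[leb]_x (nsqc (f x))%:E)%E.
Proof.
move=> Lf; have [mf _ fi2] := Lf; have fi := cL12_integrable Lf.
case: (fi) => i1 i2; case: (mf) => m1 m2.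
set f1 := @complex.Re R \o f in i1 m1; set f2 := @complex.Im R \o f in i2 m2.
have mF : measurable_fun setT (fun xi => nsqc (fourier f xi)).
  by apply: measurable_nsqc; exact: cmeas_fourier.
have m1s : measurable_fun setT (fun x => (f1 x ^+ 2)%:E).
  by apply/measurable_EFinP; exact: measurable_funX.
have m2s : measurable_fun setT (fun x => (f2 x ^+ 2)%:E).
  by apply/measurable_EFinP; exact: measurable_funX.
have s12 : (\int[leb]_x (nsqc (f x))%:E =
    \int[leb]_x (f1 x ^+ 2)%:E + \int[leb]_x (f2 x ^+ 2)%:E)%E.
  by rewrite -ge0_integralD// => x _; rewrite lee_fin sqr_ge0.
have f1oo : (\int[leb]_x (f1 x ^+ 2)%:E < +oo)%E.
  apply: le_lt_trans fi2; rewrite s12 leeDl// integral_ge0// => x _.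
  by rewrite lee_fin sqr_ge0.
have f2oo : (\int[leb]_x (f2 x ^+ 2)%:E < +oo)%E.
  apply: le_lt_trans fi2; rewrite s12 leeDr// integral_ge0// => x _.
  by rewrite lee_fin sqr_ge0.
have pw xi : nsqc (fourier f xi) + nsqc (fourier f (- xi)) =
    2 * (power_spectrum f1 xi + power_spectrum f2 xi).
  rewrite (fourierE xi fi) (fourierE (- xi) fi) -/f1 -/f2.
  rewrite !cos_transformN (sin_transformN xi i1) (sin_transformN xi i2).
  rewrite /nsqc /power_spectrum /=.
  by ring.
have mP1 := measurable_power_spectrum m1; have mP2 := measurable_power_spectrum m2.
rewrite (ge0_integral_even_part mF) => [|xi]; last exact: nsqc_ge0.
transitivity (\int[leb]_xi ((power_spectrum f1 xi)%:E + (power_spectrum f2 xi)%:E))%E.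
  by apply: eq_integral => xi _; rewrite -EFinD pw mulrA mulVf ?mul1r.
rewrite ge0_integralD//; last 4 first.
- by move=> x _; rewrite lee_fin power_spectrum_ge0.
- exact/measurable_EFinP.
- by move=> x _; rewrite lee_fin power_spectrum_ge0.
- exact/measurable_EFinP.
have q1 : (0 <= \int[leb]_x (f1 x ^+ 2)%:E)%E.
  by apply: integral_ge0 => x _; rewrite lee_fin sqr_ge0.
have q2 : (0 <= \int[leb]_x (f2 x ^+ 2)%:E)%E.
  by apply: integral_ge0 => x _; rewrite lee_fin sqr_ge0.
by rewrite (plancherel_real i1 f1oo) (plancherel_real i2 f2oo) s12 (ge0_muleDr _ q1 q2).
Qed.

Lemma parseval1 f h : cL12 leb f -> cL12 leb h ->
  cintegrable leb setT (fun xi => fourier f xi * conjc (fourier h xi)) /\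
  cintegral leb setT (fun xi => fourier f xi * conjc (fourier h xi)) =
  (2 * pi)%:C * cintegral leb setT (fun x => f x * conjc (h x)).
Proof.
move=> Lf Lh; have [mf _ _] := Lf; have [mh _ _] := Lh.
have fi := cL12_integrable Lf; have hi := cL12_integrable Lh.
have Lih := cL12Z 'i Lh; have ihi := cL12_integrable Lih.
apply: parseval_polarization => //; rewrite ?mulr_ge0 ?pi_ge0//.
- exact: cmeas_fourier.
- exact: cmeas_fourier.
- exact: plancherel1.
- exact: plancherel1.
- under eq_integral do rewrite -fourierD//.
  exact: (plancherel1 (cL12D Lf Lh)).
- under eq_integral do rewrite -fourierZ// -fourierD//.
  exact: (plancherel1 (cL12D Lf Lih)).
Qed.

End fourier_complex.

(** * Parseval's identity on the n-dimensional space *)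

Section lebesgue_tuple_theory.
Context {R : realType}.
Local Notation leb := (@lebesgue_measure R).
Local Notation lebn n := (lebesgue_tuple R n).

Lemma ge0_integral_lebesgue_tupleS n (g : n.+1.-tuple R -> \bar R) :
  measurable_fun setT g -> (forall x, 0 <= g x)%E ->
  (\int[lebn n.+1]_x g x = \int[leb]_t \int[lebn n]_x g (tuple_cons (t, x)))%E.
Proof.
move=> mg g0.
have := @ge0_integral_pushforward _ _ (measurableTypeR R * n.-tuple R)%type _ R _
  (@measurable_tuple_cons R n) (prod_measure leb (lebn n)) setT g measurableT mg
  (fun x _ => g0 x).
rewrite preimage_setT => h; rewrite [LHS]h.
have mc : measurable_fun setT (g \o (@tuple_cons R n)).
  by apply: (measurableT_comp mg); exact: measurable_tuple_cons.
exact: (fubini_tonelli1 (m1 := leb) (m2 := lebn n) _ mc (fun z => g0 _)).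
Qed.

Lemma cintegral_lebesgue_tupleS n (f : n.+1.-tuple R -> R[i]) :
  cintegrable (lebn n.+1) setT f ->
  cintegrable (leb \x lebn n)%E setT (f \o tuple_cons) /\
  cintegral (lebn n.+1) setT f = cintegral (leb \x lebn n)%E setT (f \o tuple_cons).
Proof.
move=> fi; have [mf f1] := (cintegrableP _ _).1 fi.
have mfc : cmeas (f \o tuple_cons).
  by apply: (cmeas_comp mf); exact: measurable_tuple_cons.
have ifc : cintegrable (leb \x lebn n)%E setT (f \o tuple_cons).
  apply: cintegrable_prod1 => //.
  rewrite -(ge0_integral_lebesgue_tupleS (g := fun x => (Normc.normc (f x))%:E))//.
  - by apply/measurable_EFinP; exact: measurable_normc.
  - by move=> x; rewrite lee_fin normc_ge0.
split => //; apply: complexP; congr fine.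
- have [i1 _] := ifc; have [m1 _] := mf.
  have := @integral_pushforward _ _ (measurableTypeR R * n.-tuple R)%type _ R _
    (@measurable_tuple_cons R n) (prod_measure leb (lebn n)) setT
    (EFin \o (@complex.Re R \o f)).
  by rewrite preimage_setT; apply => //; exact/measurable_EFinP.
- have [_ i1] := ifc; have [_ m1] := mf.
  have := @integral_pushforward _ _ (measurableTypeR R * n.-tuple R)%type _ R _
    (@measurable_tuple_cons R n) (prod_measure leb (lebn n)) setT
    (EFin \o (@complex.Im R \o f)).
  by rewrite preimage_setT; apply => //; exact/measurable_EFinP.
Qed.

Lemma measurable_dotp {d} {T : measurableType d} n (p q : T -> n.-tuple R) :
  measurable_fun setT p -> measurable_fun setT q ->
  measurable_fun setT (fun z => dotp (p z) (q z)).
Proof.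
move=> mp mq; apply: measurable_sum => i; apply: measurable_funM.
- exact: (measurableT_comp (measurable_tnth i) mp).
- exact: (measurableT_comp (measurable_tnth i) mq).
Qed.

Lemma dotp_cons n (t s : R) (x y : n.-tuple R) :
  dotp (tuple_cons (t, x)) (tuple_cons (s, y)) = t * s + dotp x y.
Proof.
rewrite /dotp big_ord_recl !tnth0; congr (_ + _).
by apply: eq_bigr => i _; rewrite !tnthS.
Qed.

Definition scale_tuple n (r : R) (x : n.-tuple R) : n.-tuple R :=
  [tuple r * tnth x i | i < n].

Lemma measurable_scale_tuple {d} {T : measurableType d} n (r : T -> R)
    (p : T -> n.-tuple R) : measurable_fun setT r -> measurable_fun setT p ->
  measurable_fun setT (fun z => scale_tuple (r z) (p z)).
Proof.
move=> mr mp; apply/measurable_fun_tnthP => i.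
rewrite (_ : _ \o _ = fun z => r z * tnth (p z) i); last first.
  by apply/funext => z; rewrite /= tnth_mktuple.
by apply: measurable_funM => //; exact: (measurableT_comp (measurable_tnth i) mp).
Qed.

Lemma dotp_scaler n (r : R) (x y : n.-tuple R) : dotp x (scale_tuple r y) = r * dotp x y.
Proof.
by rewrite /dotp mulr_sumr; apply: eq_bigr => i _; rewrite tnth_mktuple mulrCA.
Qed.

Lemma dotp_scalel n (r : R) (x y : n.-tuple R) : dotp (scale_tuple r x) y = r * dotp x y.
Proof.
by rewrite /dotp mulr_sumr; apply: eq_bigr => i _; rewrite tnth_mktuple mulrA.
Qed.

Lemma norm2_scale n (r : R) (x : n.-tuple R) : norm2 (scale_tuple r x) = `|r| * norm2 x.
Proof.
rewrite /norm2 dotp_scaler dotp_scalel mulrA -expr2 sqrtrM ?sqr_ge0//.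
by rewrite sqrtr_sqr.
Qed.

Lemma norm2_ge0 n (x : n.-tuple R) : 0 <= norm2 x.
Proof. exact: sqrtr_ge0. Qed.

Lemma scale_tuple_cons n (r t : R) (x : n.-tuple R) :
  scale_tuple r (tuple_cons (t, x)) = tuple_cons (r * t, scale_tuple r x).
Proof.
apply: eq_from_tnth => i; rewrite tnth_mktuple.
case: (unliftP ord0 i) => [j|] ->; last by rewrite !tnth0.
by rewrite !tnthS tnth_mktuple.
Qed.

Lemma scale_tupleA n (r s : R) (x : n.-tuple R) :
  scale_tuple r (scale_tuple s x) = scale_tuple (r * s) x.
Proof. by apply: eq_from_tnth => i; rewrite !tnth_mktuple mulrA. Qed.

(** Induction on the dimension: each coordinate contributes one factor [|r|^-1] by the
    one-dimensional substitution. *)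
Lemma ge0_integral_scale n (r : R) (g : n.-tuple R -> \bar R) : r != 0 ->
  measurable_fun setT g -> (forall x, 0 <= g x)%E ->
  (\int[lebn n]_x g (scale_tuple r x) = (`|r| ^- n)%:E * \int[lebn n]_x g x)%E.
Proof.
move=> r0; elim: n g => [|n IH] g mg g0.
  rewrite expr0 invr1 mul1e; apply: eq_integral => x _; congr g.
  by rewrite (tuple0 x) (tuple0 (scale_tuple _ _)).
have mgs : measurable_fun setT (fun x : n.+1.-tuple R => g (scale_tuple r x)).
  apply: (measurableT_comp mg); apply: measurable_scale_tuple => //.
rewrite !ge0_integral_lebesgue_tupleS//.
have mgc : measurable_fun setT (fun z : R * n.-tuple R => g (tuple_cons z)).
  by apply: (measurableT_comp mg); exact: measurable_tuple_cons.
pose G t := (\int[lebn n]_x g (tuple_cons (t, x)))%E.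
have mG : measurable_fun setT G.
  by apply: (measurable_fun_fubini_tonelli_F (m2 := lebn n)
    (fun z : R * n.-tuple R => g (tuple_cons z))).
have G0 t : (0 <= G t)%E by exact: integral_ge0.
transitivity (\int[leb]_t ((`|r| ^- n)%:E * G (r * t + 0)%R))%E.
  apply: eq_integral => t _; rewrite addr0 -IH//.
  - by apply: eq_integral => x _; rewrite scale_tuple_cons.
  - exact: (measurableT_comp mgc (pair1_measurable _)).
have mGa : measurable_fun setT (fun t : R => G (r * t + 0)).
  exact: (measurableT_comp mG (measurable_affine r 0)).
have k0 : 0 <= `|r| ^- n by rewrite invr_ge0 exprn_ge0.
rewrite (ge0_integralZl_EFin leb measurableT (fun t _ => G0 _) mGa k0).
by rewrite (ge0_integral_affine 0 r0 mG G0) muleA -EFinM exprSr invfM.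
Qed.

(** The origin lies in the hyperplane where the first coordinate vanishes, which is null as a
    product with a null factor. The dimension is positive because in dimension 0 the measure is a
    point mass at the only vector. *)
Lemma ae_norm2_neq0 n : {ae lebn n.+1, forall x, norm2 x != 0}.
Proof.
have m0 : measurable [set x : n.+1.-tuple R | norm2 x = 0].
  rewrite (_ : [set _ | _] = setT `&` norm2 @^-1` [set 0]); last first.
    by apply/seteqP; split=> x //= [].
  exact: measurable_norm2.
exists [set x | norm2 x = 0]; split => //; last first.
  by move=> x /= /negP; rewrite negbK => /eqP.
pose A : set (R * n.-tuple R) := [set 0] `*` setT.
have mA : measurable A by apply: measurableX.
apply/eqP; rewrite -measure_le0.
have -> : 0%E = (leb \x lebn n)%E A.
  rewrite product_measure1E//.
  by rewrite /= lebesgue_measure_set1 mul0e.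
rewrite /lebesgue_tuple /= /lebesgue_cons /pushforward.
apply: le_measure; rewrite ?inE//.
  by rewrite -[X in measurable X]setTI; exact: measurable_tuple_cons.
move=> [t x]; rewrite /= /norm2 dotp_cons => /eqP.
have xx : 0 <= dotp x x by apply: sumr_ge0 => i _; rewrite -expr2 sqr_ge0.
rewrite sqrtr_eq0 => tx; split => //=.
have : t * t <= 0 by apply: le_trans tx; rewrite lerDl.
by rewrite -expr2 => /(conj (sqr_ge0 t))/andP; rewrite -eq_le eq_sym sqrf_eq0 => /eqP.
Qed.

End lebesgue_tuple_theory.

Lemma ae_imply {d} {T : measurableType d} {R : realType}
    (mu : {measure set T -> \bar R}) (P Q : T -> Prop) : (forall x, P x -> Q x) ->
  {ae mu, forall x, P x} -> {ae mu, forall x, Q x}.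
Proof. by move=> PQ; apply: filterS. Qed.

Lemma ge0_integral_lty_ae {d} {T : measurableType d} {R : realType}
    (mu : {measure set T -> \bar R}) (f : T -> \bar R) : measurable_fun setT f ->
  (forall x, 0 <= f x)%E -> (\int[mu]_x f x < +oo)%E ->
  {ae mu, forall x, (f x < +oo)%E}.
Proof.
move=> mf f0 foo.
have fi : mu.-integrable setT f.
  by apply/integrableP; split => //; under eq_integral do rewrite gee0_abs//.
apply: filterS (integrable_ae measurableT fi) => x /= /(_ I).
by rewrite ge0_fin_numE.
Qed.

Section fourier_tuple.
Context {R : realType}.
Local Notation leb := (@lebesgue_measure R).
Local Notation lebn n := (lebesgue_tuple R n).

Definition fourier_tuple n (f : n.-tuple R -> R[i]) (xi : n.-tuple R) : R[i] :=
  cintegral (lebn n) setT (fun x => f x * expi (- dotp x xi)).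

Lemma cintegrable_fourier_tuple n (f : n.-tuple R -> R[i]) xi :
  cintegrable (lebn n) setT f ->
  cintegrable (lebn n) setT (fun x => f x * expi (- dotp x xi)).
Proof.
move=> fi; apply: cintegrable_Mexpi => //; apply: measurable_funN.
by apply: measurable_dotp; [exact: measurable_id|exact: measurable_cst].
Qed.

Lemma fourier_tupleD n (f g : n.-tuple R -> R[i]) xi :
  cintegrable (lebn n) setT f -> cintegrable (lebn n) setT g ->
  fourier_tuple (fun x => f x + g x) xi = fourier_tuple f xi + fourier_tuple g xi.
Proof.
move=> fi gi; rewrite /fourier_tuple -cintegralD; try exact: cintegrable_fourier_tuple.
by congr cintegral; apply/funext => x; rewrite mulrDl.
Qed.

Lemma fourier_tupleZ n c (f : n.-tuple R -> R[i]) xi : cintegrable (lebn n) setT f ->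
  fourier_tuple (fun x => c * f x) xi = c * fourier_tuple f xi.
Proof.
move=> fi; rewrite /fourier_tuple -cintegralZl; last exact: cintegrable_fourier_tuple.
by congr cintegral; apply/funext => x; rewrite mulrA.
Qed.

Lemma cmeas_fourier_tuple n (f : n.-tuple R -> R[i]) : cmeas f -> cmeas (fourier_tuple f).
Proof.
move=> mf; apply: (@cmeas_cintegral2 _ _ _ _ _ (lebn n)
  (fun z : n.-tuple R * n.-tuple R => f z.1 * expi (- dotp z.1 z.2))).
apply: cmeasM; first exact: (cmeas_comp mf measurable_fst).
apply: cmeas_expi; apply: measurable_funN.
by apply: measurable_dotp; [exact: measurable_fst|exact: measurable_snd].
Qed.

(** In dimension 0 the measure is the point mass at the empty tuple and the phase is 1, so the
    transform is the identity. *)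
Let plancherel_tuple0 (f : 0.-tuple R -> R[i]) : cL12 (lebn 0) f ->
  (\int[lebn 0]_xi (nsqc (fourier_tuple f xi))%:E = \int[lebn 0]_x (nsqc (f x))%:E)%E.
Proof.
move=> [[m1 m2] _ _]; apply: eq_integral => xi _; congr EFin.
have -> : fourier_tuple f xi = f [tuple].
  have -> : fourier_tuple f xi = cintegral (lebn 0) setT f.
    congr cintegral; apply/funext => x; rewrite /dotp big_ord0 oppr0.
    by apply: complexP; rewrite ?ReM ?ImM/= cos0 sin0; ring.
  apply: complexP; rewrite /cintegral/= /Rintegral.
  - rewrite (integral_dirac _ measurableT); last exact/measurable_EFinP.
    by rewrite diracT mul1e.
  - rewrite (integral_dirac _ measurableT); last exact/measurable_EFinP.
    by rewrite diracT mul1e.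
by rewrite (tuple0 xi).
Qed.

Section step.
Variables (n : nat) (f : n.+1.-tuple R -> R[i]).
Hypothesis Lf : cL12 (lebn n.+1) f.
Hypothesis IH : forall g : n.-tuple R -> R[i], cL12 (lebn n) g ->
  (\int[lebn n]_xi (nsqc (fourier_tuple g xi))%:E =
   ((2 * pi) ^+ n)%:E * \int[lebn n]_x (nsqc (g x))%:E)%E.

Let phi (z : R * n.-tuple R) : R[i] := f (tuple_cons z).

Let mphi : cmeas phi.
Proof. by have [mf _ _] := Lf; apply: (cmeas_comp mf); exact: measurable_tuple_cons. Qed.

Let iphi : cintegrable (leb \x lebn n)%E setT phi.
Proof. exact: (cintegral_lebesgue_tupleS (cL12_integrable Lf)).1. Qed.

(** The partial Fourier transform in the first coordinate. *)
Let g (xi0 : R) (y : n.-tuple R) : R[i] := fourier (fun t => phi (t, y)) xi0.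

Let integrand xi0 (z : R * n.-tuple R) : R[i] := phi z * expi (- (z.1 * xi0)).

Let integrable_integrand xi0 : cintegrable (leb \x lebn n)%E setT (integrand xi0).
Proof.
apply: cintegrable_Mexpi; first exact: iphi.
by apply: measurable_funN; apply: measurable_funM.
Qed.

(** The integral over the first coordinate is taken first. The phase of the other coordinates can be
    pulled out of it only where the section is integrable, that is for almost every [y], which
    suffices under the outer integral. *)
Let fourier_cons xi0 xi :
  fourier_tuple f (tuple_cons (xi0, xi)) = fourier_tuple (g xi0) xi.
Proof.
have fi := cL12_integrable Lf.
have [i1 e1] := cintegral_lebesgue_tupleS
  (cintegrable_fourier_tuple (tuple_cons (xi0, xi)) fi).
have [i2 e2] := cfubini2 i1.
rewrite [LHS]e1 -[LHS]e2.
have mg : cmeas (g xi0) := cintegrable_meas (cfubini2 (integrable_integrand xi0)).1.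
apply: ae_eq_cintegral.
- exact: cintegrable_meas i2.
- apply: cmeasM => //; apply: cmeas_expi; apply: measurable_funN.
  by apply: measurable_dotp; [exact: measurable_id|exact: measurable_cst].
apply: filterS (ae_cintegrable2 (integrable_integrand xi0)) => y iy.
rewrite /g /fourier mulrC -(cintegralZl _ iy); congr cintegral.
apply/funext => t; rewrite /integrand /comp dotp_cons /phi/= opprD expiD.
by rewrite [RHS]mulrC mulrA.
Qed.

Let cmeas_joint : cmeas (fun z : R * n.-tuple R => g z.1 z.2).
Proof.
apply: (@cmeas_cintegral1 _ _ _ (R * n.-tuple R)%type _ leb
  (fun w : (R * n.-tuple R) * R => integrand w.1.1 (w.2, w.1.2))).
have m1 : measurable_fun setT (fun w : (R * n.-tuple R) * R => w.1.1).
  exact: (measurableT_comp measurable_fst measurable_fst).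
have m2 : measurable_fun setT (fun w : (R * n.-tuple R) * R => w.1.2).
  exact: (measurableT_comp measurable_snd measurable_fst).
apply: cmeasM.
- apply: (cmeas_comp mphi (phi := fun w : (R * n.-tuple R) * R => (w.2, w.1.2))).
  by apply/measurable_fun_pair => //; exact: measurable_snd.
- apply: cmeas_expi; apply: measurable_funN.
  by apply: measurable_funM => //; exact: measurable_snd.
Qed.

Let mng : measurable_fun setT (fun z : R * n.-tuple R => (nsqc (g z.1 z.2))%:E).
Proof. exact: (measurable_nsqcE cmeas_joint). Qed.

Let ng0 (z : R * n.-tuple R) : (0 <= (nsqc (g z.1 z.2))%:E)%E.
Proof. by rewrite lee_fin nsqc_ge0. Qed.

Let mnf : measurable_fun setT (fun z : R * n.-tuple R => (nsqc (phi z))%:E).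
Proof. exact: (measurable_nsqcE mphi). Qed.

Let nf0 (z : R * n.-tuple R) : (0 <= (nsqc (phi z))%:E)%E.
Proof. by rewrite lee_fin nsqc_ge0. Qed.

Let tp0 : 0 <= 2 * pi :> R.
Proof. by rewrite mulr_ge0 ?pi_ge0. Qed.

Let norm_f : (\int[lebn n.+1]_x (nsqc (f x))%:E =
  \int[lebn n]_y \int[leb]_t (nsqc (phi (t, y)))%:E)%E.
Proof.
have [mf _ _] := Lf.
rewrite (ge0_integral_lebesgue_tupleS (measurable_nsqcE mf)); last first.
  by move=> x; rewrite lee_fin nsqc_ge0.
exact: (fubini_tonelli (m1 := leb) (m2 := lebn n) _ mnf nf0).
Qed.

Let norm_f_fin : (\int[lebn n]_y \int[leb]_t (nsqc (phi (t, y)))%:E < +oo)%E.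
Proof. by rewrite -norm_f; have [] := Lf. Qed.

Let m_norm_phi : measurable_fun setT (fun y => \int[leb]_t (nsqc (phi (t, y)))%:E)%E.
Proof. exact: (measurable_fun_fubini_tonelli_G (m1 := leb) _ mnf nf0). Qed.

Let ae_cL12 : {ae lebn n, forall y, cL12 leb (fun t => phi (t, y))}.
Proof.
have ae2 : {ae lebn n, forall y, (\int[leb]_t (nsqc (phi (t, y)))%:E < +oo)%E}.
  apply: ge0_integral_lty_ae norm_f_fin; first exact: m_norm_phi.
  by move=> y; apply: integral_ge0 => t _; exact: nf0.
apply: filterS2 (ae_cintegrable2 iphi) ae2 => y i1 i2.
by have [m1 n1] := (cintegrableP _ _).1 i1.
Qed.

Let m_norm_g2 : measurable_fun setT (fun y => \int[leb]_xi0 (nsqc (g xi0 y))%:E)%E.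
Proof. exact: (measurable_fun_fubini_tonelli_G (m1 := leb) _ mng ng0). Qed.

Let m_norm_g1 : measurable_fun setT (fun xi0 => \int[lebn n]_y (nsqc (g xi0 y))%:E)%E.
Proof. exact: (measurable_fun_fubini_tonelli_F (m2 := lebn n) _ mng ng0). Qed.

(** By Tonelli the integral in [xi0] is taken first, and Plancherel on the line applies to the
    sections of [f], almost all of which are integrable and square integrable. *)
Let norm_g : (\int[leb]_xi0 \int[lebn n]_y (nsqc (g xi0 y))%:E =
  (2 * pi)%:E * \int[lebn n.+1]_x (nsqc (f x))%:E)%E.
Proof.
rewrite (fubini_tonelli (m1 := leb) (m2 := lebn n) _ mng ng0) norm_f.
have h0 y : setT y -> (0 <= \int[leb]_t (nsqc (phi (t, y)))%:E)%E.
  by move=> _; apply: integral_ge0 => t _; exact: nf0.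
rewrite -(ge0_integralZl_EFin (lebn n) measurableT h0 m_norm_phi tp0).
apply: ge0_ae_eq_integral.
- exact: measurableT.
- exact: m_norm_g2.
- exact: (measurable_funeM _ m_norm_phi).
- by move=> y _; apply: integral_ge0 => t _; exact: (ng0 (t, y)).
- by move=> y _; rewrite mule_ge0 ?lee_fin// h0.
apply: filterS ae_cL12 => y Ly _; exact: (plancherel1 Ly).
Qed.

(** Integrability in [y] holds for every [xi0] by Fubini; square integrability holds for almost
    every [xi0], because [norm_g] bounds the total. This is what entitles the induction hypothesis
    to be applied. *)
Let ae_cL12_g : {ae leb, forall xi0, cL12 (lebn n) (g xi0)}.
Proof.
have ae2 : {ae leb, forall xi0, (\int[lebn n]_y (nsqc (g xi0 y))%:E < +oo)%E}.
  apply: ge0_integral_lty_ae; first exact: m_norm_g1.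
    by move=> xi0; apply: integral_ge0 => y _; exact: (ng0 (xi0, y)).
  rewrite norm_g; have [_ _ f2] := Lf.
  by rewrite lte_mul_pinfty// lee_fin.
apply: (ae_imply (mu := leb) _ ae2) => xi0 i2.
by have [m1 n1] := (cintegrableP _ _).1 (cfubini2 (integrable_integrand xi0)).1.
Qed.

(** The induction hypothesis treats the last [n] frequencies at almost every fixed [xi0], giving
    [(2 pi)^n]; [norm_g] treats the first frequency and gives the remaining factor [2 pi]. *)
Lemma plancherel_tuple_step :
  (\int[lebn n.+1]_xi (nsqc (fourier_tuple f xi))%:E =
   ((2 * pi) ^+ n.+1)%:E * \int[lebn n.+1]_x (nsqc (f x))%:E)%E.
Proof.
have [mf _ _] := Lf.
have mF : measurable_fun setT (fun xi => (nsqc (fourier_tuple f xi))%:E).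
  exact: (measurable_nsqcE (cmeas_fourier_tuple mf)).
have F0 xi : (0 <= (nsqc (fourier_tuple f xi))%:E)%E by rewrite lee_fin nsqc_ge0.
rewrite (ge0_integral_lebesgue_tupleS mF F0).
have mFc : measurable_fun setT
    (fun z : R * n.-tuple R => (nsqc (fourier_tuple f (tuple_cons z)))%:E).
  exact: (measurableT_comp mF (@measurable_tuple_cons R n)).
have k0 : 0 <= (2 * pi) ^+ n :> R by rewrite exprn_ge0.
have h0 xi0 : setT xi0 -> (0 <= \int[lebn n]_y (nsqc (g xi0 y))%:E)%E.
  by move=> _; apply: integral_ge0 => y _; exact: (ng0 (xi0, y)).
transitivity (\int[leb]_xi0 (((2 * pi) ^+ n)%:E *
    \int[lebn n]_y (nsqc (g xi0 y))%:E))%E.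
  apply: ge0_ae_eq_integral.
  - exact: measurableT.
  - exact: (measurable_fun_fubini_tonelli_F (m2 := lebn n) _ mFc (fun z => F0 _)).
  - exact: (measurable_funeM _ m_norm_g1).
  - by move=> xi0 _; apply: integral_ge0 => xi _; exact: F0.
  - by move=> xi0 _; rewrite mule_ge0 ?lee_fin// h0.
  apply: (ae_imply (mu := leb) _ ae_cL12_g) => xi0 Lg _; rewrite -(IH Lg).
  by apply: eq_integral => xi _; rewrite fourier_cons.
rewrite (ge0_integralZl_EFin leb measurableT h0 m_norm_g1 k0).
by rewrite norm_g muleA -EFinM exprSr.
Qed.

End step.

Theorem plancherel_tuple n (f : n.-tuple R -> R[i]) : cL12 (lebn n) f ->
  (\int[lebn n]_xi (nsqc (fourier_tuple f xi))%:E =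
   ((2 * pi) ^+ n)%:E * \int[lebn n]_x (nsqc (f x))%:E)%E.
Proof.
elim: n f => [|n IH] f Lf; first by rewrite expr0 mul1e; exact: plancherel_tuple0.
exact: plancherel_tuple_step.
Qed.

Theorem parseval_tuple n (f h : n.-tuple R -> R[i]) : cL12 (lebn n) f ->
  cL12 (lebn n) h ->
  cintegrable (lebn n) setT (fun xi => fourier_tuple f xi * conjc (fourier_tuple h xi)) /\
  cintegral (lebn n) setT (fun xi => fourier_tuple f xi * conjc (fourier_tuple h xi)) =
  ((2 * pi) ^+ n)%:C * cintegral (lebn n) setT (fun x => f x * conjc (h x)).
Proof.
move=> Lf Lh; have [mf _ _] := Lf; have [mh _ _] := Lh.
have fi := cL12_integrable Lf; have hi := cL12_integrable Lh.
have Lih := cL12Z 'i Lh; have ihi := cL12_integrable Lih.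
apply: parseval_polarization => //; first by rewrite exprn_ge0 ?mulr_ge0 ?pi_ge0.
- exact: cmeas_fourier_tuple.
- exact: cmeas_fourier_tuple.
- exact: plancherel_tuple.
- exact: plancherel_tuple.
- under eq_integral do rewrite -fourier_tupleD//.
  exact: (plancherel_tuple (cL12D Lf Lh)).
- under eq_integral do rewrite -fourier_tupleZ// -fourier_tupleD//.
  exact: (plancherel_tuple (cL12D Lf Lih)).
Qed.

End fourier_tuple.

(** Inversion is not continuous at 0, where its value is 0 by convention; it is the sign times a
    power of the modulus, both measurable. *)
Lemma measurable_invr {R : realType} : measurable_fun setT (@GRing.inv R).
Proof.
rewrite (_ : GRing.inv = fun x : R => Num.sg x * `|x| `^ (-1)).
  apply: measurable_funM; last first.
    by apply: (measurableT_comp (measurable_powR _)) => //.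
  rewrite (_ : Num.sg = fun x : R => if 0 < x then 1 else if x < 0 then -1 else 0).
    apply: measurable_fun_ifT => //.
      by apply: measurable_fun_ltr.
    apply: measurable_fun_ifT => //.
    by apply: measurable_fun_ltr.
  apply/funext => x; case: ltrgt0P => x0; rewrite ?x0; first by rewrite gtr0_sg.
    by rewrite ltr0_sg.
  by rewrite sgr0.
apply/funext => x; rewrite powR_inv1//.
have [->|x0] := eqVneq x 0; first by rewrite invr0 sgr0 mul0r.
have [xp|xn|/eqP] := ltrgt0P x; last by rewrite (negbTE x0).
  by rewrite gtr0_sg// mul1r.
by rewrite ltr0_sg// invrN mulN1r opprK.
Qed.

(** * Polar coordinates *)

Section tail_integral.
Context {R : realType}.
Local Notation leb := (@lebesgue_measure R).

Let inv_pow n (r : R) : R := (r^-1) ^+ n.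

Let primitive n : R -> R := - (n.+1%:R^-1 \*: inv_pow n.+1).

Let is_derive_primitive n (r : R) : r != 0 ->
  is_derive r 1 (primitive n) (inv_pow n.+2 r).
Proof.
move=> r0.
have dV : is_derive r 1 (@GRing.inv R) (- r ^- 2).
  apply: DeriveDef; first exact: (@derivableV _ _ id).
  by rewrite (@deriveV _ _ id)// derive_id /GRing.scale/= mulr1.
have -> : primitive n = - (n.+1%:R^-1 \*: ((@GRing.inv R : R -> R) ^+ n.+1)).
  by apply/funext => x; rewrite /primitive /inv_pow !fctE.
have := is_deriveN (is_deriveZ n.+1%:R^-1 (is_deriveX n.+1 dV)).
congr is_derive; rewrite /GRing.scale/= /inv_pow mulrA mulrA mulVf ?pnatr_eq0// mul1r.
by rewrite mulrN opprK -exprVn -exprD addn2.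
Qed.

Let continuous_inv_pow n (r : R) : r != 0 -> {for r, continuous (inv_pow n)}.
Proof.
move=> r0; rewrite /prop_for /continuous_at /inv_pow.
apply: (@cvg_comp _ _ _ (@GRing.inv R) (fun x : R => x ^+ n) _ (nbhs (r^-1 : R))).
  exact: inv_continuous.
exact: exprn_continuous.
Qed.

Let cvg_primitive n : primitive n x @[x --> +oo] --> (0 : R).
Proof.
have cV : (x : R)^-1 @[x --> +oo] --> (0 : R).
  by apply/gtr0_cvgV0 => //; exact: nbhs_pinfty_gt.
rewrite -oppr0 -(mulr0 n.+1%:R^-1); apply: cvgN; apply: cvgMr.
have : (x : R)^-1 ^+ n.+1 @[x --> +oo] --> (0 : R) ^+ n.+1.
  apply: (@cvg_comp _ _ _ (@GRing.inv R) (fun x : R => x ^+ n.+1) _ (nbhs (0 : R))).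
    exact: cV.
  exact: exprn_continuous.
by rewrite expr0n.
Qed.

Let half_tail n (c r : R) : R := if c <= r then inv_pow n r else 0.

Let measurable_inv_pow n : measurable_fun setT (inv_pow n).
Proof. by apply: measurable_funX; exact: measurable_invr. Qed.

Let integral_half_tail n (c : R) : 0 < c ->
  (\int[leb]_r (half_tail n.+2 c r)%:E = (n.+1%:R^-1 * c ^- n.+1)%:E)%E.
Proof.
move=> c0.
transitivity (\int[leb]_(r in `[c, +oo[) (inv_pow n.+2 r)%:E)%E.
  rewrite [RHS]integral_mkcond; apply: eq_integral => r _.
  by rewrite patchE /half_tail mem_setE/= in_itv/= andbT; case: ifP.
have gtc r : c <= r -> r != 0 by move=> cr; rewrite gt_eqF// (lt_le_trans c0).
rewrite (@ge0_continuous_FTC2y _ _ (primitive n) _ 0).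
- rewrite -EFinB sub0r /primitive /inv_pow; congr EFin.
  by rewrite /= opprK /GRing.scale/= exprVn.
- by move=> r cr; rewrite exprn_ge0// invr_ge0 (le_trans (ltW c0)).
- apply/continuous_within_itvcyP; split.
    by move=> r; rewrite in_itv/= andbT => /ltW/gtc; exact: continuous_inv_pow.
  by apply: cvg_at_right_filter; apply: continuous_inv_pow; rewrite gtc.
- exact: cvg_primitive.
- by move=> r /ltW/gtc r0; have [] := is_derive_primitive n r0.
- apply: cvg_at_right_filter; apply: differentiable_continuous.
  by apply/derivable1_diffP; have [] := is_derive_primitive n (gtc _ (lexx c)).
- move=> r; rewrite in_itv/= andbT => /ltW/gtc r0; rewrite derive1E.
  by have /@derive_val := is_derive_primitive n r0.
Qed.

(** Both half-lines contribute equally. The result is the radial integral met when [L] is integrated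
    over its second variable, with [c] the norm of the first. *)
Lemma integral_tail n (c : R) : 0 < c ->
  (\int[leb]_r (if c <= `|r| then `|r| ^- n.+2 else 0)%:E =
   (2 * (n.+1%:R^-1 * c ^- n.+1))%:E)%E.
Proof.
move=> c0.
have mh : measurable_fun setT (fun r => (half_tail n.+2 c r)%:E).
  apply/measurable_EFinP; apply: measurable_fun_ifT.
  - by apply: (@measurable_fun_ler _ _ _ _ (cst c) id).
  - exact: measurable_inv_pow.
  - exact: measurable_cst.
have h0 r : (0 <= (half_tail n.+2 c r)%:E)%E.
  rewrite lee_fin /half_tail; case: ifP => // cr.
  by rewrite exprn_ge0// invr_ge0 (le_trans (ltW c0)).
have N1 : (-1 : R) != 0 by rewrite oppr_eq0 oner_eq0.
have IN := ge0_integral_affine 0 N1 mh h0.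
rewrite normrN1 invr1 mul1e (integral_half_tail n c0) in IN.
have mhN : measurable_fun setT (fun r : R => (half_tail n.+2 c (-1 * r + 0))%:E).
  exact: (measurableT_comp mh (measurable_affine (-1) 0)).
rewrite mulr_natl mulr2n EFinD -{1}(integral_half_tail n c0) -IN -ge0_integralD//.
apply: eq_integral => r _; rewrite -EFinD mulN1r addr0 /half_tail /inv_pow; congr EFin.
(* Since [c > 0], at most one of the two half tails is nonzero at a given [r]. *)
have [r0|r0] := leP 0 r.
  have -> : (c <= - r) = false by apply/negbTE; rewrite -ltNge; lra.
  by rewrite ger0_norm// addr0 exprVn.
have -> : (c <= r) = false by apply/negbTE; rewrite -ltNge; lra.
by rewrite ltr0_norm// add0r exprVn.
Qed.

End tail_integral.

Section sphere_integral.
Context {R : realType}.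
Local Notation leb := (@lebesgue_measure R).
Local Notation lebn n := (lebesgue_tuple R n).

Lemma normalizeE n (x : n.-tuple R) : normalize x = scale_tuple (norm2 x)^-1 x.
Proof. by apply: eq_from_tnth => i; rewrite !tnth_mktuple mulrC. Qed.

Lemma sphere_normalize n (x : n.-tuple R) : punctured_ball x -> sphere (normalize x).
Proof.
move=> /andP[x0 _]; rewrite /sphere/= normalizeE norm2_scale.
by rewrite ger0_norm ?invr_ge0 ?(ltW x0)// mulVf// gt_eqF.
Qed.

Lemma measurable_sphere n : measurable (@sphere R n).
Proof.
rewrite (_ : sphere = setT `&` norm2 @^-1` [set 1]); last first.
  by apply/seteqP; split=> x //= [].
exact: measurable_norm2.
Qed.

(** By construction [surface_measure] is [n] times the image under [normalize] of Lebesgue measure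
    restricted to [punctured_ball], so this is integration against an image measure. All of
    [punctured_ball] is sent into [sphere], so that restricting to [sphere] loses nothing. *)
Lemma ge0_integral_surface n (J : n.-tuple R -> \bar R) : measurable_fun setT J ->
  (forall u, 0 <= J u)%E ->
  (\int[surface_measure]_(u in sphere) J u =
   n%:R%:E * \int[lebn n]_(y in punctured_ball) J (normalize y))%E.
Proof.
move=> mJ J0; have mB := @measurable_punctured_ball R n.
have mS := @measurable_sphere n; have mN := @measurable_normalize R n.
have mJN : measurable_fun setT (fun y => J (normalize y)) := measurableT_comp mJ mN.
pose restr : {measure set (n.-tuple R) -> \bar R} :=
  measure_function_mrestr__canonical__measure_function_Measure (lebn n) mB.
pose push : {measure set (n.-tuple R) -> \bar R} :=
  measure_function_pushforward__canonical__measure_function_Measure restr mN.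
have n0 : 0 <= n%:R :> R by [].
transitivity (\int[mscale (NngNum n0) push]_(u in sphere) J u)%E.
  apply: eq_measure_integral => A mA _.
  by rewrite /surface_measure; congr (_ * lebn n _)%E; exact: setIC.
rewrite ge0_integral_mscale//; last exact: measurable_funTS.
congr (_ * _)%E.
transitivity (\int[restr]_(y in normalize @^-1` sphere) J (normalize y))%E.
  apply: (ge0_integral_pushforward mN _ _ (measurable_funTS mJ)) => //.
have mSN : measurable (@normalize R n @^-1` sphere).
  by rewrite -[X in measurable X]setTI; exact: measurable_normalize.
have r0 : restr (~` punctured_ball) = 0%E.
  by rewrite /restr/= /mrestr setICl measure0.
rewrite (ge0_negligible_integral (N := ~` punctured_ball))//; last 2 first.
- exact: measurableC.
- exact: measurable_funTS.
rewrite (_ : _ `\` _ = punctured_ball); last first.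
  rewrite setDE setCK; apply/seteqP; split=> [x [_ xB]//|x xB].
  by split => //; exact: sphere_normalize.
apply: eq_measure_integral => A mA AB.
by rewrite /restr/= /mrestr setIidl.
Qed.

End sphere_integral.

Section polar.
Context {R : realType}.
Local Notation leb := (@lebesgue_measure R).
Local Notation lebn n := (lebesgue_tuple R n).

Lemma ae_neq0 : {ae leb, forall r : R, r != 0}.
Proof.
exists [set 0]; split; [exact: measurable_set1|exact: lebesgue_measure_set1|].
by move=> x /= /negP; rewrite negbK => /eqP.
Qed.

Variables (n : nat) (g : n.+1.-tuple R -> R).
Hypotheses (mg : measurable_fun setT g) (g0 : forall x, 0 <= g x).

Let T := n.+1.-tuple R.

Let J (u : T) : \bar R := (\int[leb]_s (g (scale_tuple s u) * `|s| ^+ n)%:E)%E.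

(* Integrating [K] over the second variable gives [J] at the normalized first one,
   integrating [L] over it gives [2 / n.+1 * g], and scaling the first variable by
   the second exchanges the two. *)
Let K (z : T * R) : R :=
  if (0 < norm2 z.1) && (norm2 z.1 <= 1)
  then norm2 z.1 ^+ n.+1 * (g (scale_tuple z.2 z.1) * `|z.2| ^+ n) else 0.

Let L (z : T * R) : R :=
  if (0 < norm2 z.1) && (norm2 z.1 <= `|z.2|)
  then g z.1 * norm2 z.1 ^+ n.+1 * `|z.2| ^- n.+2 else 0.

Let m1 : measurable_fun setT (fun z : T * R => z.1).
Proof. exact: measurable_fst. Qed.

Let m2 : measurable_fun setT (fun z : T * R => z.2).
Proof. exact: measurable_snd. Qed.

Let mn1 : measurable_fun setT (fun z : T * R => norm2 z.1).
Proof. exact: (measurableT_comp measurable_norm2 m1). Qed.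

Let ma2 : measurable_fun setT (fun z : T * R => `|z.2|).
Proof. exact: (measurableT_comp (@normr_measurable _ setT) m2). Qed.

Let mgs : measurable_fun setT (fun z : T * R => g (scale_tuple z.2 z.1) * `|z.2| ^+ n).
Proof.
apply: measurable_funM; last exact: (measurable_funX _ ma2).
exact: (measurableT_comp mg (measurable_scale_tuple m2 m1)).
Qed.

Let mK : measurable_fun setT (EFin \o K).
Proof.
apply/measurable_EFinP; apply: measurable_fun_ifT.
- apply: measurable_and.
    exact: (measurable_fun_ltr (measurable_cst _) mn1).
  exact: (measurable_fun_ler mn1 (measurable_cst _)).
- by apply: measurable_funM => //; exact: (measurable_funX _ mn1).
- exact: measurable_cst.
Qed.

Let mL : measurable_fun setT (EFin \o L).
Proof.
apply/measurable_EFinP; apply: measurable_fun_ifT.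
- apply: measurable_and.
    exact: (measurable_fun_ltr (measurable_cst _) mn1).
  exact: (measurable_fun_ler mn1 ma2).
- apply: measurable_funM.
    apply: measurable_funM; last exact: (measurable_funX _ mn1).
    exact: (measurableT_comp mg m1).
  exact: (measurableT_comp measurable_invr (measurable_funX _ ma2)).
- exact: measurable_cst.
Qed.

Let K0 z : (0 <= (EFin \o K) z)%E.
Proof.
rewrite lee_fin /K; case: ifP => // _.
by rewrite mulr_ge0 ?exprn_ge0 ?norm2_ge0// mulr_ge0// exprn_ge0.
Qed.

Let L0 z : (0 <= (EFin \o L) z)%E.
Proof.
rewrite lee_fin /L; case: ifP => // _.
by rewrite mulr_ge0 ?invr_ge0 ?exprn_ge0// mulr_ge0 ?exprn_ge0 ?norm2_ge0.
Qed.

Let J0 u : (0 <= J u)%E.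
Proof.
by apply: integral_ge0 => s _; rewrite lee_fin mulr_ge0// exprn_ge0.
Qed.

Let mJ : measurable_fun setT J.
Proof.
have mEgs : measurable_fun setT
    (fun z : T * R => (g (scale_tuple z.2 z.1) * `|z.2| ^+ n)%:E).
  exact/measurable_EFinP.
apply: (measurable_fun_fubini_tonelli_F (m2 := leb) _ mEgs).
by move=> z; rewrite lee_fin mulr_ge0// exprn_ge0.
Qed.

(** The substitution [s = |y| r] replaces the unit vector by [y] itself. The differential and the
    weight [|s|^n] together produce the factor [|y|^(n+1)] of [K]. *)
Let J_normalize y : punctured_ball y ->
  J (normalize y) = (\int[leb]_r (K (y, r))%:E)%E.
Proof.
move=> yB; have /andP[y0 y1] := yB; have yn : norm2 y != 0 by rewrite gt_eqF.
pose h (s : R) := (g (scale_tuple s (normalize y)) * `|s| ^+ n)%:E.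
have mh : measurable_fun setT h.
  apply/measurable_EFinP; apply: measurable_funM.
    apply: (measurableT_comp mg); apply: measurable_scale_tuple.
      exact: measurable_id.
    exact: measurable_cst.
  exact: (measurable_funX _ (@normr_measurable _ setT)).
have h0 s : (0 <= h s)%E by rewrite lee_fin mulr_ge0// exprn_ge0.
have := ge0_integral_affine 0 yn mh h0; rewrite gtr0_norm// => /(congr1 (mule (norm2 y)%:E)).
rewrite muleA -EFinM divff// mul1e => Eh.
transitivity (\int[leb]_r h r)%E; first by [].
rewrite -Eh.
have mha : measurable_fun setT (fun r : R => h (norm2 y * r + 0)).
  exact: (measurableT_comp mh (measurable_affine (norm2 y) 0)).
rewrite -(ge0_integralZl_EFin leb measurableT (fun r _ => h0 _) mha (norm2_ge0 y)).
apply: eq_integral => r _; rewrite /h /K/= y0 y1/= addr0 -EFinM; congr EFin.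
rewrite normalizeE scale_tupleA mulrAC divff// mul1r normrM gtr0_norm// exprMn exprS.
by ring.
Qed.

(** With [x = r y] the condition [|y| <= 1] becomes [|x| <= |r|], and [K (y, r)] is
    [|r|^(n+1) L (r y, r)]; the power of [|r|] is cancelled by the Jacobian in dimension [n + 1]. *)
Let integral_K (r : R) : r != 0 ->
  (\int[lebn n.+1]_y (K (y, r))%:E = \int[lebn n.+1]_x (L (x, r))%:E)%E.
Proof.
move=> r0; have rn : 0 < `|r| by rewrite normr_gt0.
have mL1 : measurable_fun setT (fun x => (`|r| ^+ n.+1 * L (x, r))%:E).
  apply/measurable_EFinP; apply: measurable_funM; first exact: measurable_cst.
  by apply/measurable_EFinP; exact: (measurableT_comp mL (pair2_measurable r)).
have L10 x : (0 <= (`|r| ^+ n.+1 * L (x, r))%:E)%E.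
  by rewrite lee_fin mulr_ge0 ?exprn_ge0// -lee_fin; exact: L0.
have Es := ge0_integral_scale r0 mL1 L10.
transitivity (\int[lebn n.+1]_y (`|r| ^+ n.+1 * L (scale_tuple r y, r))%:E)%E.
  apply: eq_integral => y _; congr EFin.
  rewrite /K /L/= norm2_scale pmulr_rgt0// ger_pMr//; case: ifP => _; last by rewrite mulr0.
  rewrite exprMn !exprS; set A := `|r| ^+ n; set B := norm2 y ^+ n.
  have A0 : A != 0 by rewrite expf_neq0// gt_eqF.
  by field; rewrite A0 gt_eqF.
rewrite Es -(ge0_integralZl_EFin (lebn n.+1) measurableT (fun x _ => L10 x) mL1); last first.
  by rewrite invr_ge0 exprn_ge0.
apply: eq_integral => x _; rewrite -EFinM mulrA mulVf ?mul1r//.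
by rewrite expf_neq0// gt_eqF.
Qed.

(** The tail integral from [c = |x|] yields [|x|^-(n+1)], which cancels the power of [|x|] carried
    by [L]. *)
Let integral_L (x : T) : norm2 x != 0 ->
  (\int[leb]_r (L (x, r))%:E = (2 / n.+1%:R * g x)%:E)%E.
Proof.
move=> x0; have xp : 0 < norm2 x by rewrite lt_neqAle eq_sym x0 norm2_ge0.
pose q (r : R) := (if norm2 x <= `|r| then `|r| ^- n.+2 else 0)%:E.
have mq : measurable_fun setT q.
  have ma := @normr_measurable R setT.
  apply/measurable_EFinP; apply: measurable_fun_ifT.
  - exact: (measurable_fun_ler (measurable_cst _) ma).
  - exact: (measurableT_comp measurable_invr (measurable_funX _ ma)).
  - exact: measurable_cst.
have q0 r : (0 <= q r)%E.
  by rewrite lee_fin; case: ifP => // _; rewrite invr_ge0 exprn_ge0.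
have k0 : 0 <= g x * norm2 x ^+ n.+1 by rewrite mulr_ge0// exprn_ge0// norm2_ge0.
transitivity ((g x * norm2 x ^+ n.+1)%:E * \int[leb]_r q r)%E.
  rewrite -(ge0_integralZl_EFin leb measurableT (fun r _ => q0 r) mq k0).
  apply: eq_integral => r _; rewrite -EFinM /L/= xp/=; congr EFin.
  by case: ifP => _; rewrite ?mulr0.
rewrite /q integral_tail// -EFinM; congr EFin.
have p0 : norm2 x ^+ n.+1 != 0 by rewrite expf_neq0.
have N0 : n.+1%:R != 0 :> R by rewrite pnatr_eq0.
move: (norm2 x ^+ n.+1) (n.+1%:R : R) p0 N0 => p N p0 N0.
by field; rewrite p0 N0.
Qed.

(* [s] ranges over the whole line, so that every half-line is met twice, from [u]
   and from [- u]. *)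
Theorem ge0_polar :
  (\int[surface_measure]_(u in sphere) \int[leb]_s (g (scale_tuple s u) * `|s| ^+ n)%:E =
   2%:E * \int[lebn n.+1]_x (g x)%:E)%E.
Proof.
rewrite (ge0_integral_surface mJ J0).
have mB := @measurable_punctured_ball R n.+1.
have -> : (\int[lebn n.+1]_(y in punctured_ball) J (normalize y) =
    \int[lebn n.+1]_y \int[leb]_r (K (y, r))%:E)%E.
  rewrite [LHS]integral_mkcond; apply: eq_integral => y _; rewrite patchE.
  case: ifPn => [|/negP yB]; first by rewrite inE => yB; exact: J_normalize.
  rewrite integral0_eq// => r _; congr EFin; rewrite /K/=.
  by case: ifPn => // yB'; exfalso; apply: yB; rewrite inE.
have EK := fubini_tonelli (m1 := lebn n.+1) (m2 := leb) _ mK K0.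
have EL := fubini_tonelli (m1 := lebn n.+1) (m2 := leb) _ mL L0.
have -> : (\int[lebn n.+1]_y \int[leb]_r (K (y, r))%:E =
    \int[lebn n.+1]_x \int[leb]_r (L (x, r))%:E)%E.
  apply: (etrans EK); apply: (etrans _ (esym EL)).
  apply: ge0_ae_eq_integral.
  - exact: measurableT.
  - exact: (measurable_fun_fubini_tonelli_G (m1 := lebn n.+1) _ mK K0).
  - exact: (measurable_fun_fubini_tonelli_G (m1 := lebn n.+1) _ mL L0).
  - by move=> r _; apply: integral_ge0 => y _; exact: (K0 (y, r)).
  - by move=> r _; apply: integral_ge0 => y _; exact: (L0 (y, r)).
  - by apply: (ae_imply (mu := leb) _ ae_neq0) => r r0 _; exact: integral_K.
have mEg : measurable_fun setT (EFin \o g) by exact/measurable_EFinP.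
have Eg0 (x : T) : setT x -> (0 <= (EFin \o g) x)%E by move=> _; rewrite lee_fin.
have k0 : 0 <= 2 / n.+1%:R :> R by rewrite divr_ge0.
have -> : (\int[lebn n.+1]_x \int[leb]_r (L (x, r))%:E =
    \int[lebn n.+1]_x ((2 / n.+1%:R)%:E * (g x)%:E))%E.
  apply: ge0_ae_eq_integral.
  - exact: measurableT.
  - exact: (measurable_fun_fubini_tonelli_F (m2 := leb) _ mL L0).
  - exact: (measurable_funeM _ mEg).
  - by move=> x _; apply: integral_ge0 => r _; exact: (L0 (x, r)).
  - by move=> x _; rewrite -EFinM lee_fin mulr_ge0.
  - by apply: (ae_imply _ (ae_norm2_neq0 n)) => x x0 _; rewrite integral_L// EFinM.
(* The dimension factor of the surface measure cancels the denominator [n.+1] and leaves 2. *)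
rewrite (ge0_integralZl_EFin (lebn n.+1) measurableT Eg0 mEg k0) muleA -EFinM.
by rewrite mulrC divfK// pnatr_eq0.
Qed.

End polar.

Section polar_integrable.
Context {R : realType} {n : nat}.
Local Notation leb := (@lebesgue_measure R).
Local Notation lebn n := (lebesgue_tuple R n).
Let T := n.+1.-tuple R.
Local Notation sigma := (@surface_measure R n.+1).

Let measurable_radial (G : T -> R) : measurable_fun setT G ->
  measurable_fun setT (fun z : T * R => G (scale_tuple z.2 z.1) * `|z.2| ^+ n).
Proof.
move=> mG.
have m1 : measurable_fun setT (fun z : T * R => z.1) := measurable_fst.
have m2 : measurable_fun setT (fun z : T * R => z.2) := measurable_snd.
apply: measurable_funM.
  exact: (measurableT_comp mG (measurable_scale_tuple m2 m1)).
exact: (measurable_funX _ (measurableT_comp (@normr_measurable _ setT) m2)).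
Qed.

Let measurable_radial_int (g : T -> R) : measurable_fun setT g ->
  measurable_fun setT (fun u => \int[leb]_s (g (scale_tuple s u) * `|s| ^+ n)%:E)%E.
Proof.
move=> mg; have /measurable_EFinP h := measurable_radial mg.
exact: (measurable_eintegral1 leb h).
Qed.

Let integrable_radial (g : T -> R) : measurable_fun setT g -> (forall x, 0 <= g x) ->
  (\int[lebn n.+1]_x (g x)%:E < +oo)%E ->
  sigma.-integrable sphere (fun u => \int[leb]_s (g (scale_tuple s u) * `|s| ^+ n)%:E)%E.
Proof.
move=> mg g0 goo; apply/integrableP; split.
  exact: (measurable_funTS (measurable_radial_int mg)).
have h u : (0 <= \int[leb]_s (g (scale_tuple s u) * `|s| ^+ n)%:E)%E.
  by apply: integral_ge0 => s _; rewrite lee_fin mulr_ge0// exprn_ge0.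
under eq_integral => u _ do rewrite (gee0_abs (h u)).
by rewrite (ge0_polar mg g0) lte_mul_pinfty.
Qed.

(** The nonnegative formula is applied to both parts of [G]. For almost every direction both line
    integrals are finite, and only there is the real-valued line integral known to be their
    difference. *)
Lemma integral_polar (G : T -> R) : (lebn n.+1).-integrable setT (EFin \o G) ->
  sigma.-integrable sphere
    (EFin \o (fun u => \int[leb]_s (G (scale_tuple s u) * `|s| ^+ n))) /\
  \int[sigma]_(u in sphere) \int[leb]_s (G (scale_tuple s u) * `|s| ^+ n) =
  2 * \int[lebn n.+1]_x G x.
Proof.
move=> iG; have mS := @measurable_sphere R n.+1.
have mG : measurable_fun setT G by apply/measurable_EFinP; exact: measurable_int iG.
have mp : measurable_fun setT (G^\+)%R := measurable_funrpos mG.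
have mm : measurable_fun setT (G^\-)%R := measurable_funrneg mG.
have p0 x : 0 <= (G^\+)%R x by exact: funrpos_ge0.
have m0 x : 0 <= (G^\-)%R x by exact: funrneg_ge0.
have ip := integrable_funrpos measurableT iG.
have im := integrable_funrneg measurableT iG.
have poo : (\int[lebn n.+1]_x ((G^\+)%R x)%:E < +oo)%E by exact: integrable_lty ip.
have moo : (\int[lebn n.+1]_x ((G^\-)%R x)%:E < +oo)%E by exact: integrable_lty im.
pose P u := (\int[leb]_s ((G^\+)%R (scale_tuple s u) * `|s| ^+ n)%:E)%E.
pose N u := (\int[leb]_s ((G^\-)%R (scale_tuple s u) * `|s| ^+ n)%:E)%E.
have iP : sigma.-integrable sphere P := integrable_radial mp p0 poo.
have iN : sigma.-integrable sphere N := integrable_radial mm m0 moo.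
have E u : (\int[leb]_s (G (scale_tuple s u) * `|s| ^+ n)%:E = P u - N u)%E.
  rewrite integralE; congr (_ - _)%E; apply: eq_integral => s _.
  - rewrite funeposE/= /funrpos -EFin_max; congr EFin.
    by rewrite maxr_pMl ?exprn_ge0// mul0r.
  - rewrite funenegE/= /funrneg -EFin_max; congr EFin.
    by rewrite maxr_pMl ?exprn_ge0// mul0r mulNr.
pose z u := \int[leb]_s (G (scale_tuple s u) * `|s| ^+ n).
have mz : measurable_fun setT z := measurable_Rintegral1 leb (measurable_radial mG).
have ae_z : ae_eq sigma sphere (P \- N)%E (EFin \o z).
  apply: filterS2 (integrable_ae mS iP) (integrable_ae mS iN) => u fP fN Su.
  rewrite /= /z /Rintegral E fineK// fin_numB fP// fN//.
have iPN : sigma.-integrable sphere (P \- N)%E := integrableB mS iP iN.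
have mzS : measurable_fun sphere (EFin \o z).
  by apply/measurable_EFinP; exact: measurable_funTS.
split; first exact: ae_eq_integrable ae_z iPN.
rewrite {1}/Rintegral -(ae_eq_integral _ _ mS (measurable_int _ iPN) mzS ae_z).
rewrite (integralB mS iP iN) (ge0_polar mp p0) (ge0_polar mm m0).
have fp := integrable_fin_num measurableT ip.
have fm := integrable_fin_num measurableT im.
rewrite -muleBr; [|by []|by rewrite fin_num_adde_defr].
rewrite fineM; [|by []|by rewrite fin_numB fp fm].
rewrite [fine 2]/=; congr (2 * _).
transitivity (\int[lebn n.+1]_x ((G^\+)%R x - (G^\-)%R x)).
  by rewrite RintegralB// /Rintegral fineB.
by apply: eq_Rintegral => x _; rewrite -[in RHS](funrposBneg G).
Qed.

Lemma Re_Mreal (z : R[i]) (r : R) : complex.Re (z * r%:C) = complex.Re z * r.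
Proof. by rewrite ReM/= mulr0 subr0. Qed.

Lemma Im_Mreal (z : R[i]) (r : R) : complex.Im (z * r%:C) = complex.Im z * r.
Proof. by rewrite ImM/= mulr0 add0r. Qed.

(** The density in polar coordinates along the line through [u]; the dimension being [n.+1], the
    exponent is the dimension minus one. *)
Definition radial (Phi : T -> R[i]) (u : T) (s : R) : R[i] :=
  Phi (scale_tuple s u) * (`|s| ^+ n)%:C.

Lemma cmeas_radial (Phi : T -> R[i]) : cmeas Phi ->
  cmeas (fun z : T * R => radial Phi z.1 z.2).
Proof.
move=> mP; apply: cmeasM.
  apply: (cmeas_comp mP).
  by apply: measurable_scale_tuple; [exact: measurable_snd|exact: measurable_fst].
apply: cmeas_real; apply: measurable_funX.
exact: (measurableT_comp (@normr_measurable _ setT) measurable_snd).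
Qed.

(** Polar coordinates for the modulus of [Phi] give a finite total over the sphere, so almost every
    line integral is finite. The directions singled out here are those for which the integral in [a]
    will be shown to converge. *)
Lemma ae_radial_lty (Phi : T -> R[i]) : cintegrable (lebn n.+1) setT Phi ->
  {ae sigma, forall u, sphere u ->
    (\int[leb]_s (Normc.normc (radial Phi u s))%:E < +oo)%E}.
Proof.
move=> /cintegrableP[mP Poo].
have ni u s : Normc.normc (radial Phi u s) =
    Normc.normc (Phi (scale_tuple s u)) * `|s| ^+ n.
  by rewrite Normc.normcM normc_real ger0_norm// exprn_ge0.
have := integrable_ae (@measurable_sphere R n.+1)
  (integrable_radial (measurable_normc mP) (fun x => normc_ge0 _) Poo).
apply: filterS => u /= h Su; under eq_integral do rewrite ni.
have := h Su; rewrite ge0_fin_numE//.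
by apply: integral_ge0 => s _; rewrite lee_fin mulr_ge0 ?normc_ge0// exprn_ge0.
Qed.

Lemma cintegral_polar (Phi : T -> R[i]) : cintegrable (lebn n.+1) setT Phi ->
  cintegrable sigma sphere (fun u => cintegral leb setT (radial Phi u)) /\
  cintegral sigma sphere (fun u => cintegral leb setT (radial Phi u)) =
  2%:C * cintegral (lebn n.+1) setT Phi.
Proof.
move=> [iRe iIm].
have ER u : \int[leb]_s complex.Re (radial Phi u s) =
    \int[leb]_s (complex.Re (Phi (scale_tuple s u)) * `|s| ^+ n).
  by apply: eq_Rintegral => s _; rewrite Re_Mreal.
have EI u : \int[leb]_s complex.Im (radial Phi u s) =
    \int[leb]_s (complex.Im (Phi (scale_tuple s u)) * `|s| ^+ n).
  by apply: eq_Rintegral => s _; rewrite Im_Mreal.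
have [r1 r2] := integral_polar iRe; have [i1 i2] := integral_polar iIm.
split.
- split.
  + rewrite (_ : _ \o _ = EFin \o
      (fun u => \int[leb]_s (complex.Re (Phi (scale_tuple s u)) * `|s| ^+ n)))//.
    by apply/funext => u /=; rewrite ER.
  + rewrite (_ : _ \o _ = EFin \o
      (fun u => \int[leb]_s (complex.Im (Phi (scale_tuple s u)) * `|s| ^+ n)))//.
    by apply/funext => u /=; rewrite EI.
- apply: complexP; rewrite ?ReM ?ImM /cintegral/= mul0r ?subr0 ?addr0.
  + rewrite -r2; apply: eq_Rintegral => u _; exact: ER.
  + rewrite -i2; apply: eq_Rintegral => u _; exact: EI.
Qed.

End polar_integrable.

Lemma conjcM {R : rcfType} (x y : R[i]) : conjc (x * y) = conjc x * conjc y.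
Proof. exact: rmorphM. Qed.

(** * The Stockwell transform *)

Section windows.
Context {R : realType}.
Local Notation leb := (@lebesgue_measure R).
Local Notation normc := (@Normc.normc R).

Lemma cintegral_affine (a b : R) (g : R -> R[i]) : a != 0 -> cintegrable leb setT g ->
  cintegrable leb setT (fun x => g (a * x + b)) /\
  cintegral leb setT (fun x => g (a * x + b)) = (`|a|^-1)%:C * cintegral leb setT g.
Proof.
move=> a0 [i1 i2]; split.
  by split; [exact: (integrable_affine b a0 i1)|exact: (integrable_affine b a0 i2)].
apply: complexP; rewrite ?ReM ?ImM /cintegral/= mul0r ?subr0 ?addr0.
- exact: (Rintegral_affine b a0 i1).
- exact: (Rintegral_affine b a0 i2).
Qed.

Lemma schwartz_cmeas (g : R -> R[i]) : schwartz g -> cmeas g.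
Proof.
move=> [sg _]; split; apply: continuous_measurable_fun => x.
- have [+ _] := sg 0%N x; rewrite derive1n0 => h.
  by apply: differentiable_continuous; apply/derivable1_diffP.
- have [_ +] := sg 0%N x; rewrite derive1n0 => h.
  by apply: differentiable_continuous; apply/derivable1_diffP.
Qed.

Lemma schwartz_bounds (g : R -> R[i]) (j : nat) : schwartz g ->
  exists2 C : R, 0 <= C & forall x, `|x| ^+ j * normc (g x) <= C.
Proof.
move=> [_ /(_ j 0%N)[C HC]]; exists C.
  by apply: le_trans (HC 0); rewrite mulr_ge0 ?exprn_ge0 ?normc_ge0.
move=> x; have := HC x; rewrite /cderive1n !derive1n0.
by rewrite (_ : _ +i* _ = g x)//; exact: complexP.
Qed.

Lemma schwartz_bounded (g : R -> R[i]) : schwartz g ->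
  exists C : R, forall x, normc (g x) <= C.
Proof.
move=> /(schwartz_bounds 0)[C _ H]; exists C => x.
by have := H x; rewrite expr0 mul1r.
Qed.

(** The bounds on [|g|] and on [x^2 |g|] add up to [|g| <= (C0 + C2) / (1 + x^2)], an integrable
    majorant. *)
Lemma schwartz_cintegrable (g : R -> R[i]) : schwartz g -> cintegrable leb setT g.
Proof.
move=> sg; have mg := schwartz_cmeas sg.
have [C0 C00 H0] := schwartz_bounds 0 sg; have [C2 C20 H2] := schwartz_bounds 2 sg.
(* [cauchy_kernel 1 x] is [2 / (1 + x^2)], hence the division by 2. *)
have iK := integrable_EFinZl ((C0 + C2) / 2) (integrable_cauchy_kernel (@ltr01 R)).
have H x : normc (g x) <= (C0 + C2) / 2 * cauchy_kernel 1 x.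
  have d0 : 0 < 1 + x ^+ 2 by rewrite ltr_pwDl// sqr_ge0.
  rewrite /cauchy_kernel expr1n mulr1 mulrA divfK// ler_pdivlMr//.
  rewrite mulrDr mulr1 mulrC; have := H0 x; have := H2 x.
  by rewrite expr0 mul1r real_normK ?num_real// => h2 h0; exact: lerD.
have [m1 m2] := mg.
split; apply: (integrable_le _ iK) => // x.
- by apply: (le_trans (Re_le_normc _)); apply: (le_trans (H x)); exact: ler_norm.
- by apply: (le_trans (Im_le_normc _)); apply: (le_trans (H x)); exact: ler_norm.
Qed.

Lemma cL12_bounded {d} {T : measurableType d} (mu : {measure set T -> \bar R})
    (g : T -> R[i]) (C : R) : cintegrable mu setT g -> (forall x, normc (g x) <= C) ->
  cL12 mu g.
Proof.
move=> ig gC; have [mg g1] := (cintegrableP _ _).1 ig; split => //.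
(* A point of [T] is used to see that [C] is nonnegative; on an empty space the integral is 0. *)
have [[x0 _]|/forallNP T0] := pselect (exists x : T, True); last first.
  rewrite (_ : (\int[mu]_x _)%E = 0%E) ?ltry//.
  by rewrite (eq_integral (cst 0%E)) ?integral0// => x; have := T0 x.
have C0 : 0 <= C by apply: le_trans (gC x0); exact: normc_ge0.
have mn : measurable_fun setT (fun x => (normc (g x))%:E).
  by apply/measurable_EFinP; exact: measurable_normc.
have n0 x : setT x -> (0 <= (normc (g x))%:E)%E by rewrite lee_fin normc_ge0.
apply: (@le_lt_trans _ _ (\int[mu]_x (C%:E * (normc (g x))%:E))%E).
  apply: ge0_le_integral.
  - exact: measurableT.
  - by move=> x _; rewrite lee_fin nsqc_ge0.
  - exact: (measurable_nsqcE mg).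
  - exact: (measurable_funeM _ mn).
  - move=> x _; rewrite -EFinM lee_fin -sqr_normc expr2.
    by apply: ler_wpM2r; rewrite ?normc_ge0.
by rewrite (ge0_integralZl_EFin mu measurableT n0 mn C0) lte_mul_pinfty.
Qed.

End windows.

Section stockwell_fourier.
Context {R : realType} {n : nat}.
Local Notation leb := (@lebesgue_measure R).
Local Notation lebn := (lebesgue_tuple R n).
Local Notation normc := (@Normc.normc R).
Variables (psi : R -> R[i]) (C : R) (f : n.-tuple R -> R[i]) (u : n.-tuple R) (a : R).
Hypotheses (ipsi : cintegrable leb setT psi) (psiC : forall x, normc (psi x) <= C).
Hypotheses (fi : cintegrable lebn setT f) (a0 : a != 0).

Let mpsi : cmeas psi := cintegrable_meas ipsi.
Let mf : cmeas f := cintegrable_meas fi.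

Let G (z : n.-tuple R * R) : R[i] :=
  f z.1 * conjc (psi (a * (dotp z.1 u - z.2))) * expi (- (a * dotp z.1 u)).

Let mdot : measurable_fun setT (fun z : n.-tuple R * R => dotp z.1 u).
Proof.
by apply: measurable_dotp; [exact: measurable_fst|exact: measurable_cst].
Qed.

Let mG : cmeas G.
Proof.
apply: cmeasM.
  apply: cmeasM; first exact: (cmeas_comp mf measurable_fst).
  apply: cmeasJ; apply: (cmeas_comp mpsi); apply: measurable_funM => //.
  by apply: measurable_funB => //; exact: measurable_snd.
by apply: cmeas_expi; apply: measurable_funN; apply: measurable_funM.
Qed.

Let normG z : normc (G z) = normc (f z.1) * normc (psi (a * (dotp z.1 u - z.2))).
Proof. by rewrite /G !Normc.normcM normc_expi mulr1 normc_conjc. Qed.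

Let aN0 : - a != 0. Proof. by rewrite oppr_eq0. Qed.

(** For fixed [x] the integral of the modulus in [b] is [|f x|] times [|a|^-1] times the integral of
    [|psi|], because the window is only reflected, dilated and translated; what remains is
    integrable in [x]. *)
Let iG : cintegrable (lebn \x leb)%E setT G.
Proof.
apply: cintegrable_prod1; first exact: mG.
have mn : measurable_fun setT (fun t => (normc (psi t))%:E).
  by apply/measurable_EFinP; exact: measurable_normc.
have n0 t : (0 <= (normc (psi t))%:E)%E by rewrite lee_fin normc_ge0.
have mnf : measurable_fun setT (fun x => (normc (f x))%:E).
  by apply/measurable_EFinP; exact: measurable_normc.
set I := (\int[leb]_t (normc (psi t))%:E)%E.
have I0 : (0 <= `|- a|^-1%:E * I)%E.
  by rewrite mule_ge0 ?lee_fin ?invr_ge0//; exact: integral_ge0.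
have E x : (\int[leb]_b (normc (G (x, b)))%:E = (normc (f x))%:E * (`|- a|^-1%:E * I))%E.
  have h := ge0_integral_affine (a * dotp x u) aN0 mn n0.
  rewrite /I -h.
  have mh : measurable_fun setT (fun b : R => (normc (psi (- a * b + a * dotp x u)))%:E).
    exact: (measurableT_comp mn (measurable_affine (- a) (a * dotp x u))).
  rewrite -(ge0_integralZl_EFin leb measurableT (fun b _ => n0 _) mh (normc_ge0 _)).
  apply: eq_integral => b _; rewrite normG/= EFinM; congr (_ * (normc (psi _))%:E)%E.
  by ring.
under eq_integral => x _ do rewrite E.
have f0 x : setT x -> (0 <= (normc (f x))%:E)%E by rewrite lee_fin normc_ge0.
rewrite (ge0_integralZr lebn measurableT mnf f0 I0).
have Ioo : (I < +oo)%E by exact: (cintegrable_norm ipsi).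
apply: lte_mul_pinfty.
- by apply: integral_ge0 => x _; exact: f0.
- by rewrite ge0_fin_numE ?(cintegrable_norm fi)//; apply: integral_ge0 => x _; exact: f0.
- by rewrite lte_mul_pinfty// lee_fin invr_ge0.
Qed.

Let iGb b : cintegrable lebn setT (fun x => G (x, b)).
Proof.
apply: (cintegrable_le _ (cintegrableZl C%:C fi)) => [|x].
  exact: (cmeas_comp mG (pair2_measurable b)).
rewrite normG Normc.normcM normc_real mulrC ler_wpM2r ?normc_ge0//=.
exact: (le_trans (psiC _) (ler_norm _)).
Qed.

Let kappa : R := `|a| / (2 * pi) `^ (n%:R / 2).

Let stockwellE b : stockwell psi f u b a =
  kappa%:C * cintegral lebn setT (fun x => G (x, b)).
Proof. by []. Qed.

Lemma cintegrable_stockwell : cintegrable leb setT (fun b => stockwell psi f u b a).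
Proof. by apply: cintegrableZl; exact: (cfubini2 iG).1. Qed.

(** A bounded window against an integrable [f] gives a bound uniform in [b]. Combined with
    integrability in [b], it puts the transform in [L^2] of the line. The absolute value of [C]
    spares a discussion of its sign. *)
Lemma stockwell_bounded : exists M : R, forall b, normc (stockwell psi f u b a) <= M.
Proof.
pose I := (\int[lebn]_x (normc (f x))%:E)%E.
have I0 : (0 <= I)%E by apply: integral_ge0 => x _; rewrite lee_fin normc_ge0.
have Ioo : I \is a fin_num by rewrite ge0_fin_numE// (cintegrable_norm fi).
exists (normc kappa%:C * (2 * (`|C| * fine I))) => b.
rewrite stockwellE Normc.normcM ler_wpM2l ?normc_ge0//.
rewrite -lee_fin; apply: (le_trans (normc_cintegral_le (iGb b))).
rewrite EFinM; apply: lee_wpmul2l; first by rewrite lee_fin.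
have mnf : measurable_fun setT (fun x => (normc (f x))%:E).
  by apply/measurable_EFinP; exact: measurable_normc.
have f0 x : setT x -> (0 <= (normc (f x))%:E)%E by rewrite lee_fin normc_ge0.
rewrite EFinM fineK// /I -(ge0_integralZl_EFin lebn measurableT f0 mnf (normr_ge0 C)).
apply: ge0_le_integral.
- exact: measurableT.
- by move=> x _; rewrite lee_fin normc_ge0.
- by apply/measurable_EFinP; apply: measurable_normc; exact: (cintegrable_meas (iGb b)).
- exact: (measurable_funeM _ mnf).
- move=> x _; rewrite -EFinM lee_fin normG/= mulrC ler_wpM2r ?normc_ge0//.
  exact: (le_trans (psiC _) (ler_norm _)).
Qed.

Lemma cL12_stockwell : cL12 leb (fun b => stockwell psi f u b a).
Proof.
by have [M HM] := stockwell_bounded; exact: cL12_bounded cintegrable_stockwell HM.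
Qed.

(** After Fubini the substitution [t = a (x . u - b)] splits the phase [b w] into
    [w (x . u) - t w / a]. The second part builds the transform of [psi] at [w / a]; the first joins
    the phase [a (x . u)] and builds that of [f] at [(w + a) u]. The Jacobian [|a|^-1] cancels the
    [|a|] of the definition. *)
Lemma fourier_stockwell w : fourier (fun b => stockwell psi f u b a) w =
  (((2 * pi) `^ (n%:R / 2))^-1)%:C * conjc (fourier psi (w / a)) *
  fourier_tuple f (scale_tuple (w + a) u).
Proof.
pose H z : R[i] := G z * expi (- (z.2 * w)).
have iH : cintegrable (lebn \x leb)%E setT H.
  apply: cintegrable_Mexpi; first exact: iG.
  by apply: measurable_funN; apply: measurable_funM => //; exact: measurable_snd.
have [i1 e1] := cfubini1 iH; have [i2 e2] := cfubini2 iH.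
transitivity (kappa%:C *
    cintegral leb setT (fun b => cintegral lebn setT (fun x => H (x, b)))).
  rewrite -cintegralZl; last exact: i2.
  congr cintegral; apply/funext => b; rewrite stockwellE -mulrA; congr (_ * _).
  rewrite mulrC -cintegralZl; last exact: iGb.
  by congr cintegral; apply/funext => x; rewrite mulrC.
rewrite e2 -e1.
have inner x : cintegral leb setT (fun b => H (x, b)) =
    ((`|a|^-1)%:C * conjc (fourier psi (w / a))) *
      (f x * expi (- dotp x (scale_tuple (w + a) u))).
  pose K t : R[i] := conjc (psi t * expi (- (t * (w / a)))).
  have iK : cintegrable leb setT K.
    by apply: cintegrableJ; exact: (cintegrable_fourier (w / a) ipsi).
  have [iKa EKa] := cintegral_affine (a * dotp x u) aN0 iK.
  rewrite normrN in EKa.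
  have -> : conjc (fourier psi (w / a)) = cintegral leb setT K.
    by rewrite /K cintegralJ//; exact: (cintegrable_fourier (w / a) ipsi).
  rewrite -EKa mulrC -cintegralZl//.
  congr cintegral; apply/funext => b.
  rewrite /H /G /K/= conjcM conjc_expi dotp_scaler.
  have -> : a * (dotp x u - b) = - a * b + a * dotp x u by ring.
  have -> : - ((w + a) * dotp x u) = - (a * dotp x u) + (- (w * dotp x u)) by ring.
  have -> : - - ((- a * b + a * dotp x u) * (w / a)) = w * dotp x u + - (b * w).
    by field.
  rewrite !expiD.
  have -> : expi (- (w * dotp x u)) = conjc (expi (w * dotp x u)) by rewrite conjc_expi.
  (* The right side contains the phase [w (x . u)] with both signs. Since [ring] treats values of
     [expi] as atoms, this cancellation is supplied by hand. *)
  have h1 : conjc (expi (w * dotp x u)) * expi (w * dotp x u) = 1.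
    by rewrite conjc_expi -expiD addNr /expi cos0 sin0.
  rewrite -[LHS]mulr1 -h1; ring.
under [X in cintegral lebn setT X]eq_fun do rewrite inner.
rewrite cintegralZl; last exact: cintegrable_fourier_tuple.
rewrite mulrA; congr (_ * _); rewrite mulrA; congr (_ * _).
rewrite -rmorphM; congr (_%:C); rewrite /kappa mulrAC divff ?mul1r//.
by rewrite normr_eq0.
Qed.

End stockwell_fourier.

Section cL12_cLfun.
Context {d} {T : measurableType d} {R : realType}.
Variable mu : {measure set T -> \bar R}.
Local Notation normc := (@Normc.normc R).

Lemma cLfun_cL12 (f : T -> R[i]) : cLfun mu 1%E f -> cLfun mu 2%:E f -> cL12 mu f.
Proof.
move=> [m1 m2 L1] [_ _ L2]; split => //.
- move: L1; rewrite /finite_norm Lnorm1; apply: le_lt_trans.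
  rewrite le_eqVlt; apply/orP; left; apply/eqP; apply: eq_integral => x _.
  by rewrite /= ger0_norm ?normc_ge0.
- move: L2; rewrite /finite_norm unlock /= => /lty_poweRy; rewrite invr_eq0 pnatr_eq0.
  move=> /(_ isT); apply: le_lt_trans.
  rewrite le_eqVlt; apply/orP; left; apply/eqP; apply: eq_integral => x _.
  by rewrite -sqr_normc /= ger0_norm ?normc_ge0// powR_mulrn ?normc_ge0.
Qed.

End cL12_cLfun.

Lemma cintegral_neq0 {R : realType} (g : R -> R[i]) : cmeas g ->
  cintegral lebesgue_measure [set a : R | a != 0] g = cintegral lebesgue_measure setT g.
Proof.
move=> [m1 m2]; have -> : [set a : R | a != 0] = setT `\ (0 : R).
  by apply/seteqP; split => a /= => [/eqP ?|[_ /eqP]].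
have mD : measurable (setT `\ (0 : R)) by exact: measurableD.
by apply: complexP; congr fine; apply: (integral_setD1 mD);
  apply: measurable_funTS; apply/measurable_EFinP.
Qed.

(** * Slices at a fixed direction: from the integral in [b] to a product of two line integrals *)

Section stockwell_slices.
Context {R : realType} {m : nat}.
Local Notation leb := (@lebesgue_measure R).
Local Notation n := m.+1.
Local Notation lebn := (lebesgue_tuple R n.+1).
Local Notation T := (n.+1.-tuple R).
Local Notation normc := (@Normc.normc R).
Variables (psi eta : R -> R[i]) (f h : T -> R[i]).
Hypotheses (spsi : schwartz psi) (seta : schwartz eta).
Hypotheses (Lf : cL12 lebn f) (Lh : cL12 lebn h).

Let ipsi := schwartz_cintegrable spsi.
Let ieta := schwartz_cintegrable seta.
Let fi := cL12_integrable Lf.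
Let hi := cL12_integrable Lh.

Definition spectral_product (xi : T) : R[i] :=
  fourier_tuple f xi * conjc (fourier_tuple h xi).
Local Notation Phi := spectral_product.

Definition window_product (xi : R) : R[i] :=
  conjc (fourier psi (xi - 1)) * fourier eta (xi - 1).
Local Notation W := window_product.

(* The integrand in (u, a, xi) after Parseval's identity in b and the substitution
   xi := w / a + 1 of its frequency w. *)
Definition slice (z : (T * R) * R) : R[i] :=
  W z.2 * Phi (scale_tuple (z.1.2 * z.2) z.1.1) * (`|z.1.2| ^+ n)%:C.

Let cmeas_Phi : cmeas Phi.
Proof.
apply: cmeasM; first exact: (cmeas_fourier_tuple (cintegrable_meas fi)).
by apply: cmeasJ; exact: (cmeas_fourier_tuple (cintegrable_meas hi)).
Qed.

Let cmeas_W : cmeas W.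
Proof.
have ma : measurable_fun setT (fun xi : R => xi - 1) by exact: measurable_funB.
apply: cmeasM; first apply: cmeasJ.
- exact: (cmeas_comp (cmeas_fourier (cintegrable_meas ipsi)) ma).
- exact: (cmeas_comp (cmeas_fourier (cintegrable_meas ieta)) ma).
Qed.

Lemma cmeas_slice : cmeas slice.
Proof.
have m1 : measurable_fun setT (fun z : (T * R) * R => z.1.1).
  exact: (measurableT_comp measurable_fst measurable_fst).
have m2 : measurable_fun setT (fun z : (T * R) * R => z.1.2).
  exact: (measurableT_comp measurable_snd measurable_fst).
apply: cmeasM; first apply: cmeasM.
- exact: (cmeas_comp cmeas_W measurable_snd).
- apply: (cmeas_comp cmeas_Phi); apply: measurable_scale_tuple => //.
  by apply: measurable_funM => //; exact: measurable_snd.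
- apply: cmeas_real; apply: measurable_funX.
  exact: (measurableT_comp (@normr_measurable _ setT) m2).
Qed.

Section slice_stockwell.
Variables (u : T) (a : R).
Hypothesis a0 : a != 0.

Local Notation p := (fun b => stockwell psi f u b a).
Local Notation q := (fun b => stockwell eta h u b a).

Let Lp : cL12 leb p.
Proof.
by have [C HC] := schwartz_bounded spsi; exact: (cL12_stockwell u ipsi HC fi a0).
Qed.

Let Lq : cL12 leb q.
Proof.
by have [C HC] := schwartz_bounded seta; exact: (cL12_stockwell u ieta HC hi a0).
Qed.

Lemma cintegrable_stockwellM :
  cintegrable leb setT (fun b => p b * conjc (q b) * (`|a| ^+ m)%:C).
Proof.
have -> : (fun b => p b * conjc (q b) * (`|a| ^+ m)%:C) =
    (fun b => (`|a| ^+ m)%:C * (p b * conjc (q b))).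
  by apply/funext => b; rewrite mulrC.
by apply: cintegrableZl; exact: (cintegrable_polarization Lp Lq).
Qed.

(** The frequency [w = a xi - a] is chosen so that [w / a = xi - 1], the argument in the
    admissibility integrand, and [w + a = a xi]. The two normalizations [(2 pi)^(- d / 2)], with
    [d = n.+1] the dimension, multiply to [(2 pi)^-d]. *)
Let fourierM xi : fourier p (a * xi - a) * conjc (fourier q (a * xi - a)) =
  (((2 * pi) ^+ n.+1)^-1)%:C * (W xi * Phi (scale_tuple (a * xi) u)).
Proof.
have [C1 HC1] := schwartz_bounded spsi; have [C2 HC2] := schwartz_bounded seta.
rewrite (fourier_stockwell u ipsi HC1 fi a0) (fourier_stockwell u ieta HC2 hi a0).
have -> : (a * xi - a) / a = xi - 1 by field.
rewrite subrK.
set k := ((2 * pi) `^ (n.+1%:R / 2))^-1.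
have kJ : conjc k%:C = k%:C by apply: complexP; rewrite /= ?oppr0.
have -> : ((2 * pi) ^+ n.+1)^-1 = k * k.
  have p0 : 0 < 2 * pi :> R by rewrite mulr_gt0// pi_gt0.
  rewrite -invfM -powRD; last by rewrite (gt_eqF p0) implybT.
  by rewrite -splitr powR_mulrn// ltW.
rewrite !conjcM conjcK kJ /W /Phi [in RHS]rmorphM.
by ring.
Qed.

(** Parseval on the line costs [(2 pi)^-1], and the substitution [w = a xi - a] costs [|a|]. The
    latter raises the exponent from [m], the dimension minus two, to [n = m.+1], the exponent needed
    for polar coordinates. *)
Lemma cintegral_stockwellM :
  cintegral leb setT (fun b => p b * conjc (q b) * (`|a| ^+ m)%:C) =
  ((2 * pi)^-1 * ((2 * pi) ^+ n.+1)^-1)%:C *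
  cintegral leb setT (fun xi => slice ((u, a), xi)).
Proof.
have p0 : 2 * pi != 0 :> R by rewrite mulf_neq0 ?gt_eqF ?pi_gt0.
have [iG eG] := parseval1 Lp Lq.
have [iA eA] := cintegral_affine (- a) a0 iG.
pose J xi := W xi * Phi (scale_tuple (a * xi) u).
have JE : J = (fun xi => ((2 * pi) ^+ n.+1)%:C *
    (fourier p (a * xi - a) * conjc (fourier q (a * xi - a)))).
  apply/funext => xi; rewrite fourierM mulrA -rmorphM mulfV ?expf_neq0//=.
  by rewrite mul1r.
have iJ : cintegrable leb setT J by rewrite JE; exact: cintegrableZl.
have eJ : cintegral leb setT J = ((2 * pi) ^+ n.+1 * `|a|^-1 * (2 * pi))%:C *
    cintegral leb setT (fun b => p b * conjc (q b)).
  by rewrite JE (cintegralZl _ iA) eA eG !rmorphM/= !mulrA.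
have -> : (fun b => p b * conjc (q b) * (`|a| ^+ m)%:C) =
    (fun b => (`|a| ^+ m)%:C * (p b * conjc (q b))).
  by apply/funext => b; rewrite mulrC.
have -> : (fun xi => slice ((u, a), xi)) = (fun xi => (`|a| ^+ n)%:C * J xi).
  by apply/funext => xi; rewrite /slice/= mulrC.
rewrite (cintegralZl _ (cintegrable_polarization Lp Lq)) (cintegralZl _ iJ) eJ.
rewrite !mulrA -!rmorphM.
congr (real_complex _ _ * _).
have x0 : `|a| != 0 by rewrite normr_eq0.
have y0 : (2 * pi) ^+ n.+1 != 0 :> R by rewrite expf_neq0.
have key (p v x y : R) : 2 * p != 0 -> v != 0 -> x != 0 ->
    y = (2 * p)^-1 * v^-1 * (x * y) * (v * x^-1 * 2 * p).
  by rewrite mulf_eq0 negb_or => /andP[_ w0] v0 r0; field; rewrite w0 v0 r0.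
have -> : `|a| ^+ n = `|a| * `|a| ^+ m by exact: exprS.
exact: key.
Qed.

End slice_stockwell.

Section slice_fubini.
Variable u : T.
Hypothesis iA : cintegrable leb setT (admissibility_integrand n.+1 psi eta).
Hypothesis Zoo : (\int[leb]_s (normc (radial Phi u s))%:E < +oo)%E.

Let V (z : R * R) : R[i] := slice ((u, z.1), z.2).

Let mV : cmeas V.
Proof.
apply: (cmeas_comp cmeas_slice (phi := fun z : R * R => ((u, z.1), z.2))).
by apply/measurable_fun_pair => //; apply/measurable_fun_pair.
Qed.

Let mr : cmeas (radial Phi u).
Proof. exact: (cmeas_comp (cmeas_radial cmeas_Phi) (pair1_measurable u)). Qed.

Let ir : cintegrable leb setT (radial Phi u).
Proof. by apply/cintegrableP. Qed.

(** With [s = xi a], the weight [|a|^n] is [|xi|^-n |s|^n]: this is the separation of the variables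
    [xi] and [s]. *)
Let VE a xi : xi != 0 -> V (a, xi) =
  W xi * ((`|xi| ^+ n)^-1)%:C * radial Phi u (xi * a + 0).
Proof.
move=> xi0; rewrite /V /slice/= /radial addr0 (mulrC xi a) normrM exprMn.
have x0 : `|xi| ^+ n != 0 by rewrite expf_neq0// normr_eq0.
move: (W xi) (Phi _) => w p; rewrite -!mulrA; congr (_ * _).
rewrite [RHS]mulrCA -rmorphM; congr (_ * (real_complex _ _)).
by field.
Qed.

(** The Jacobian [|xi|^-1] of [s = xi a] joins [|xi|^-n] and completes the power [|xi|^-(n+1)] of
    the admissibility integrand, [n + 1] being the dimension. *)
Let int_normV xi : xi != 0 -> (\int[leb]_a (normc (V (a, xi)))%:E =
  (normc (admissibility_integrand n.+1 psi eta xi))%:E *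
  \int[leb]_s (normc (radial Phi u s))%:E)%E.
Proof.
move=> xi0.
have mn : measurable_fun setT (fun s => (normc (radial Phi u s))%:E).
  by apply/measurable_EFinP; exact: measurable_normc.
have n0 s : (0 <= (normc (radial Phi u s))%:E)%E by rewrite lee_fin normc_ge0.
have e := ge0_integral_affine 0 xi0 mn n0.
have ma : measurable_fun setT (fun a => (normc (radial Phi u (xi * a + 0)))%:E).
  exact: (measurableT_comp mn (measurable_affine xi 0)).
transitivity (\int[leb]_a ((normc (W xi * ((`|xi| ^+ n)^-1)%:C))%:E *
    (normc (radial Phi u (xi * a + 0)))%:E))%E.
  by apply: eq_integral => a _; rewrite (VE a xi0) Normc.normcM EFinM.
rewrite (ge0_integralZl_EFin leb measurableT (fun a _ => n0 _) ma (normc_ge0 _)).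
rewrite e muleA -EFinM.
have nr k : normc ((`|xi| ^+ k)^-1)%:C = (`|xi| ^+ k)^-1.
  by rewrite normc_real ger0_norm// invr_ge0 exprn_ge0.
rewrite /admissibility_integrand -/(W xi); move: (W xi) => w.
by rewrite !Normc.normcM !nr -mulrA -invfM -exprSr.
Qed.

(** Tonelli with the integral in [a] taken first: by [int_normV] the double integral is a product of
    two numbers, one finite by admissibility, the other by the choice of [u]. *)
Let iV : cintegrable (leb \x leb)%E setT V.
Proof.
apply: (cintegrable_prod2 (m1 := leb) (m2 := leb)); first exact: mV.
have mA : measurable_fun setT
    (fun xi => (normc (admissibility_integrand n.+1 psi eta xi))%:E).
  by apply/measurable_EFinP; apply: measurable_normc; exact: cintegrable_meas iA.
have Z0 : (0 <= \int[leb]_s (normc (radial Phi u s))%:E)%E.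
  by apply: integral_ge0 => s _; rewrite lee_fin normc_ge0.
have A0 xi : setT xi -> (0 <= (normc (admissibility_integrand n.+1 psi eta xi))%:E)%E.
  by rewrite lee_fin normc_ge0.
rewrite (_ : integral _ _ _ = (\int[leb]_xi
    ((normc (admissibility_integrand n.+1 psi eta xi))%:E *
    \int[leb]_s (normc (radial Phi u s))%:E))%E).
  rewrite (ge0_integralZr leb measurableT mA A0 Z0).
  apply: lte_mul_pinfty.
  - by apply: integral_ge0 => xi _; exact: A0.
  - by rewrite ge0_fin_numE ?(cintegrable_norm iA)//; apply: integral_ge0 => xi _; exact: A0.
  - exact: Zoo.
apply: ge0_ae_eq_integral.
- exact: measurableT.
- apply: (measurable_eintegral2 leb (h := fun z => (normc (V z))%:E)).
  by apply/measurable_EFinP; exact: measurable_normc mV.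
- exact: (emeasurable_funM mA (measurable_cst _)).
- by move=> xi _; apply: integral_ge0 => a _; rewrite lee_fin normc_ge0.
- by move=> xi _; rewrite mule_ge0// A0.
by apply: (ae_imply (mu := leb) _ (@ae_neq0 R)) => xi xi0 _; exact: int_normV.
Qed.

Let cint_V xi : xi != 0 -> cintegral leb setT (fun a => V (a, xi)) =
  cintegral leb setT (radial Phi u) * admissibility_integrand n.+1 psi eta xi.
Proof.
move=> xi0; have [i1 e1] := cintegral_affine 0 xi0 ir.
have -> : (fun a => V (a, xi)) =
    (fun a => W xi * ((`|xi| ^+ n)^-1)%:C * radial Phi u (xi * a + 0)).
  by apply/funext => a; exact: VE.
rewrite (cintegralZl _ i1) e1 [RHS]mulrC mulrA; congr (_ * _).
rewrite /admissibility_integrand -mulrA -/(W xi) -rmorphM; congr (_ * _).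
by rewrite -invfM -exprSr.
Qed.

Lemma slice_fubini :
  cintegrable leb setT (fun a => cintegral leb setT (fun xi => slice ((u, a), xi))) /\
  cintegral leb setT (fun a => cintegral leb setT (fun xi => slice ((u, a), xi))) =
  cintegral leb setT (radial Phi u) *
  cintegral leb setT (admissibility_integrand n.+1 psi eta).
Proof.
have [i1 e1] := cfubini1 iV; have [i2 e2] := cfubini2 iV.
split; first exact: i1.
rewrite [LHS]e1 -[LHS]e2 -(cintegralZl _ iA).
apply: ae_eq_cintegral.
- exact: cintegrable_meas i2.
- exact: cintegrable_meas (cintegrableZl _ iA).
by apply: (ae_imply (mu := leb) _ (@ae_neq0 R)) => xi; exact: cint_V.
Qed.

End slice_fubini.
End stockwell_slices.

(** Since [cintegral] has a value even for divergent integrals, the identity alone would not say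
    that the iterated integral exists; the first three clauses certify its three layers from the
    inside out. The middle one is stated for almost every [u] because it rests on the integrability
    of [Phi (s u) |s|^(n-1)] along the line through [u]. *)
Theorem proposition3p4 (R : realType) (n : nat) (n2 : (2 <= n)%N)
    (psi eta : R -> R[i])
    (psi_schwartz : schwartz psi) (psi_nontrivial : exists t, psi t != 0)
    (eta_rec : reconstruction_window n psi eta)
    (f h : n.-tuple R -> R[i])
    (f1 : cLfun (lebesgue_tuple R n) 1%E f)
    (f2 : cLfun (lebesgue_tuple R n) 2%:E f)
    (h1 : cLfun (lebesgue_tuple R n) 1%E h)
    (h2 : cLfun (lebesgue_tuple R n) 2%:E h) :
  let F (u : n.-tuple R) (a b : R) :=
    stockwell psi f u b a * conjc (stockwell eta h u b a)
      * (`|a| ^+ (n - 2))%:C in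
  let Fb (u : n.-tuple R) (a : R) := cintegral lebesgue_measure setT (F u a) in
  let Fba (u : n.-tuple R) :=
    cintegral lebesgue_measure [set a | a != 0] (Fb u) in
  [/\ forall u a, sphere u -> a != 0 ->
        cintegrable lebesgue_measure setT (F u a),
      {ae surface_measure, forall u, sphere u ->
        cintegrable lebesgue_measure [set a | a != 0] (Fb u)},
      cintegrable surface_measure sphere Fba &
      cintegral (lebesgue_tuple R n) setT (fun x => f x * conjc (h x)) =
        (admissibility_constant n psi eta)^-1
          * cintegral surface_measure sphere Fba].
Proof.
case: n => [|[|m]] // in n2 eta_rec f h f1 f2 h1 h2 *.
move=> F Fb Fba; have [seta iA C0] := eta_rec.
have Lf := cLfun_cL12 f1 f2; have Lh := cLfun_cL12 h1 h2.
have mS := @measurable_sphere R m.+2.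
pose leb := @lebesgue_measure R.
pose A := cintegral leb setT (admissibility_integrand m.+2 psi eta).
(* The first factor comes from Parseval in [b], the second from the normalization of the two
   transforms. *)
pose c : R := (2 * pi)^-1 * ((2 * pi) ^+ m.+2)^-1.
pose Phi := spectral_product f h.
pose Z u := cintegral leb setT (radial Phi u).
(* [U] agrees with [Fb] for [a != 0], and its joint measurability in [(u, a)] follows from that of
   [slice]; the null set [a = 0] does not affect the integral, so [X] coincides with [Fba] for every
   [u]. *)
pose U u a := c%:C * cintegral leb setT (fun xi => slice psi eta f h ((u, a), xi)).
have mU : cmeas (fun z => U z.1 z.2).
  apply: cmeasM; first exact: cmeas_cst.
  apply: (cmeas_cintegral1 leb
    (f := fun z => slice psi eta f h ((z.1.1, z.1.2), z.2))).
  apply: (cmeas_comp (cmeas_slice psi_schwartz seta Lf Lh)).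
  by apply/measurable_fun_pair; [apply/measurable_fun_pair|exact: measurable_snd];
    [exact: (measurableT_comp measurable_fst measurable_fst)|
     exact: (measurableT_comp measurable_snd measurable_fst)].
have FE u a : F u a =
    fun b => stockwell psi f u b a * conjc (stockwell eta h u b a) * (`|a| ^+ m)%:C.
  by rewrite /F subn2.
have FbE u a : a != 0 -> U u a = Fb u a.
  move=> a0; rewrite /Fb FE.
  by rewrite (cintegral_stockwellM psi_schwartz seta Lf Lh u a0).
have mD : measurable [set a : R | a != 0].
  have -> : [set a : R | a != 0] = setT `\ (0 : R).
    by apply/seteqP; split => a /= => [/eqP ?|[_ /eqP]].
  exact: measurableD.
have mUu u : cmeas (U u) := cmeas_comp mU (pair1_measurable u).
pose X u := cintegral leb setT (U u).
have mX : cmeas X by exact: (cmeas_cintegral1 leb mU).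
have FbaE u : X u = Fba u.
  rewrite /X -cintegral_neq0; last exact: mUu.
  by apply: eq_cintegral => a; exact: FbE.
have [iPhi ePhi] := parseval_tuple Lf Lh.
have ae_good := ae_radial_lty iPhi.
have good u : (\int[leb]_s (Normc.normc (radial Phi u s))%:E < +oo)%E ->
    cintegrable leb setT (U u) /\ X u = (c%:C * A) * Z u.
  move=> Zoo.
  have [i1 e1] := slice_fubini psi_schwartz seta Lf Lh iA Zoo.
  split; first exact: cintegrableZl.
  by rewrite /X (cintegralZl _ i1) e1 -mulrA; congr (_ * _); exact: mulrC.
have [iZ eZ] := cintegral_polar iPhi.
have ae_X : {ae surface_measure, forall u, sphere u -> (c%:C * A) * Z u = X u}.
  by apply: ae_imply ae_good => u hu Su; have [] := good _ (hu Su).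
have iX : cintegrable surface_measure sphere X.
  exact: (ae_eq_cintegrable_in mS mX ae_X (cintegrableZl_in mS _ iZ)).
have FbaX : Fba = X by apply/funext => u; rewrite FbaE.
split.
- move=> u a _ a0; rewrite FE.
  exact: (cintegrable_stockwellM psi_schwartz seta Lf Lh u a0).
- apply: ae_imply ae_good => u hu Su; have [[r1 r2] _] := good _ (hu Su).
  refine (@eq_cintegrable _ _ _ leb _ mD (U u) (Fb u) (FbE u) _).
  have sD := @subsetT _ [set a : R | a != 0].
  split.
  + by apply: (@integrableS _ _ _ leb setT _ _ measurableT mD sD).
  + by apply: (@integrableS _ _ _ leb setT _ _ measurableT mD sD).
- by rewrite FbaX.
- rewrite FbaX -(ae_eq_cintegral_in mS mX (cintegrableZl_in mS _ iZ) ae_X).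
  rewrite (cintegralZl_in mS _ iZ) eZ ePhi.
  apply: (mulfI C0); rewrite [RHS]mulrA mulfV// mul1r.
  rewrite /admissibility_constant -/leb -/A.
  set I := cintegral _ _ _.
  have p0 : (pi : R) != 0 by rewrite gt_eqF ?pi_gt0.
  (* The [2] is the double covering in polar coordinates and the power of [2 pi] comes from Parseval
     on the whole space; against [c] they leave exactly the [1 / pi] of the admissibility
     constant. *)
  have -> : (pi^-1)%:C = c%:C * (2%:C * ((2 * pi) ^+ m.+2)%:C) :> R[i].
    rewrite -!rmorphM; congr (real_complex _ _); rewrite /c.
    have : (2 * pi) ^+ m.+2 != 0 :> R by rewrite expf_neq0 ?mulf_neq0.
    have key (p k : R) : p != 0 -> k != 0 -> p^-1 = (2 * p)^-1 * k^-1 * (2 * k).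
      by move=> p1 k1; field; rewrite k1 p1.
    by move=> k0; exact: key.
  rewrite -!mulrA; congr (_ * _); rewrite [RHS]mulrCA; congr (_ * _).
  by rewrite [RHS]mulrCA.
Qed.
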